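(* Let $\mathfrak{C}\models T^*_\infty$ and let $a,b$ be finite tuples in $\mathfrak{C}$. If $\dim(a/b)=[d_0+d_1n]$, then $d_1$ is equal to the linear dimension $\dim_{\mathrm{Lin}}(a/b)$ of $V(a)$ over $V(b)$, that is, the size of a maximal subset of $V(a)$ which is $K$-linearly independent over $\mathrm{Lin}_K(V(b))$.
   Context: Theories: fix $p$ equal to $0$ or a prime different from $2$. $L$ is the two-sorted language with a sort $V$ (vectors) and a sort $K$ (scalars), with symbols for $0_V,0_K,1_K$, vector addition, field addition and multiplication, scalar multiplication, and a map $[\cdot,\cdot]:V\times V\to K$. For $m\in\omega\cup\{\infty\}$ let $T_m$ denote either of the two $L$-theories saying that $K$ is an algebraically closed field of characteristic $p$, $V$ is an $m$-dimensional $K$-vector space (infinite-dimensional if $m=\infty$) and $[\cdot,\cdot]$ is a nondegenerate symmetric, respectively nondegenerate alternating, $K$-bilinear form. $T^{RCF}_m$ denotes either of the analogous theories with $K$ real closed and $[\cdot,\cdot]$ symmetric positive-definite, respectively nondegenerate alternating. In the alternating case a finite $m$ is always even. $T^*_m$ means any of these ($*\in\{\mathrm{ACF}_p,\mathrm{RCF}\}$). $\mathfrak{C}=(V,K)$ is a fixed $\aleph_0$-saturated model of $T^*_\infty$. ''Definable'' means with parameters; definable sets are subsets of sorts $V^k\times K^m$. For a tuple $a$, $V(a)$ is the set of vectors occurring in $a$; $\mathrm{Lin}_K$ denotes $K$-linear span. Dimension of sets: for $N=(V_0,K)\models T^*_r$ with $r\in\omega$, $N$ is definable in the pure field $K$;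 $\mathrm{rk}_N$ denotes Morley rank in $N$ if $*=\mathrm{ACF}_p$, and if $*=\mathrm{RCF}$ the o-minimal (topological) dimension, computed after transporting the set by an $N$-definable bijection to a subset of some $K^n$; the empty set has rank $-1$. If $M\preceq\mathfrak{C}$ with $V(M)$ of countably infinite dimension over $K(M)$, an approximating sequence for $M$ is an increasing sequence $(N_r)_{r\in\omega}$ of substructures of $M$ with union $M$, $K(N_r)=K(M)$ and $N_r\models T^*_r$ (in the alternating case it is indexed by $r\in\{2,4,\dots\}$). Let $S$ be the group of functions $\omega\to\mathbb{Z}$ modulo equality at all but finitely many arguments, $[f]$ the class of $f$; $[d_0+d_1n]$ is the class of the linear function $n\mapsto d_0+d_1n$, and $S_{\mathrm{lin}}$ is the subgroup of such classes, ordered by eventual inequality (so isomorphic to $\mathbb{Z}\times\mathbb{Z}$ with lexicographic order, $d_1$ being dominant). For a non-empty definable $X\subseteq V^k$, choose $M\preceq\mathfrak{C}$ with $V(M)$ of countably infinite dimension over $K(M)$ such that $X$ is definable over $M$, and an approximating sequence $(N_r)$ for $M$, and put $\dim(X):=[r\mapsto \mathrm{rk}_{N_r}(X\cap N_r)]$ (in the alternating case the function is defined on even $r$); this is independent of choices and is always given by a linear function, so $\dim(X)\in S_{\mathrm{lin}}$. For definable $X\subseteq V^k\times K^m$, $\dim(X):=\dim(X')$ for any definable $X'\subseteq V^{k'}$ in definable bijection with $X$. One sets $\dim(\emptyset)=-1$. Dimension of types: for a type $\pi(x)$ over $A$ in finitely many variables, $\dim(\pi)$ is the infimum of $\dim(\phi(x))$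 over all formulas $\phi(x)$ over $A$ implied by $\pi$, taken in the Dedekind completion of $S_{\mathrm{lin}}$; it lies in $S_{\mathrm{lin}}$ when $A$ contains only finitely many vectors. $\dim(a/b):=\dim(\mathrm{tp}(a/b))$. *)

(* Defs.v *)
From HB Require Import structures.
From mathcomp Require Import all_boot all_order all_algebra.
From mathcomp Require Import boolp classical_sets functions.

Set Implicit Arguments.
Unset Strict Implicit.
Unset Printing Implicit Defensive.

Import Order.TTheory GRing.Theory Num.Theory.
Local Open Scope classical_set_scope.
Local Open Scope ring_scope.

(* L-structures whose sort K is a field and whose sort V is a K-vector space.
   The form is an arbitrary map here; bilinearity belongs to the theories. *)
Record lstruct := LStruct {
  scal : fieldType;
  vect : lmodType scal;
  bform : vect -> vect -> scal }.

(* The two-sorted language L, with de Bruijn variables, one numbering per sort;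
   VEx and KEx bind variable 0 of their sort.  The remaining connectives are
   classically definable from these. *)
Inductive vterm :=
  | VVar of nat | VZero | VAdd of vterm & vterm | VScale of kterm & vterm
with kterm :=
  | KVar of nat | KZero | KOne | KAdd of kterm & kterm | KMul of kterm & kterm
  | KForm of vterm & vterm.

Inductive formula :=
  | VEq of vterm & vterm
  | KEq of kterm & kterm
  | FNot of formula
  | FAnd of formula & formula
  | VEx of formula
  | KEx of formula.

(* Valuations are finite sequences; a variable beyond the end of its sequence
   denotes the constant 0 of its sort, so it is never an extra parameter. *)
Fixpoint veval (N : lstruct) (vs : seq (vect N)) (ks : seq (scal N))
    (t : vterm) : vect N :=
  match t with
  | VVar i => vs`_i
  | VZero => 0
  | VAdd t1 t2 => veval vs ks t1 + veval vs ks t2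
  | VScale c t1 => keval vs ks c *: veval vs ks t1
  end
with keval (N : lstruct) (vs : seq (vect N)) (ks : seq (scal N))
    (t : kterm) : scal N :=
  match t with
  | KVar i => ks`_i
  | KZero => 0
  | KOne => 1
  | KAdd t1 t2 => keval vs ks t1 + keval vs ks t2
  | KMul t1 t2 => keval vs ks t1 * keval vs ks t2
  | KForm t1 t2 => bform (veval vs ks t1) (veval vs ks t2)
  end.

Fixpoint holds (N : lstruct) (vs : seq (vect N)) (ks : seq (scal N))
    (phi : formula) : Prop :=
  match phi with
  | VEq t1 t2 => veval vs ks t1 = veval vs ks t2
  | KEq t1 t2 => keval vs ks t1 = keval vs ks t2
  | FNot phi1 => ~ holds vs ks phi1
  | FAnd phi1 phi2 => holds vs ks phi1 /\ holds vs ks phi2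
  | VEx phi1 => exists v, holds (v :: vs) ks phi1
  | KEx phi1 => exists c, holds vs (c :: ks) phi1
  end.

(* Substructures and elementary substructures are given by embeddings, the
   substructure proper being the image. *)
Record lembedding (M N : lstruct) := LEmbedding {
  embV : {additive vect M -> vect N};
  embK : {rmorphism scal M -> scal N};
  embV_inj : injective embV;
  embZ : forall c v, embV (c *: v) = embK c *: embV v;
  embF : forall u v, bform (embV u) (embV v) = embK (bform u v) }.

Record elementary (M N : lstruct) := Elementary {
  elV : vect M -> vect N;
  elK : scal M -> scal N;
  elP : forall vs ks phi,
    holds vs ks phi <-> holds (map elV vs) (map elK ks) phi }.

(* Points of V^k x K^m. *)
Definition pt (N : lstruct) (k m : nat) : Type :=
  (k.-tuple (vect N) * m.-tuple (scal N))%type.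

Definition pt_map (M N : lstruct) (fV : vect M -> vect N)
    (fK : scal M -> scal N) k m (x : pt M k m) : pt N k m :=
  (map_tuple fV x.1, map_tuple fK x.2).

Definition pt_cat (N : lstruct) k m k' m' (x : pt N k m) (y : pt N k' m') :
    pt N (k + k') (m + m') :=
  (cat_tuple x.1 y.1, cat_tuple x.2 y.2).

Definition defset (N : lstruct) k m (phi : formula)
    (pv : seq (vect N)) (pk : seq (scal N)) : set (pt N k m) :=
  [set x : pt N k m | holds (x.1 ++ pv) (x.2 ++ pk) phi].

Definition definable_over (N : lstruct) (AV : set (vect N)) (AK : set (scal N))
    k m (X : set (pt N k m)) : Prop :=
  exists (phi : formula) (pv : seq (vect N)) (pk : seq (scal N)),
    [/\ forall v, v \in pv -> AV v, forall c, c \in pk -> AK c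
      & X = defset phi pv pk].

Definition definable (N : lstruct) k m (X : set (pt N k m)) : Prop :=
  definable_over setT setT X.

Definition def_bijection (N : lstruct) k m k' m'
    (X : set (pt N k m)) (Y : set (pt N k' m')) : Prop :=
  exists2 f : pt N k m -> pt N k' m', set_bij X Y f
    & definable [set z | exists2 x, X x & z = pt_cat x (f x)].

(* Realization of finitely satisfiable partial types, in finitely many
   variables, over finitely many parameters. *)
Definition aleph0_saturated (N : lstruct) : Prop :=
  forall k m (pv : seq (vect N)) (pk : seq (scal N)) (Phi : set formula),
    (forall n (phi : 'I_n -> formula), (forall i, Phi (phi i)) ->
       exists x : pt N k m, forall i, defset (phi i) pv pk x) ->
    exists x : pt N k m, forall phi, Phi phi -> defset phi pv pk x.

Section LinearAlgebra.
Variables (K : fieldType) (V : lmodType K).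

Definition Lin (s : seq V) : set V :=
  [set v | exists c : 'I_(size s) -> K, v = \sum_(i < size s) c i *: s`_i].

Definition lin_indep_over (W : set V) (s : seq V) : Prop :=
  forall c : 'I_(size s) -> K,
    W (\sum_(i < size s) c i *: s`_i) -> forall i, c i = 0.

Definition lin_indep (s : seq V) : Prop := lin_indep_over [set 0] s.

Definition has_dim (m : nat) : Prop :=
  exists e : seq V, [/\ size e = m, lin_indep e & forall v, Lin e v].

Definition countably_infinite_dim : Prop :=
  exists e : nat -> V, (forall n, lin_indep (mkseq e n)) /\
    (forall v, exists n, Lin (mkseq e n) v).

(* Independent sequences have no repetition, so s enumerates a subset of a. *)
Definition maximal_indep (a b s : seq V) : Prop :=
  [/\ {subset s <= a}, lin_indep_over (Lin b) s
    & forall t, {subset t <= a} -> lin_indep_over (Lin b) t ->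
        {subset s <= t} -> {subset t <= s}].

(* The linear dimension of a over b equals d. *)
Definition lin_dim_eq (a b : seq V) (d : int) : Prop :=
  (exists s, maximal_indep a b s) /\
  (forall s, maximal_indep a b s -> (size s)%:Z = d).

End LinearAlgebra.

Inductive scal_theory := ACF of nat | RCF.
Inductive form_theory := Symmetric | Alternating.

Definition admissible (F : scal_theory) : Prop :=
  if F is ACF p then p = 0%N \/ (prime p /\ p != 2%N) else True.

Definition has_char (K : fieldType) (p : nat) : Prop :=
  if p is 0%N then [pchar K] =i pred0 else p \in [pchar K].

Definition real_closed (K : fieldType) : Prop :=
  exists (R : rcfType) (f : {rmorphism K -> R}), bijective f.

(* The order of a real closed field, where positive means nonzero square. *)
Definition sq_lt (K : fieldType) (x y : K) : Prop :=
  exists2 z : K, z != 0 & y - x = z ^+ 2.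

Definition scal_model (F : scal_theory) (K : fieldType) : Prop :=
  match F with
  | ACF p => GRing.closed_field_axiom K /\ has_char K p
  | RCF => real_closed K
  end.

Definition nondegenerate_form (N : lstruct) : Prop :=
  forall u : vect N, (forall v, bform u v = 0) -> u = 0.

Definition form_model (F : scal_theory) (B : form_theory) (N : lstruct) :
    Prop :=
  bilinear_for *%R *%R (@bform N) /\
  match B with
  | Symmetric =>
      (forall u v : vect N, bform u v = bform v u) /\
      match F with
      | ACF _ => nondegenerate_form N
      | RCF => forall u : vect N, u != 0 -> sq_lt 0 (bform u u)
      end
  | Alternating => (forall u : vect N, bform u u = 0) /\ nondegenerate_form N
  end.

(* N is a model of T^*_m; None stands for m = oo. *)
Definition model (F : scal_theory) (B : form_theory) (m : option nat)
    (N : lstruct) : Prop :=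
  [/\ scal_model F (scal N),
      if m is Some n then has_dim (vect N) n
      else forall n, ~ has_dim (vect N) n
    & form_model F B N].

(* z is the largest d with ge d, or -1 if there is none because ge 0 fails. *)
Definition rank_of (ge : nat -> Prop) (z : int) : Prop :=
  (z = -1 /\ ~ ge 0%N) \/
  (exists d : nat, [/\ z = d%:Z, ge d & forall d', ge d' -> (d' <= d)%N]).

(* Morley rank >= n, computed inside N (to be used in aleph_0-saturated N). *)
Fixpoint morley_ge (N : lstruct) k m (n : nat) (X : set (pt N k m)) : Prop :=
  if n is n'.+1 then
    exists Y : nat -> set (pt N k m),
      [/\ forall i, definable (Y i), forall i, Y i `<=` X,
          forall i j, i <> j -> Y i `&` Y j = set0
        & forall i, morley_ge n' (Y i)]
  else X !=set0.

(* Morley rank in an arbitrary structure: pass to an aleph_0-saturated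
   elementary extension. *)
Definition morley_rank (N : lstruct) k m (X : set (pt N k m)) (z : int) :
    Prop :=
  exists (N' : lstruct) (e : elementary N N') (phi : formula)
    (pv : seq (vect N)) (pk : seq (scal N)),
    [/\ aleph0_saturated N', X = defset phi pv pk
      & rank_of (fun n => morley_ge n
          (defset phi (map (elV e) pv) (map (elK e) pk) : set (pt N' k m))) z].

(* Some projection of Y onto d coordinates contains an open box. *)
Definition omin_ge (N : lstruct) n (Y : set (pt N 0 n)) (d : nat) : Prop :=
  exists sigma : 'I_d -> 'I_n, injective sigma /\
  exists lo hi : 'I_d -> scal N, (forall i, sq_lt (lo i) (hi i)) /\
  forall z : 'I_d -> scal N,
    (forall i, sq_lt (lo i) (z i) /\ sq_lt (z i) (hi i)) ->
    exists2 y, Y y & forall i, tnth y.2 (sigma i) = z i.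

Definition omin_dim (N : lstruct) k m (X : set (pt N k m)) (z : int) : Prop :=
  exists n (Y : set (pt N 0 n)),
    [/\ definable X, definable Y, def_bijection X Y & rank_of (omin_ge Y) z].

Definition rk (F : scal_theory) (N : lstruct) k m (X : set (pt N k m))
    (z : int) : Prop :=
  match F with
  | ACF _ => morley_rank X z
  | RCF => omin_dim X z
  end.

(* The indices r for which T^*_r is used in approximating sequences. *)
Definition form_index (B : form_theory) (r : nat) : bool :=
  if B is Alternating then (0 < r)%N && ~~ odd r else true.

Definition approximating (F : scal_theory) (B : form_theory) (M : lstruct)
    (N : nat -> lstruct) (j : forall r, lembedding (N r) M) : Prop :=
  [/\ forall r, form_index B r -> model F B (Some r) (N r),
      forall r, form_index B r -> range (embK (j r)) = setT,
      forall r s, form_index B r -> form_index B s -> (r <= s)%N ->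
        range (embV (j r)) `<=` range (embV (j s))
    & forall v, exists2 r, form_index B r & range (embV (j r)) v].

Definition eventually_rel (B : form_theory) (R : int -> int -> Prop)
    (f g : nat -> int) : Prop :=
  exists n0, forall n, (n0 <= n)%N -> form_index B n -> R (f n) (g n).

(* Elements of the group S are the equivalence classes [f], as sets of
   functions; only values at the indices of B matter. *)
Definition germ (B : form_theory) (f : nat -> int) : set (nat -> int) :=
  [set g | eventually_rel B eq f g].

Definition germ_le (B : form_theory) (s t : set (nat -> int)) : Prop :=
  exists f g, [/\ s f, t g & eventually_rel B (fun x y => x <= y) f g].

(* [d0 + d1 n] *)
Definition lin_germ (B : form_theory) (d0 d1 : int) : set (nat -> int) :=
  germ B (fun n => d0 + d1 * n%:Z).

Definition S_lin (B : form_theory) : set (set (nat -> int)) :=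
  [set s | exists d0 d1, s = lin_germ B d0 d1].

(* The Dedekind completion of S_lin, by lower cuts: an element s of S_lin is
   identified with the cut of all t <= s, and the infimum of a family is the
   cut of its lower bounds, i.e. the intersection of the associated cuts. *)
Definition cut (B : form_theory) (s : set (nat -> int)) :
    set (set (nat -> int)) :=
  [set t | S_lin B t /\ germ_le B t s].

Definition inf_cut (B : form_theory) (D : set (set (nat -> int))) :
    set (set (nat -> int)) :=
  [set t | S_lin B t /\ forall s, D s -> germ_le B t s].

(* s is the dimension of a definable subset X of V^k.  The rank of the empty
   set being -1, the dimension of the empty set comes out as [-1]. *)
Definition dim_vect_set (F : scal_theory) (B : form_theory) (C : lstruct) k
    (X : set (pt C k 0)) (s : set (nat -> int)) : Prop :=
  exists (M : lstruct) (e : elementary M C) (N : nat -> lstruct)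
    (j : forall r, lembedding (N r) M) (f : nat -> int),
    [/\ countably_infinite_dim (vect M),
        definable_over (range (elV e)) (range (elK e)) X,
        approximating F B j,
        exists n0, forall r, (n0 <= r)%N -> form_index B r ->
          rk F [set x : pt (N r) k 0 |
                 X (pt_map (elV e) (elK e) (pt_map (embV (j r)) (embK (j r)) x))]
               (f r)
      & s = germ B f].

Definition dim_set (F : scal_theory) (B : form_theory) (C : lstruct) k m
    (X : set (pt C k m)) (s : set (nat -> int)) : Prop :=
  exists k' (X' : set (pt C k' 0)),
    [/\ definable X', def_bijection X X' & dim_vect_set F B X' s].

(* A type in variables (x in V^k x K^m) over the finite tuple b is the set of
   formulas phi(x, y) for which phi(x, b) belongs to the type. *)
Definition tp (C : lstruct) k m k' m' (a : pt C k m) (b : pt C k' m') :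
    set formula :=
  [set phi | defset phi b.1 b.2 a].

Definition implied (C : lstruct) k m k' m' (b : pt C k' m')
    (Pi : set formula) (phi : formula) : Prop :=
  forall (C' : lstruct) (e : elementary C C') (x : pt C' k m),
    let b' := pt_map (elV e) (elK e) b in
    (forall psi, Pi psi -> defset psi b'.1 b'.2 x) -> defset phi b'.1 b'.2 x.

Definition dim_type (F : scal_theory) (B : form_theory) (C : lstruct)
    k m k' m' (b : pt C k' m') (Pi : set formula) : set (set (nat -> int)) :=
  inf_cut B [set s | exists2 phi, @implied C k m k' m' b Pi phi
    & dim_set F B (defset phi b.1 b.2 : set (pt C k m)) s].

Definition dim_over (F : scal_theory) (B : form_theory) (C : lstruct)
    k m k' m' (a : pt C k m) (b : pt C k' m') : set (set (nat -> int)) :=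
  @dim_type F B C k m k' m' b (tp a b).

(* Main.v *)
(* Fix a maximal independent s in V(a) over V(b), of size e.

   Upper bound: the set of x all of whose vectors lie in the span of b and of
   the coordinates of x corresponding to s is definable over b and contains a.
   In a model of dimension r it is parametrized by e r + O(1) scalars, so its
   dimension is at most [D + e n] for some constant D.

   Lower bound: let X be definable over b and contain a, and let X' be a
   definable image of X in V^k', defined over P.  Moving a by an isometry fixing
   b, one may take s independent over P, and then V(x'), for the image x' of a,
   contains e vectors independent over P: a vector of a outside the span of x'
   and P could be moved by a transvection fixing x' and P.  Products of e
   transvections fixing P move these e vectors within X', and the axes can be
   recovered from the images up to O(1) scalars; hence X' has dimension at least
   e r - O(1) in the r-dimensional submodel.

   Both ranks are compared with one combinatorial dimension: call a set of
   tuples of scalars null if it is small in the sense of iterated Fubini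
   (finitely many exceptions at each coordinate), and let the dimension be the
   largest number of coordinates onto which the projection is not null.
   Quantifier elimination for the scalars shows that this dimension behaves well
   and bounds Morley rank and o-minimal dimension on both sides.

   A countable-dimensional elementary submodel with an approximating sequence is
   obtained by extending a finite regular sequence containing the parameters to
   a basis e_0, e_1, ... all of whose initial segments (of even length, in the
   alternating case) are regular; by Witt's theorem its span is an elementary
   substructure. *)

From HB Require Import structures.
From Stdlib Require List.
From mathcomp Require Import all_boot all_order all_algebra.
From mathcomp Require Import boolp classical_sets functions.
From mathcomp Require Import closed_field zify ring lra.
From mathcomp Require ordered_qelim qe_rcf.
Require Import Defs.

Set Implicit Arguments.
Unset Strict Implicit.
Unset Printing Implicit Defensive.

Import Order.TTheory GRing.Theory Num.Theory.
Local Open Scope classical_set_scope.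
Local Open Scope ring_scope.

(** * Substitution and uniform definability *)

(* The obstacle is that the two ranks are given in unlike ways: Morley rank through an arbitrary
   saturated elementary extension, o-minimal dimension through an arbitrary definable bijection.
   Nullity is not first order and would be lost on the way to the extension. Hence the uniform
   version [thin D], where each exceptional set has a prescribed size: for definable sets of scalars
   it agrees with nullity, and it passes along elementary maps. Conversely, to bound Morley rank
   from above the finite-dimensional submodel must be saturated itself; it is, being interpreted in
   the saturated model with finitely many parameters. Coordinates are read off as values of the form
   on a dual basis, so that every coordinate map is a term of the language. Only slopes are
   compared, so an error term need only be independent of r. The lower bound enters through the
   infimum: were d1 smaller than the linear dimension, the class [d0 + 1 + d1 n] would lie below the
   dimension of every set in the type, and [d0 + d1 n] would not be their infimum. *)
Scheme vterm_mut := Induction for vterm Sort Prop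
  with kterm_mut := Induction for kterm Sort Prop.
Combined Scheme vkterm_ind from vterm_mut, kterm_mut.

(** Missing entries are replaced by the zero of their sort, in agreement with the reading of
    variables beyond the end of a valuation; so [holds_fsubst] needs no bound on the variables of
    the formula. *)
Fixpoint vsubst (tv : seq vterm) (tk : seq kterm) (t : vterm) : vterm :=
  match t with
  | VVar i => nth VZero tv i
  | VZero => VZero
  | VAdd t1 t2 => VAdd (vsubst tv tk t1) (vsubst tv tk t2)
  | VScale c t1 => VScale (ksubst tv tk c) (vsubst tv tk t1)
  end
with ksubst (tv : seq vterm) (tk : seq kterm) (t : kterm) : kterm :=
  match t with
  | KVar i => nth KZero tk i
  | KZero => KZero
  | KOne => KOne
  | KAdd t1 t2 => KAdd (ksubst tv tk t1) (ksubst tv tk t2)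
  | KMul t1 t2 => KMul (ksubst tv tk t1) (ksubst tv tk t2)
  | KForm t1 t2 => KForm (vsubst tv tk t1) (vsubst tv tk t2)
  end.

Fixpoint vshift (a b : nat) (t : vterm) : vterm :=
  match t with
  | VVar i => VVar (a + i)
  | VZero => VZero
  | VAdd t1 t2 => VAdd (vshift a b t1) (vshift a b t2)
  | VScale c t1 => VScale (kshift a b c) (vshift a b t1)
  end
with kshift (a b : nat) (t : kterm) : kterm :=
  match t with
  | KVar i => KVar (b + i)
  | KZero => KZero
  | KOne => KOne
  | KAdd t1 t2 => KAdd (kshift a b t1) (kshift a b t2)
  | KMul t1 t2 => KMul (kshift a b t1) (kshift a b t2)
  | KForm t1 t2 => KForm (vshift a b t1) (vshift a b t2)
  end.

Fixpoint fsubst (tv : seq vterm) (tk : seq kterm) (phi : formula) : formula :=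
  match phi with
  | VEq t1 t2 => VEq (vsubst tv tk t1) (vsubst tv tk t2)
  | KEq t1 t2 => KEq (ksubst tv tk t1) (ksubst tv tk t2)
  | FNot phi1 => FNot (fsubst tv tk phi1)
  | FAnd phi1 phi2 => FAnd (fsubst tv tk phi1) (fsubst tv tk phi2)
  | VEx phi1 =>
      VEx (fsubst (VVar 0 :: map (vshift 1 0) tv) (map (kshift 1 0) tk) phi1)
  | KEx phi1 =>
      KEx (fsubst (map (vshift 0 1) tv) (KVar 0 :: map (kshift 0 1) tk) phi1)
  end.

Section Substitution.
Variable N : lstruct.
Implicit Types (vs : seq (vect N)) (ks : seq (scal N)).

Lemma nth_map_default (T1 T2 : Type) (x1 : T1) (x2 : T2) (f : T1 -> T2) s i :
  f x1 = x2 -> nth x2 (map f s) i = f (nth x1 s i).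
Proof.
move=> fx; have [lt_is|le_si] := ltnP i (size s); first exact: nth_map.
by rewrite !nth_default ?size_map // fx.
Qed.

Lemma vkeval_subst vs ks tv tk :
  (forall t, veval vs ks (vsubst tv tk t)
     = veval (map (veval vs ks) tv) (map (keval vs ks) tk) t) /\
  (forall t, keval vs ks (ksubst tv tk t)
     = keval (map (veval vs ks) tv) (map (keval vs ks) tk) t).
Proof.
apply: vkterm_ind => //=; try by move=> *; congruence.
- by move=> i; rewrite (@nth_map_default _ _ VZero).
- by move=> i; rewrite (@nth_map_default _ _ KZero).
Qed.

Lemma vkeval_shift us vs ls ks :
  (forall t, veval (us ++ vs) (ls ++ ks) (vshift (size us) (size ls) t)
     = veval vs ks t) /\
  (forall t, keval (us ++ vs) (ls ++ ks) (kshift (size us) (size ls) t)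
     = keval vs ks t).
Proof.
apply: vkterm_ind => //=; try by move=> *; congruence.
- by move=> i; rewrite nth_cat ltnNge leq_addr /= addKn.
- by move=> i; rewrite nth_cat ltnNge leq_addr /= addKn.
Qed.

Lemma holds_fsubst phi : forall vs ks tv tk,
  holds vs ks (fsubst tv tk phi)
  <-> holds (map (veval vs ks) tv) (map (keval vs ks) tk) phi.
Proof.
elim: phi => [t1 t2|t1 t2|phi IH|phi IH psi IH'|phi IH|phi IH] vs ks tv tk /=.
- by rewrite !(vkeval_subst vs ks tv tk).1.
- by rewrite !(vkeval_subst vs ks tv tk).2.
- by rewrite IH.
- by rewrite IH IH'.
- have E v : map (veval (v :: vs) ks) (map (vshift 1 0) tv) = map (veval vs ks) tv.
    by rewrite -map_comp; apply: eq_map => t /=; rewrite ((vkeval_shift [:: v] vs [::] ks).1 t).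
  have E' v : map (keval (v :: vs) ks) (map (kshift 1 0) tk) = map (keval vs ks) tk.
    by rewrite -map_comp; apply: eq_map => t /=; rewrite ((vkeval_shift [:: v] vs [::] ks).2 t).
  by split=> -[v hv]; exists v; move: hv; rewrite IH /= E E'.
- have E c : map (veval vs (c :: ks)) (map (vshift 0 1) tv) = map (veval vs ks) tv.
    by rewrite -map_comp; apply: eq_map => t /=; rewrite ((vkeval_shift [::] vs [:: c] ks).1 t).
  have E' c : map (keval vs (c :: ks)) (map (kshift 0 1) tk) = map (keval vs ks) tk.
    by rewrite -map_comp; apply: eq_map => t /=; rewrite ((vkeval_shift [::] vs [:: c] ks).2 t).
  by split=> -[c hc]; exists c; move: hc; rewrite IH /= E E'.
Qed.

Lemma vkeval_morphism (M M' : lstruct) (fV : vect M -> vect M')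
    (fK : {rmorphism scal M -> scal M'}) :
  (forall u v, fV (u + v) = fV u + fV v) -> (forall c v, fV (c *: v) = fK c *: fV v) ->
  (forall u v, bform (fV u) (fV v) = fK (bform u v)) ->
  forall (vs : seq (vect M)) (ks : seq (scal M)),
  (forall t, veval (map fV vs) (map fK ks) t = fV (veval vs ks t)) /\
  (forall t, keval (map fV vs) (map fK ks) t = fK (keval vs ks t)).
Proof.
move=> fD fZ fF vs ks; have f0 : fV 0 = 0 by rewrite -(scale0r 0) fZ rmorph0 scale0r.
apply: vkterm_ind => //=.
- by move=> i; rewrite -f0 (@nth_map_default _ _ 0).
- by move=> t1 E1 t2 E2; rewrite fD E1 E2.
- by move=> c E1 t E2; rewrite fZ E1 E2.
- by move=> i; rewrite -(rmorph0 fK) (@nth_map_default _ _ 0).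
- by rewrite rmorph0.
- by rewrite rmorph1.
- by move=> t1 E1 t2 E2; rewrite rmorphD E1 E2.
- by move=> t1 E1 t2 E2; rewrite rmorphM E1 E2.
- by move=> t1 E1 t2 E2; rewrite -fF E1 E2.
Qed.

Lemma holds_automorphism (g h : vect N -> vect N) :
  (forall u v, g (u + v) = g u + g v) -> (forall c v, g (c *: v) = c *: g v) ->
  (forall u v, bform (g u) (g v) = bform u v) ->
  cancel h g -> cancel g h -> forall phi vs ks,
  holds (map g vs) ks phi <-> holds vs ks phi.
Proof.
move=> gD gZ gF hK gK; have E vs ks : (forall t, veval (map g vs) ks t = g (veval vs ks t)) /\
    (forall t, keval (map g vs) ks t = keval vs ks t).
  by have := vkeval_morphism (fK := idfun) gD gZ gF vs ks; rewrite map_id.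
elim=> [t1 t2|t1 t2|phi IH|phi IH psi IH'|phi IH|phi IH] vs ks /=.
- by rewrite !(E vs ks).1; split=> [/(can_inj gK)|->].
- by rewrite !(E vs ks).2.
- by rewrite IH.
- by rewrite IH IH'.
- split=> -[v hv]; last by exists (g v); apply/(IH (v :: vs)).
  by exists (h v); apply/IH => /=; rewrite hK.
- by split=> -[c hc]; exists c; apply/(IH vs (c :: ks)).
Qed.

End Substitution.

(* Definability, uniformly over a family of structures, with parameters drawn
   from the families cv and ck of named constants.  Asking for a formula over
   every larger list of constants makes the notion closed under connectives
   without renaming of parameters. *)
Section UniformDefinability.
Variables (I : Type) (N : I -> lstruct) (CV CK : Type).
Variables (cv : CV -> forall i, vect (N i)) (ck : CK -> forall i, scal (N i)).
Implicit Types (k m j : nat).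

Definition vconst (S : seq CV) i := [seq cv c i | c <- S].
Definition kconst (S' : seq CK) i := [seq ck c i | c <- S'].

Definition gV k m (F : forall i, seq (vect (N i)) -> seq (scal (N i)) -> vect (N i)) :=
  exists s s', forall S S', List.incl s S -> List.incl s' S' ->
  exists t, forall i vs ks, size vs = k -> size ks = m ->
    F i vs ks = veval (vs ++ vconst S i) (ks ++ kconst S' i) t.

Definition gK k m (F : forall i, seq (vect (N i)) -> seq (scal (N i)) -> scal (N i)) :=
  exists s s', forall S S', List.incl s S -> List.incl s' S' ->
  exists t, forall i vs ks, size vs = k -> size ks = m ->
    F i vs ks = keval (vs ++ vconst S i) (ks ++ kconst S' i) t.

Definition gVs k m j
    (F : forall i, seq (vect (N i)) -> seq (scal (N i)) -> seq (vect (N i))) :=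
  exists s s', forall S S', List.incl s S -> List.incl s' S' ->
  exists2 ts, size ts = j & forall i vs ks, size vs = k -> size ks = m ->
    F i vs ks = map (veval (vs ++ vconst S i) (ks ++ kconst S' i)) ts.

Definition gKs k m j
    (F : forall i, seq (vect (N i)) -> seq (scal (N i)) -> seq (scal (N i))) :=
  exists s s', forall S S', List.incl s S -> List.incl s' S' ->
  exists2 ts, size ts = j & forall i vs ks, size vs = k -> size ks = m ->
    F i vs ks = map (keval (vs ++ vconst S i) (ks ++ kconst S' i)) ts.

Definition gdef k m (P : forall i, seq (vect (N i)) -> seq (scal (N i)) -> Prop) :=
  exists s s', forall S S', List.incl s S -> List.incl s' S' ->
  exists phi, forall i vs ks, size vs = k -> size ks = m ->
    (P i vs ks <-> holds (vs ++ vconst S i) (ks ++ kconst S' i) phi).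

Lemma gdef_ext k m P Q : gdef k m P ->
  (forall i vs ks, size vs = k -> size ks = m -> (Q i vs ks <-> P i vs ks)) ->
  gdef k m Q.
Proof.
move=> [s [s' h]] PQ; exists s, s' => S S' iS iS'.
by have [phi hphi] := h S S' iS iS'; exists phi => i vs ks hv hk; rewrite PQ // hphi.
Qed.

Lemma gK_ext k m F G : gK k m F ->
  (forall i vs ks, size vs = k -> size ks = m -> G i vs ks = F i vs ks) ->
  gK k m G.
Proof.
move=> [s [s' h]] FG; exists s, s' => S S' iS iS'.
by have [t ht] := h S S' iS iS'; exists t => i vs ks hv hk; rewrite FG // ht.
Qed.

Lemma gV_ext k m F G : gV k m F ->
  (forall i vs ks, size vs = k -> size ks = m -> G i vs ks = F i vs ks) ->
  gV k m G.
Proof.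
move=> [s [s' h]] FG; exists s, s' => S S' iS iS'.
by have [t ht] := h S S' iS iS'; exists t => i vs ks hv hk; rewrite FG // ht.
Qed.

Lemma gVs_ext k m j F G : gVs k m j F ->
  (forall i vs ks, size vs = k -> size ks = m -> G i vs ks = F i vs ks) ->
  gVs k m j G.
Proof.
move=> [s [s' h]] FG; exists s, s' => S S' iS iS'.
by have [t st ht] := h S S' iS iS'; exists t => // i vs ks hv hk; rewrite FG // ht.
Qed.

Lemma gKs_ext k m j F G : gKs k m j F ->
  (forall i vs ks, size vs = k -> size ks = m -> G i vs ks = F i vs ks) ->
  gKs k m j G.
Proof.
move=> [s [s' h]] FG; exists s, s' => S S' iS iS'.
by have [t st ht] := h S S' iS iS'; exists t => // i vs ks hv hk; rewrite FG // ht.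
Qed.

Local Ltac merge h1 h2 :=
  let s1 := fresh "zs" in let s1' := fresh "zs" in let s2 := fresh "zs" in
  let s2' := fresh "zs" in let iS := fresh "iS" in let iS' := fresh "iS" in
  let T := fresh "T" in let T' := fresh "T" in
  move: h1 h2 => [s1 [s1' h1]] [s2 [s2' h2]];
  exists (s1 ++ s2), (s1' ++ s2') => T T' /(@List.incl_app_inv _ _ _ _) iS
    /(@List.incl_app_inv _ _ _ _) iS';
  move: (h1 T T' iS.1 iS'.1) (h2 T T' iS.2 iS'.2) => {}h1 {}h2.

Local Ltac single h1 :=
  let s1 := fresh "zs" in let s1' := fresh "zs" in
  let iS := fresh "iS" in let iS' := fresh "iS" in
  let T := fresh "T" in let T' := fresh "T" in
  move: h1 => [s1 [s1' h1]];
  exists s1, s1' => T T' iS iS'; move: (h1 T T' iS iS') => {}h1.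

Lemma gV0 k m : gV k m (fun i _ _ => 0).
Proof. by exists [::], [::] => *; exists VZero. Qed.

Lemma gK0 k m : gK k m (fun i _ _ => 0).
Proof. by exists [::], [::] => *; exists KZero. Qed.

Lemma gVD k m F G : gV k m F -> gV k m G -> gV k m (fun i vs ks => F i vs ks + G i vs ks).
Proof.
move=> h1 h2; merge h1 h2; move: h1 h2 => [t1 e1] [t2 e2].
by exists (VAdd t1 t2) => i vs ks sv sk /=; rewrite e1 ?e2.
Qed.

Lemma gVZ k m c F : gK k m c -> gV k m F -> gV k m (fun i vs ks => c i vs ks *: F i vs ks).
Proof.
move=> h1 h2; merge h1 h2; move: h1 h2 => [t1 e1] [t2 e2].
by exists (VScale t1 t2) => i vs ks sv sk /=; rewrite e1 ?e2.
Qed.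

Lemma gKM k m F G : gK k m F -> gK k m G -> gK k m (fun i vs ks => F i vs ks * G i vs ks).
Proof.
move=> h1 h2; merge h1 h2; move: h1 h2 => [t1 e1] [t2 e2].
by exists (KMul t1 t2) => i vs ks sv sk /=; rewrite e1 ?e2.
Qed.

Lemma gKF k m F G : gV k m F -> gV k m G ->
  gK k m (fun i vs ks => bform (F i vs ks) (G i vs ks)).
Proof.
move=> h1 h2; merge h1 h2; move: h1 h2 => [t1 e1] [t2 e2].
by exists (KForm t1 t2) => i vs ks sv sk /=; rewrite e1 ?e2.
Qed.

Lemma gV_const k m c : gV k m (fun i _ _ => cv c i).
Proof.
exists [:: c], [::] => S S' iS _.
have [|S1 [S2 ->]] := @List.in_split _ c S; first by apply: iS; left.
exists (VVar (k + size S1)) => i vs ks <- _ /=.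
rewrite nth_cat ltnNge leq_addr /= addKn /vconst map_cat nth_cat size_map.
by rewrite ltnn subnn.
Qed.

Lemma gK_const k m c : gK k m (fun i _ _ => ck c i).
Proof.
exists [::], [:: c] => S S' _ iS.
have [|S1 [S2 ->]] := @List.in_split _ c S'; first by apply: iS; left.
exists (KVar (m + size S1)) => i vs ks _ <- /=.
rewrite nth_cat ltnNge leq_addr /= addKn /kconst map_cat nth_cat size_map.
by rewrite ltnn subnn.
Qed.

Lemma gVs_var k m : gVs k m k (fun i vs _ => vs).
Proof.
exists [::], [::] => S S' _ _.
exists (map VVar (iota 0 k)) => [|i vs ks <- _]; first by rewrite size_map size_iota.
rewrite -map_comp; apply: (@eq_from_nth _ 0) => [|q lt_q]; first by rewrite size_map size_iota.
by rewrite (nth_map 0%N) ?size_iota // nth_iota //= add0n nth_cat lt_q.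
Qed.

Lemma gKs_var k m : gKs k m m (fun i _ ks => ks).
Proof.
exists [::], [::] => S S' _ _.
exists (map KVar (iota 0 m)) => [|i vs ks _ <-]; first by rewrite size_map size_iota.
rewrite -map_comp; apply: (@eq_from_nth _ 0) => [|q lt_q]; first by rewrite size_map size_iota.
by rewrite (nth_map 0%N) ?size_iota // nth_iota //= add0n nth_cat lt_q.
Qed.

Lemma gVs_nil k m : gVs k m 0 (fun i _ _ => [::]).
Proof. by exists [::], [::] => *; exists [::]. Qed.

Lemma gKs_nil k m : gKs k m 0 (fun i _ _ => [::]).
Proof. by exists [::], [::] => *; exists [::]. Qed.

Lemma gVs_cons k m j F G : gV k m F -> gVs k m j G ->
  gVs k m j.+1 (fun i vs ks => F i vs ks :: G i vs ks).
Proof.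
move=> h1 h2; merge h1 h2; move: h1 h2 => [t1 e1] [t2 s2 e2].
by exists (t1 :: t2) => [|i vs ks sv sk] /=; rewrite ?s2 // e1 ?e2.
Qed.

Lemma gKs_cons k m j F G : gK k m F -> gKs k m j G ->
  gKs k m j.+1 (fun i vs ks => F i vs ks :: G i vs ks).
Proof.
move=> h1 h2; merge h1 h2; move: h1 h2 => [t1 e1] [t2 s2 e2].
by exists (t1 :: t2) => [|i vs ks sv sk] /=; rewrite ?s2 // e1 ?e2.
Qed.

Lemma gVs_cat k m j j' F G : gVs k m j F -> gVs k m j' G ->
  gVs k m (j + j') (fun i vs ks => F i vs ks ++ G i vs ks).
Proof.
move=> h1 h2; merge h1 h2; move: h1 h2 => [t1 s1 e1] [t2 s2 e2].
exists (t1 ++ t2) => [|i vs ks sv sk] /=; first by rewrite size_cat s1 s2.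
by rewrite e1 ?e2 // map_cat.
Qed.

Lemma gKs_cat k m j j' F G : gKs k m j F -> gKs k m j' G ->
  gKs k m (j + j') (fun i vs ks => F i vs ks ++ G i vs ks).
Proof.
move=> h1 h2; merge h1 h2; move: h1 h2 => [t1 s1 e1] [t2 s2 e2].
exists (t1 ++ t2) => [|i vs ks sv sk] /=; first by rewrite size_cat s1 s2.
by rewrite e1 ?e2 // map_cat.
Qed.

Lemma gVs_take k m j l F : gVs k m (l + j) F ->
  gVs k m l (fun i vs ks => take l (F i vs ks)).
Proof.
move=> h; single h; move: h => [ts sts e].
exists (take l ts) => [|i vs ks sv sk] /=; first by rewrite size_takel // sts leq_addr.
by rewrite e // map_take.
Qed.

Lemma gVs_drop k m j l F : gVs k m (l + j) F ->
  gVs k m j (fun i vs ks => drop l (F i vs ks)).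
Proof.
move=> h; single h; move: h => [ts sts e].
exists (drop l ts) => [|i vs ks sv sk] /=; first by rewrite size_drop sts addKn.
by rewrite e // map_drop.
Qed.

Lemma gKs_take k m j l F : gKs k m (l + j) F ->
  gKs k m l (fun i vs ks => take l (F i vs ks)).
Proof.
move=> h; single h; move: h => [ts sts e].
exists (take l ts) => [|i vs ks sv sk] /=; first by rewrite size_takel // sts leq_addr.
by rewrite e // map_take.
Qed.

Lemma gKs_drop k m j l F : gKs k m (l + j) F ->
  gKs k m j (fun i vs ks => drop l (F i vs ks)).
Proof.
move=> h; single h; move: h => [ts sts e].
exists (drop l ts) => [|i vs ks sv sk] /=; first by rewrite size_drop sts addKn.
by rewrite e // map_drop.
Qed.

Lemma gV_nth k m j l F : gVs k m j F -> gV k m (fun i vs ks => (F i vs ks)`_l).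
Proof.
move=> h; single h; move: h => [ts sts e].
by exists (nth VZero ts l) => i vs ks sv sk; rewrite e // (@nth_map_default _ _ VZero).
Qed.

Lemma gK_nth k m j l F : gKs k m j F -> gK k m (fun i vs ks => (F i vs ks)`_l).
Proof.
move=> h; single h; move: h => [ts sts e].
by exists (nth KZero ts l) => i vs ks sv sk; rewrite e // (@nth_map_default _ _ KZero).
Qed.

Lemma gVs_const k m (s : seq CV) : gVs k m (size s) (fun i _ _ => vconst s i).
Proof. by elim: s => [|c s IH] /=; [exact: gVs_nil|apply: gVs_cons => //; exact: gV_const]. Qed.

Lemma gKs_const k m (s : seq CK) : gKs k m (size s) (fun i _ _ => kconst s i).
Proof. by elim: s => [|c s IH] /=; [exact: gKs_nil|apply: gKs_cons => //; exact: gK_const]. Qed.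

Lemma gVs_map (T : Type) k m (s : seq T)
    (F : T -> forall i, seq (vect (N i)) -> seq (scal (N i)) -> vect (N i)) :
  (forall x, gV k m (F x)) -> gVs k m (size s) (fun i vs ks => [seq F x i vs ks | x <- s]).
Proof. by move=> h; elim: s => [|c s IH] /=; [exact: gVs_nil|apply: gVs_cons]. Qed.

Lemma gKs_map (T : Type) k m (s : seq T)
    (F : T -> forall i, seq (vect (N i)) -> seq (scal (N i)) -> scal (N i)) :
  (forall x, gK k m (F x)) -> gKs k m (size s) (fun i vs ks => [seq F x i vs ks | x <- s]).
Proof. by move=> h; elim: s => [|c s IH] /=; [exact: gKs_nil|apply: gKs_cons]. Qed.

Lemma gV_sum (T : Type) k m (s : seq T)
    (F : T -> forall i, seq (vect (N i)) -> seq (scal (N i)) -> vect (N i)) :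
  (forall x, gV k m (F x)) -> gV k m (fun i vs ks => \sum_(x <- s) F x i vs ks).
Proof.
move=> h; elim: s => [|c s IH].
  by apply: gV_ext (gV0 k m) _ => i vs ks _ _; rewrite big_nil.
by apply: gV_ext (gVD (h c) IH) _ => i vs ks _ _; rewrite big_cons.
Qed.

Lemma gdef_eqV k m F G : gV k m F -> gV k m G -> gdef k m (fun i vs ks => F i vs ks = G i vs ks).
Proof.
move=> h1 h2; merge h1 h2; move: h1 h2 => [t1 e1] [t2 e2].
by exists (VEq t1 t2) => i vs ks sv sk /=; rewrite e1 ?e2.
Qed.

Lemma gdef_eqK k m F G : gK k m F -> gK k m G -> gdef k m (fun i vs ks => F i vs ks = G i vs ks).
Proof.
move=> h1 h2; merge h1 h2; move: h1 h2 => [t1 e1] [t2 e2].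
by exists (KEq t1 t2) => i vs ks sv sk /=; rewrite e1 ?e2.
Qed.

Lemma gdef_not k m P : gdef k m P -> gdef k m (fun i vs ks => ~ P i vs ks).
Proof.
move=> h; single h; move: h => [phi e].
by exists (FNot phi) => i vs ks sv sk /=; rewrite e.
Qed.

Lemma gdef_and k m P Q : gdef k m P -> gdef k m Q -> gdef k m (fun i vs ks => P i vs ks /\ Q i vs ks).
Proof.
move=> h1 h2; merge h1 h2; move: h1 h2 => [t1 e1] [t2 e2].
by exists (FAnd t1 t2) => i vs ks sv sk /=; rewrite e1 ?e2.
Qed.

Lemma gdef_imp k m P Q : gdef k m P -> gdef k m Q -> gdef k m (fun i vs ks => P i vs ks -> Q i vs ks).
Proof.
move=> h1 h2; apply: gdef_ext (gdef_not (gdef_and h1 (gdef_not h2))) _ => i vs ks _ _.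
split=> [h [p /(_ (h p))] //|h p].
by apply: contrapT => q; apply: h.
Qed.

Lemma gdef_or k m P Q : gdef k m P -> gdef k m Q -> gdef k m (fun i vs ks => P i vs ks \/ Q i vs ks).
Proof.
move=> h1 h2; apply: gdef_ext (gdef_imp (gdef_not h1) h2) _ => i vs ks _ _.
split=> [[]// p /(_ p)//|h].
by case: (pselect (P i vs ks)) => p; [left|right; exact: h].
Qed.

Lemma gdef_cst k m (P : Prop) : gdef k m (fun _ _ _ => P).
Proof.
have T := gdef_eqK (gK0 k m) (gK0 k m).
case: (pselect P) => p; first by apply: gdef_ext T _ => *; split.
by apply: gdef_ext (gdef_not T) _ => *; split.
Qed.

Lemma gdef_exV k m (P : forall i, vect (N i) -> seq (vect (N i)) -> seq (scal (N i)) -> Prop) :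
  gdef k.+1 m (fun i vs ks => P i (head 0 vs) (behead vs) ks) ->
  gdef k m (fun i vs ks => exists v, P i v vs ks).
Proof.
move=> h; single h; move: h => [phi e]; exists (VEx phi) => i vs ks sv sk /=.
have E v := e i (v :: vs) ks (congr1 S sv) sk.
by split=> -[v hv]; exists v; apply/E.
Qed.

Lemma gdef_exK k m (P : forall i, scal (N i) -> seq (vect (N i)) -> seq (scal (N i)) -> Prop) :
  gdef k m.+1 (fun i vs ks => P i (head 0 ks) vs (behead ks)) ->
  gdef k m (fun i vs ks => exists c, P i c vs ks).
Proof.
move=> h; single h; move: h => [phi e]; exists (KEx phi) => i vs ks sv sk /=.
have E v := e i vs (v :: ks) sv (congr1 S sk).
by split=> -[v hv]; exists v; apply/E.
Qed.

Lemma gdef_allK k m (P : forall i, scal (N i) -> seq (vect (N i)) -> seq (scal (N i)) -> Prop) :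
  gdef k m.+1 (fun i vs ks => P i (head 0 ks) vs (behead ks)) ->
  gdef k m (fun i vs ks => forall c, P i c vs ks).
Proof.
move=> h; apply: gdef_ext (gdef_not (gdef_exK
  (P := fun i v vs ks => ~ P i v vs ks) (gdef_not h))) _ => i vs ks _ _.
by split=> [h' [v hv]|h' v]; [exact: hv|apply: contrapT => hv; apply: h'; exists v].
Qed.

Lemma gdef_exVs j k m
    (P : forall i, seq (vect (N i)) -> seq (vect (N i)) -> seq (scal (N i)) -> Prop) :
  gdef (j + k) m (fun i vs ks => P i (take j vs) (drop j vs) ks) ->
  gdef k m (fun i vs ks => exists2 us, size us = j & P i us vs ks).
Proof.
elim: j k P => [|j IH] k P h.
  apply: gdef_ext h _ => i vs ks _ _; rewrite take0 drop0.
  by split=> [[[]//]|h]; exists [::].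
(* A quantifier puts its variable in front of the valuation, so the outermost one binds the last
   entry of the block; hence the decomposition by [rcons]. *)
have H : gdef k m (fun i vs ks => exists v,
    exists2 us, size us = j & P i (rcons us v) vs ks).
  apply: gdef_exV; apply: (IH k.+1 (fun i us vs ks => P i (rcons us (head 0 vs)) (behead vs) ks)).
  rewrite addnS; apply: gdef_ext h _ => i vs ks sv _.
  rewrite (take_nth 0) ?sv ?ltnS ?leq_addr //.
  by rewrite -nth0 nth_drop addn0 -drop1 drop_drop add1n.
apply: gdef_ext H _ => i vs ks _ _; split=> [[us]|[v [us sus h']]]; last first.
  by exists (rcons us v); rewrite ?size_rcons ?sus.
case/lastP: us => // us v; rewrite size_rcons => -[sus] h'.
by exists v, us.
Qed.

Lemma gdef_exKs j k m
    (P : forall i, seq (scal (N i)) -> seq (vect (N i)) -> seq (scal (N i)) -> Prop) :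
  gdef k (j + m) (fun i vs ks => P i (take j ks) vs (drop j ks)) ->
  gdef k m (fun i vs ks => exists2 us, size us = j & P i us vs ks).
Proof.
elim: j m P => [|j IH] m P h.
  apply: gdef_ext h _ => i vs ks _ _; rewrite take0 drop0.
  by split=> [[[]//]|h]; exists [::].
have H : gdef k m (fun i vs ks => exists v,
    exists2 us, size us = j & P i (rcons us v) vs ks).
  apply: gdef_exK; apply: (IH m.+1 (fun i us vs ks => P i (rcons us (head 0 ks)) vs (behead ks))).
  rewrite addnS; apply: gdef_ext h _ => i vs ks _ sv.
  rewrite (take_nth 0) ?sv ?ltnS ?leq_addr //.
  by rewrite -nth0 nth_drop addn0 -drop1 drop_drop add1n.
apply: gdef_ext H _ => i vs ks _ _; split=> [[us]|[v [us sus h']]]; last first.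
  by exists (rcons us v); rewrite ?size_rcons ?sus.
case/lastP: us => // us v; rewrite size_rcons => -[sus] h'.
by exists v, us.
Qed.

Lemma gdef_allKs j k m
    (P : forall i, seq (scal (N i)) -> seq (vect (N i)) -> seq (scal (N i)) -> Prop) :
  gdef k (j + m) (fun i vs ks => P i (take j ks) vs (drop j ks)) ->
  gdef k m (fun i vs ks => forall us, size us = j -> P i us vs ks).
Proof.
move=> h; apply: gdef_ext (gdef_not (gdef_exKs
  (P := fun i v vs ks => ~ P i v vs ks) (gdef_not h))) _ => i vs ks _ _.
split=> [h' [v sv hv]|h' v sv]; first exact: hv (h' v sv).
by apply: contrapT => hv; apply: h'; exists v.
Qed.

Lemma gdef_holds k m j l F G phi : gVs k m j F -> gKs k m l G ->
  gdef k m (fun i vs ks => holds (F i vs ks) (G i vs ks) phi).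
Proof.
move=> h1 h2; merge h1 h2; move: h1 h2 => [tv sv ev] [tk sk ek].
exists (fsubst tv tk phi) => i vs ks szv szk.
by rewrite holds_fsubst ev ?ek.
Qed.

(** The constants occurring in [P] are appended to the substituted lists, so that a formula for [P]
    over its own constants suffices. *)
Lemma gdef_comp k m j l F G P : gdef j l P -> gVs k m j F -> gKs k m l G ->
  gdef k m (fun i vs ks => P i (F i vs ks) (G i vs ks)).
Proof.
move=> [s [s' h]] hF hG; have [phi hphi] := h _ _ (@List.incl_refl _ s) (@List.incl_refl _ s').
have H := gdef_holds phi (gVs_cat hF (gVs_const k m s)) (gKs_cat hG (gKs_const k m s')).
apply: gdef_ext H _ => i vs ks sv sk; apply: hphi.
- have [? [? h1]] := hF; have [ts sts ->] // := h1 _ _ (@List.incl_refl _ _) (@List.incl_refl _ _).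
  by rewrite size_map.
- have [? [? h1]] := hG; have [ts sts ->] // := h1 _ _ (@List.incl_refl _ _) (@List.incl_refl _ _).
  by rewrite size_map.
Qed.

Lemma gVs_comp k m j l n F G H : gVs j l n H -> gVs k m j F -> gKs k m l G ->
  gVs k m n (fun i vs ks => H i (F i vs ks) (G i vs ks)).
Proof.
move=> [s [s' h]] hF hG; have [us sus hus] := h _ _ (@List.incl_refl _ s) (@List.incl_refl _ s').
have h1 := gVs_cat hF (gVs_const k m s); have h2 := gKs_cat hG (gKs_const k m s').
merge h1 h2; move: h1 h2 => [tv sv ev] [tk sk ek].
exists [seq vsubst tv tk t | t <- us] => [|i vs ks szv szk]; first by rewrite size_map.
rewrite hus.
- rewrite -map_comp; apply: eq_map => t /=.
  by rewrite (vkeval_subst _ _ _ _).1 -ev // -ek.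
- have [? [? h1]] := hF; have [ts sts ->] // := h1 _ _ (@List.incl_refl _ _) (@List.incl_refl _ _).
  by rewrite size_map.
- have [? [? h1]] := hG; have [ts sts ->] // := h1 _ _ (@List.incl_refl _ _) (@List.incl_refl _ _).
  by rewrite size_map.
Qed.

Lemma gdef_eqKs k m j F G : gKs k m j F -> gKs k m j G ->
  gdef k m (fun i vs ks => F i vs ks = G i vs ks).
Proof.
move=> h1 h2.
suff H l : gdef k m (fun i vs ks => forall q, (q < l)%N -> (F i vs ks)`_q = (G i vs ks)`_q).
  apply: gdef_ext (H j) _ => i vs ks sv sk.
  have [? [? h1']] := h1; have [t1 s1 e1] := h1' _ _ (@List.incl_refl _ _) (@List.incl_refl _ _).
  have [? [? h2']] := h2; have [t2 s2 e2] := h2' _ _ (@List.incl_refl _ _) (@List.incl_refl _ _).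
  split=> [-> //|h]; apply: (@eq_from_nth _ 0); rewrite ?e1 ?e2 ?size_map ?s1 ?s2 //.
  by move=> q lq; rewrite -e1 // -e2 //; apply: h.
elim: l => [|l IH]; first by apply: gdef_ext (gdef_cst k m True) _ => *; split.
apply: gdef_ext (gdef_and IH (gdef_eqK (gK_nth l h1) (gK_nth l h2))) _ => i vs ks _ _.
split=> [h|[h hl] q]; first by split=> [q lq|]; apply: h => //; exact: ltnW.
by rewrite ltnS leq_eqVlt => /orP[/eqP->|/h].
Qed.

Lemma gdef_eqVs k m j F G : gVs k m j F -> gVs k m j G ->
  gdef k m (fun i vs ks => F i vs ks = G i vs ks).
Proof.
move=> h1 h2.
suff H l : gdef k m (fun i vs ks => forall q, (q < l)%N -> (F i vs ks)`_q = (G i vs ks)`_q).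
  apply: gdef_ext (H j) _ => i vs ks sv sk.
  have [? [? h1']] := h1; have [t1 s1 e1] := h1' _ _ (@List.incl_refl _ _) (@List.incl_refl _ _).
  have [? [? h2']] := h2; have [t2 s2 e2] := h2' _ _ (@List.incl_refl _ _) (@List.incl_refl _ _).
  split=> [-> //|h]; apply: (@eq_from_nth _ 0); rewrite ?e1 ?e2 ?size_map ?s1 ?s2 //.
  by move=> q lq; rewrite -e1 // -e2 //; apply: h.
elim: l => [|l IH]; first by apply: gdef_ext (gdef_cst k m True) _ => *; split.
apply: gdef_ext (gdef_and IH (gdef_eqV (gV_nth l h1) (gV_nth l h2))) _ => i vs ks _ _.
split=> [h|[h hl] q]; first by split=> [q lq|]; apply: h => //; exact: ltnW.
by rewrite ltnS leq_eqVlt => /orP[/eqP->|/h].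
Qed.

Lemma gKs_size k m j F i vs ks : gKs k m j F -> size vs = k -> size ks = m ->
  size (F i vs ks) = j.
Proof.
move=> [? [? h]] sv sk; have [t st ->//] := h _ _ (@List.incl_refl _ _) (@List.incl_refl _ _).
by rewrite size_map.
Qed.

Lemma gVs_size k m j F i vs ks : gVs k m j F -> size vs = k -> size ks = m ->
  size (F i vs ks) = j.
Proof.
move=> [? [? h]] sv sk; have [t st ->//] := h _ _ (@List.incl_refl _ _) (@List.incl_refl _ _).
by rewrite size_map.
Qed.

End UniformDefinability.

(** * Linear algebra *)

Section Combinations.
Variables (K : fieldType) (V : lmodType K).
Implicit Types (s t P : seq V) (c d : seq K) (u v w x y : V).

(** Coefficients form a list, so that a linear combination is given by a tuple of scalars over which
    a formula can quantify. *)
Fixpoint comb c s : V :=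
  match c, s with
  | a :: c', x :: s' => a *: x + comb c' s'
  | _, _ => 0
  end.

Lemma combE c s : comb c s = \sum_(i < size s) c`_i *: s`_i.
Proof.
elim: s c => [|x s IH] [|a c] //=; rewrite ?big_ord0 //.
  by rewrite big1 // => i _; rewrite nth_nil scale0r.
by rewrite big_ord_recl /= IH.
Qed.

Lemma LinP s v : Lin s v <-> exists2 c, size c = size s & v = comb c s.
Proof.
split=> [[c ->]|[c _ ->]]; last by exists (fun i => c`_i); rewrite combE.
exists (mkseq (fun i => if insub i is Some j then c j else 0) (size s)); first by rewrite size_mkseq.
by rewrite combE; apply: eq_bigr => i _; rewrite nth_mkseq // valK.
Qed.

Lemma comb0 s : comb (nseq (size s) 0) s = 0.
Proof. by elim: s => //= x s ->; rewrite scale0r add0r. Qed.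

Lemma combZ a c s : comb (map ( *%R a) c) s = a *: comb c s.
Proof.
by elim: s c => [|x s IH] [|b c] //=; rewrite ?scaler0 // IH scalerDr scalerA.
Qed.

Lemma combD c d s : size c = size d ->
  comb [seq p.1 + p.2 | p <- zip c d] s = comb c s + comb d s.
Proof.
elim: s c d => [|x s IH] [|a c] [|b d] //=; rewrite ?addr0 // => -[/IH ->].
by rewrite scalerDl addrACA.
Qed.

Lemma Lin_nil v : Lin [::] v <-> v = 0.
Proof.
by split=> [/LinP[c _ ->]|->]; [case: c|apply/LinP; exists [::]].
Qed.

Lemma Lin_cons x s v : Lin (x :: s) v <-> exists a w, Lin s w /\ v = a *: x + w.
Proof.
split=> [/LinP[[|a c] //= [sc] ->]|[a [w [/LinP[c sc ->] ->]]]].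
  by exists a, (comb c s); split=> //; apply/LinP; exists c.
by apply/LinP; exists (a :: c); rewrite /= ?sc.
Qed.

Lemma Lin0 s : Lin s 0.
Proof. by apply/LinP; exists (nseq (size s) 0); rewrite ?size_nseq ?comb0. Qed.

Lemma LinD s u v : Lin s u -> Lin s v -> Lin s (u + v).
Proof.
elim: s u v => [|x s IH] u v; first by move=> /Lin_nil-> /Lin_nil->; rewrite addr0; apply/Lin_nil.
move=> /Lin_cons[a [w [hw ->]]] /Lin_cons[b [w' [hw' ->]]].
by apply/Lin_cons; exists (a + b), (w + w'); rewrite scalerDl addrACA; split=> //; exact: IH.
Qed.

Lemma LinZ s a v : Lin s v -> Lin s (a *: v).
Proof.
move=> /LinP[c sc ->]; apply/LinP; exists (map ( *%R a) c); rewrite ?size_map //.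
by rewrite combZ.
Qed.

Lemma LinN s v : Lin s v -> Lin s (- v).
Proof. by rewrite -scaleN1r; exact: LinZ. Qed.

Lemma LinB s u v : Lin s u -> Lin s v -> Lin s (u - v).
Proof. by move=> hu hv; apply: LinD => //; exact: LinN. Qed.

Lemma Lin_mem s x : x \in s -> Lin s x.
Proof.
elim: s => // y s IH; rewrite inE => /orP[/eqP->|/IH h]; apply/Lin_cons.
  by exists 1, 0; rewrite scale1r addr0; split=> //; exact: Lin0.
by exists 0, x; rewrite scale0r add0r.
Qed.

Lemma Lin_sub s t v : (forall x, x \in s -> Lin t x) -> Lin s v -> Lin t v.
Proof.
elim: s v => [|x s IH] v h; first by move/Lin_nil->; exact: Lin0.
move=> /Lin_cons[a [w [hw ->]]]; apply: LinD; first by apply/LinZ/h; rewrite mem_head.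
by apply: IH hw => y ys; apply: h; rewrite inE ys orbT.
Qed.

Lemma Lin_subset s t v : {subset s <= t} -> Lin s v -> Lin t v.
Proof. by move=> st; apply: Lin_sub => x /st; exact: Lin_mem. Qed.

Lemma Lin_catl s t v : Lin s v -> Lin (s ++ t) v.
Proof. by apply: Lin_subset => x xs; rewrite mem_cat xs. Qed.

Lemma Lin_catr s t v : Lin t v -> Lin (s ++ t) v.
Proof. by apply: Lin_subset => x xs; rewrite mem_cat xs orbT. Qed.

Lemma Lin_cat s t v : Lin (s ++ t) v <-> exists u w, [/\ Lin s u, Lin t w & v = u + w].
Proof.
split=> [|[u [w [hu hw ->]]]]; last by apply: LinD; [exact: Lin_catl|exact: Lin_catr].
elim: s v => [|x s IH] v /=; first by move=> hv; exists 0, v; rewrite add0r; split=> //; exact: Lin0.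
move=> /Lin_cons[a [w [/IH[u [w' [hu hw' ->]]] ->]]].
exists (a *: x + u), w'; rewrite addrA; split=> //.
by apply/Lin_cons; exists a, u.
Qed.

Lemma Lin_comb c s : Lin s (comb c s).
Proof. by exists (fun i => c`_i); rewrite combE. Qed.

Lemma indepP P s : lin_indep_over (Lin P) s <->
  forall c, size c = size s -> Lin P (comb c s) -> c = nseq (size s) 0.
Proof.
split=> h c.
  move=> sc; rewrite combE => /h c0; apply: (@eq_from_nth _ 0); rewrite ?size_nseq // => i lt_i.
  by rewrite nth_nseq; case: ifP => // _; rewrite sc in lt_i; exact: (c0 (Ordinal lt_i)).
move=> hc i.
have /h E : size (mkseq (fun i => if insub i is Some j then c j else 0) (size s)) = size s.
  by rewrite size_mkseq.
have /E {E} : Lin P (comb (mkseq (fun i => if insub i is Some j then c j else 0) (size s)) s).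
  rewrite combE; move: hc; congr Lin; apply: eq_bigr => j _.
  by rewrite nth_mkseq // valK.
move/(congr1 (fun l => l`_i)); rewrite nth_mkseq // valK => ->.
by rewrite nth_nseq; case: ifP.
Qed.

Lemma indep_nil P : lin_indep_over (Lin P) [::].
Proof. by move=> c _ []. Qed.

Lemma indep_cons P x s : lin_indep_over (Lin P) (x :: s) <->
  ~ Lin (s ++ P) x /\ lin_indep_over (Lin P) s.
Proof.
split=> [/indepP h|[hx /indepP h]].
  split; last first.
    apply/indepP => c sc hc; have := h (0 :: c); rewrite /= sc scale0r add0r.
    by case/(_ erefl hc).
  move=> /Lin_cat[u [w [/LinP[c sc ->] hw E]]].
  have /= := h (1 :: map ( *%R (-1)) c); rewrite size_map sc => /(_ erefl).
  rewrite combZ scale1r scaleN1r E addrAC subrr add0r => /(_ hw) [] /eqP.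
  by rewrite oner_eq0.
apply/indepP => -[|a c] //= [sc] hc.
have a0 : a = 0.
  apply: contrapT => /eqP a0; apply: hx.
  have -> : x = a^-1 *: ((a *: x + comb c s) - comb c s).
    by rewrite addrK scalerA mulVf // scale1r.
  by apply/LinZ/LinB; [exact: Lin_catr|apply: Lin_catl; exact: Lin_comb].
by rewrite a0 in hc *; rewrite (h c) //; move: hc; rewrite scale0r add0r.
Qed.

Lemma indep_subset P Q s : (forall v, Lin Q v -> Lin P v) ->
  lin_indep_over (Lin P) s -> lin_indep_over (Lin Q) s.
Proof. by move=> QP h c /QP; exact: h. Qed.

Lemma indep_take P s e : lin_indep_over (Lin P) s -> lin_indep_over (Lin P) (take e s).
Proof.
elim: s e => [|x s IH] [|e] // h; first exact: indep_nil.
have [hx /(IH e) hs] := (indep_cons _ _ _).1 h.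
apply/indep_cons; split=> // hx'; apply: hx; apply: Lin_subset hx' => y.
by rewrite !mem_cat => /orP[/mem_take ->|->] //; rewrite orbT.
Qed.

(** Modulo the span of [P], the coefficients of [s] over [t] would form a matrix with more rows than
    columns, and a nonzero row vector killing it is a dependence of [s] over [P]. *)
Lemma Steinitz P s t : lin_indep_over (Lin P) s ->
  (forall x, x \in s -> Lin (t ++ P) x) -> (size s <= size t)%N.
Proof.
move=> ind st; rewrite leqNgt; apply/negP => lt_ts.
have /choice[f hf] (i : 'I_(size s)) : exists cw : ('I_(size t) -> K) * V,
    Lin P cw.2 /\ s`_i = \sum_(j < size t) cw.1 j *: t`_j + cw.2.
  have /Lin_cat[u [w [[c ->] hw E]]] := st s`_i (mem_nth _ (ltn_ord i)).
  by exists (c, w).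
pose A := \matrix_(i < size s, j < size t) (f i).1 j.
have kn0 : kermx A != 0.
  rewrite -mxrank_eq0 mxrank_ker subn_eq0 -ltnNge.
  by apply: leq_ltn_trans lt_ts; exact: rank_leq_col.
pose u := nz_row (kermx A).
have u0 : u != 0 by rewrite nz_row_eq0.
have uA : u *m A = 0 by apply/sub_kermxP; exact: nz_row_sub.
have /ind c0 : Lin P (\sum_(i < size s) u 0 i *: s`_i).
  suff -> : \sum_(i < size s) u 0 i *: s`_i = \sum_(i < size s) u 0 i *: (f i).2.
    by elim/big_ind: _ => [|x y hx hy|i _]; [exact: Lin0|exact: LinD|apply/LinZ; exact: (hf i).1].
  rewrite (eq_bigr (fun i => \sum_j (u 0 i * A i j) *: t`_j + u 0 i *: (f i).2)); last first.
    move=> i _; rewrite (hf i).2 scalerDr scaler_sumr; congr (_ + _).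
    by apply: eq_bigr => j _; rewrite mxE scalerA.
  rewrite big_split /= exchange_big /= big1 ?add0r // => j _.
  rewrite -scaler_suml; move/matrixP: uA => /(_ 0 j); rewrite !mxE => ->.
  by rewrite scale0r.
by case/eqP: u0; apply/rowP => i; rewrite c0 mxE.
Qed.

Lemma maximal_indep_sublist P s : exists t,
  [/\ {subset t <= s}, lin_indep_over (Lin P) t & forall x, x \in s -> Lin (t ++ P) x].
Proof.
elim: s => [|x s [t [ts it h]]]; first by exists [::]; split=> //; exact: indep_nil.
case: (pselect (Lin (t ++ P) x)) => hx.
  exists t; split=> // [y /ts|y]; rewrite inE; first by move=> ->; rewrite orbT.
  by case/orP => [/eqP->|/h].
exists (x :: t); split=> [y||y].
- by rewrite !inE => /orP[->//|/ts ->]; rewrite orbT.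
- exact/indep_cons.
- by rewrite inE => /orP[/eqP->|/h]; [apply: Lin_mem; rewrite mem_head|apply: Lin_subset => z; rewrite inE orbC => ->].
Qed.

End Combinations.

Section Semilinear.
Variables (K K' : fieldType) (V : lmodType K) (V' : lmodType K').
Variables (f : V -> V') (phi : K -> K').
Hypothesis fD : forall u v, f (u + v) = f u + f v.
Hypothesis f0 : f 0 = 0.
Hypothesis fZ : forall a v, f (a *: v) = phi a *: f v.

Lemma comb_semilinear c s : comb (map phi c) (map f s) = f (comb c s).
Proof. by elim: s c => [|x s IH] [|a c] //=; rewrite IH fD fZ. Qed.

Lemma Lin_semilinear s v : Lin s v -> Lin (map f s) (f v).
Proof.
move=> /LinP[c sc ->]; apply/LinP; exists (map phi c); rewrite ?size_map //.
by rewrite comb_semilinear.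
Qed.

Lemma Lin_semilinear_inv s v : injective f -> (forall a', exists a, phi a = a') ->
  Lin (map f s) (f v) -> Lin s v.
Proof.
move=> fI phi_onto /LinP[c' sc E].
have [c Ec] : exists c, map phi c = c'.
  elim: c' {sc E} => [|a' c' [c <-]]; first by exists [::].
  by have [a <-] := phi_onto a'; exists (a :: c).
apply/LinP; exists c; first by rewrite -Ec !size_map in sc.
by apply: fI; rewrite -comb_semilinear Ec.
Qed.

End Semilinear.

(** * Forms and transvections *)

Definition form_sign (K : fieldType) (alt : bool) : K := if alt then -1 else 1.

(** Symmetric and alternating forms are treated at once, [alt] telling them apart: exchanging the
    arguments costs only the factor [form_sign]. Of the field, only infinity and characteristic
    different from 2 are recorded; of positive definiteness, only nondegeneracy. *)
Record form_space (N : lstruct) (alt : bool) : Prop := FormSpace {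
  formDl : forall u v w : vect N, bform (u + v) w = bform u w + bform v w;
  formZl : forall c (u w : vect N), bform (c *: u) w = c * bform u w;
  form_sym : forall u v : vect N, bform v u = form_sign (scal N) alt * bform u v;
  form_alt : forall u : vect N, alt -> bform u u = 0;
  form_two : 2%:R != 0 :> scal N;
  form_nondeg : forall u : vect N, u != 0 -> exists v, bform u v != 0;
  form_infinite : forall s : seq (scal N), exists x, x \notin s }.

(** For an alternating form these are the symplectic transvections; for a symmetric form and [c = -
    2 / [y, y]] it is the reflection along [y]. *)
Definition transvection (N : lstruct) (c : scal N) (y x : vect N) : vect N :=
  x + (c * bform x y) *: y.

Section FormSpace.
Variables (N : lstruct) (alt : bool).
Hypothesis FN : form_space N alt.
Local Notation V := (vect N).
Local Notation K := (scal N).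
Implicit Types (u v w x y z : V) (a c : K) (W P Q : seq V).
Local Notation eps := (form_sign K alt).
Local Notation tau := (@transvection N).

Lemma formDr u v w : bform u (v + w) = bform u v + bform u w.
Proof. by rewrite (form_sym FN) (formDl FN) mulrDr -!(form_sym FN _ u). Qed.

Lemma formZr c u w : bform u (c *: w) = c * bform u w.
Proof. by rewrite (form_sym FN) (formZl FN) mulrCA -(form_sym FN). Qed.

Lemma form0l u : bform (0 : V) u = 0.
Proof. by rewrite -(scale0r 0) (formZl FN) mul0r. Qed.

Lemma form0r u : bform u (0 : V) = 0.
Proof. by rewrite -(scale0r 0) formZr // mul0r. Qed.

Lemma formNl u v : bform (- u) v = - bform u v.
Proof. by rewrite -scaleN1r (formZl FN) mulN1r. Qed.

Lemma formNr u v : bform u (- v) = - bform u v.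
Proof. by rewrite -scaleN1r formZr // mulN1r. Qed.

Lemma formBl u v w : bform (u - v) w = bform u w - bform v w.
Proof. by rewrite (formDl FN) formNl. Qed.

Lemma formBr u v w : bform u (v - w) = bform u v - bform u w.
Proof. by rewrite formDr // formNr. Qed.

Lemma form_eq0C u v : bform u v = 0 -> bform v u = 0.
Proof. by rewrite (form_sym FN u v) => ->; rewrite mulr0. Qed.

Lemma form_neq0C u v : bform u v != 0 -> bform v u != 0.
Proof. by apply: contraNneq => /form_eq0C->. Qed.

Lemma form_Lin_eq0 W u v : (forall w, w \in W -> bform w u = 0) -> Lin W v -> bform v u = 0.
Proof.
elim: W v => [|w W IH] v h; first by move/Lin_nil->; rewrite form0l.
move=> /Lin_cons[a [v' [hv' ->]]]; rewrite (formDl FN) (formZl FN) h ?mem_head // mulr0 add0r.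
by apply: IH hv' => x xW; apply: h; rewrite inE xW orbT.
Qed.

(** Induction on [W]. A vector [y'] found for [v - b w] is made orthogonal to [w] by subtracting a
    multiple of a vector [y] dual to [w] modulo [W]; with [b = [v, y] / [w, y]] this turns the value
    at [v] into [[v - b w, y']], which is nonzero. *)
Lemma form_dual W v : ~ Lin W v ->
  exists2 y, (forall w, w \in W -> bform w y = 0) & bform v y != 0.
Proof.
elim: W v => [|w W IH] v hv.
  have /(form_nondeg FN)[y hy] : v != 0 by apply: contra_notN hv => /eqP->; exact: Lin0.
  by exists y.
case: (pselect (Lin W w)) => hw.
  have [|y yW vy] := IH v.
    by move=> hv'; apply: hv; apply: Lin_subset hv' => x xW; rewrite inE xW orbT.
  exists y => // x; rewrite inE => /orP[/eqP->|/yW//].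
  exact: form_Lin_eq0 yW hw.
have [y yW wy] := IH w hw.
pose b := bform v y / bform w y.
have [|y' y'W vy'] := IH (v - b *: w).
  move=> h; apply: hv; apply/Lin_cons; exists b, (v - b *: w); split=> //.
  by rewrite addrCA subrr addr0.
pose d := bform w y' / bform w y.
exists (y' - d *: y).
  move=> x; rewrite inE formBr formZr => /orP[/eqP->|xW]; first by rewrite /d mulfVK // subrr.
  by rewrite y'W // yW // mulr0 subr0.
move: vy'; rewrite formBl formBr !(formZl FN) formZr.
have -> : d * bform v y = b * bform w y' by rewrite /d /b mulrAC [RHS]mulrAC [X in X / _]mulrC.
by [].
Qed.

(** [W] may be degenerate, so that there need be no orthogonal projection. All that is kept is a
    linear projection onto the orthogonal complement of [W] that changes vectors only by elements of
    the span of a list [F]; the size of [F] bounds the number of scalars needed to recover a vector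
    from its projection. *)
Definition orthoprojection W F (pi : V -> V) :=
  [/\ forall u v, pi (u + v) = pi u + pi v,
      forall a v, pi (a *: v) = a *: pi v,
      forall v w, w \in W -> bform w (pi v) = 0,
      forall v, Lin F (v - pi v) &
      forall v, (forall w, w \in W -> bform w v = 0) -> pi v = v].

Lemma form_projection W : exists F : seq V, exists2 pi : V -> V,
  size F = size W & orthoprojection W F pi.
Proof.
elim: W => [|w W [F [pi sF [piD piZ piW piF piK]]]].
  exists [::], id => //; split=> // v; rewrite subrr; exact: Lin0.
case: (pselect (exists v, bform w (pi v) != 0)) => [[v0 hv0]|h]; last first.
  (* Orthogonality to [w] holds already; the zero vector only keeps the size of [F] equal to that of
     [W]. *)
  exists (0 :: F), pi; first by rewrite /= sF.
  split=> //.
  - move=> v x; rewrite inE => /orP[/eqP->|/piW//].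
    by apply: contrapT => /eqP hv; apply: h; exists v.
  - by move=> v; apply/Lin_cons; exists 0, (v - pi v); rewrite scale0r add0r.
  - by move=> v hv; apply: piK => x xW; apply: hv; rewrite inE xW orbT.
pose f := pi v0; pose q v := bform w (pi v) / bform w f.
exists (f :: F), (fun v => pi v - q v *: f); first by rewrite /= sF.
split.
- move=> u v; rewrite /q piD formDr mulrDl scalerDl opprD.
  by rewrite addrACA.
- by move=> a v; rewrite /q piZ formZr -mulrA -scalerA scalerBr.
- move=> v x; rewrite inE formBr formZr => /orP[/eqP->|xW].
    by rewrite /q mulfVK // subrr.
  by rewrite !piW // mulr0 subr0.
- move=> v; apply/Lin_cons; exists (q v), (v - pi v); split=> //.
  by rewrite opprB addrCA.
- move=> v hv; rewrite /q piK => [|x xW]; last by apply: hv; rewrite inE xW orbT.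
  by rewrite hv ?mem_head // mul0r scale0r subr0.
Qed.

Lemma transvectionD c y u v : tau c y (u + v) = tau c y u + tau c y v.
Proof. by rewrite /tau (formDl FN) mulrDr scalerDl addrACA. Qed.

Lemma transvectionZ c y a v : tau c y (a *: v) = a *: tau c y v.
Proof. by rewrite /tau (formZl FN) scalerDr scalerA mulrCA. Qed.

Lemma transvection_fix c y x : bform x y = 0 -> tau c y x = x.
Proof. by rewrite /tau => ->; rewrite mulr0 scale0r addr0. Qed.

(* Expanding [tau u, tau v] - [u, v] leaves this scalar times [u, y] [v, y]. *)
Definition isometric c y := c * (1 + eps) + c ^+ 2 * bform y y = 0.

Lemma transvection_isometry c y : isometric c y -> forall u v,
  bform (tau c y u) (tau c y v) = bform u v.
Proof.
move=> cy u v; rewrite /tau (formDl FN) !formDr !(formZl FN) !formZr.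
rewrite (form_sym FN v y).
transitivity (bform u v + bform u y * bform v y * (c * (1 + eps) + c ^+ 2 * bform y y)).
  by ring.
by rewrite cy mulr0 addr0.
Qed.

(** A symplectic transvection is inverted by changing the sign of [c], a reflection is its own
    inverse. *)
Lemma transvection_inverse c y : isometric c y ->
  exists2 c', isometric c' y & forall x, tau c' y (tau c y x) = x /\ tau c y (tau c' y x) = x.
Proof.
rewrite /isometric /form_sign /tau; case: (boolP alt) => ha cy.
  exists (- c) => [|x]; first by rewrite subrr mulr0 add0r (form_alt FN) // mulr0.
  rewrite !(formDl FN) !(formZl FN) (form_alt FN y) // !mulr0 !addr0.
  by rewrite !mulNr !scaleNr; split; rewrite ?addrK ?subrK.
exists c => // x.
rewrite !(formDl FN) !(formZl FN) -addrA -scalerDl.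
have -> : c * bform x y + c * (bform x y + c * bform x y * bform y y) =
  bform x y * (c * (1 + 1) + c ^+ 2 * bform y y) by ring.
by rewrite cy mulr0 scale0r addr0.
Qed.

Lemma holds_transvection c y phi vs ks : isometric c y ->
  holds (map (tau c y) vs) ks phi <-> holds vs ks phi.
Proof.
move=> cy; have [c' cy' K'] := transvection_inverse cy.
apply: (@holds_automorphism N (tau c y) (tau c' y)).
- exact: transvectionD.
- exact: transvectionZ.
- exact: transvection_isometry.
- by move=> x; rewrite (K' x).2.
- by move=> x; rewrite (K' x).1.
Qed.

(** The condition under which some nonzero [c] makes the transvection along [y] isometric; an
    alternating form imposes none. *)
Definition anisotropic y := alt || (bform y y != 0).

Lemma anisotropic_isometric y : anisotropic y -> exists2 c, c != 0 & isometric c y.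
Proof.
rewrite /anisotropic /isometric /form_sign; case: (boolP alt) => /= ha yy.
  by exists 1; rewrite ?oner_eq0 // subrr mulr0 add0r (form_alt FN) // mulr0.
exists (- 2%:R / bform y y).
  by rewrite mulf_neq0 ?invr_eq0 // oppr_eq0 (form_two FN).
by field.
Qed.

Lemma infinite_avoid2 a c (d : K) : exists2 t, t != 0 & [/\ t != a, t != c & t != d].
Proof.
have [t] := form_infinite FN [:: 0; a; c; d].
by rewrite !inE !negb_or => /and4P[? ? ? ?]; exists t.
Qed.

Section Infinite.
Hypothesis inf_dim : forall n, ~ has_dim V n.

Lemma notin_Lin Q : exists v, ~ Lin Q v.
Proof.
apply: contrapT => h.
have hQ v : Lin Q v by apply: contrapT => hv; apply: h; exists v.
have [t [tQ it hs]] := maximal_indep_sublist [::] Q.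
apply: (inf_dim (n := size t)); exists t; split=> //.
  by move=> c E; apply: it; rewrite E; exact: Lin0.
move=> v; move: (hQ v); apply: Lin_sub => x /hs; by rewrite cats0.
Qed.

(** Projecting a vector outside a large enough span gives [z] orthogonal to [W] and outside the span
    of [Q]. If [z] is isotropic, it is replaced by [z + t y] with [[z, y]] nonzero: two different
    values of [t] with [z + t y] in the span of [Q] would put [z] there, so all but a few [t]
    work. *)
Lemma exists_anisotropic W Q : exists z,
  [/\ forall w, w \in W -> bform w z = 0, ~ Lin Q z & anisotropic z].
Proof.
have [F [pi sF [piD piZ piW piF _]]] := form_projection W.
have [v hv] := notin_Lin ((Q ++ W) ++ F).
pose z := pi v.
have hz : ~ Lin (Q ++ W) z.
  move=> hz; apply: hv; rewrite -(subrK z v); apply: LinD.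
    by apply: Lin_catr; exact: piF.
  exact: Lin_catl.
have zQ : ~ Lin Q z by move=> h; apply: hz; exact: Lin_catl.
have zW w : w \in W -> bform w z = 0 by exact: piW.
case: (boolP (anisotropic z)) => az; first by exists z.
move: az; rewrite /anisotropic negb_or negbK => /andP[nalt /eqP zz].
have [y yW zy] := form_dual hz.
have yW' w : w \in W -> bform w y = 0 by move=> wW; apply: yW; rewrite mem_cat wW orbT.
have [t1 ht1] : exists t1, forall t, t != 0 -> t != t1 -> ~ Lin Q (z + t *: y).
  case: (pselect (exists t1, Lin Q (z + t1 *: y))) => [[t1 h1]|h]; last first.
    by exists 0 => t _ _ ht; apply: h; exists t.
  exists t1 => t _ tt1 ht; apply: zQ.
  have : Lin Q (t *: (z + t1 *: y) - t1 *: (z + t *: y)) by apply: LinB; exact: LinZ.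
  rewrite !scalerDr !scalerA [t1 * t]mulrC opprD addrACA subrr addr0 -scalerBl.
  by move/(LinZ (t - t1)^-1); rewrite scalerA mulVf ?subr_eq0 // scale1r.
(* The norm of [z + t y] is [t (2 [z, y] + t [y, y])], nonzero unless [t] is 0 or the second
   excluded value. If [[y, y] = 0], that value is 0 by the convention on division, and only [t = 0]
   has to be avoided. *)
have [t t0 [tt1 tt2 _]] := infinite_avoid2 t1 (- (2%:R * bform z y) / bform y y) 0.
exists (z + t *: y); split; last 1 first.
- rewrite /anisotropic (negPf nalt) /= (formDl FN) !formDr !(formZl FN) !formZr zz add0r.
  rewrite (form_sym FN z y) /form_sign (negPf nalt) mul1r.
  have -> : t * bform z y + (t * bform z y + t * (t * bform y y)) =
    t * (2%:R * bform z y + t * bform y y) by ring.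
  rewrite mulf_neq0 //; case: (eqVneq (bform y y) 0) => [->|yy].
    by rewrite mulr0 addr0 mulf_neq0 ?(form_two FN).
  apply: contraNneq tt2 => /eqP; rewrite addrC addr_eq0 => /eqP <-.
  by rewrite mulfK.
- by move=> w wW; rewrite formDr formZr zW // yW' // mulr0 addr0.
- exact: ht1.
Qed.

(** The vector [y] given by duality may be isotropic or lie in the span of [Q]. Adding a multiple
    [t z] of an anisotropic vector orthogonal to [y], [v] and [W] repairs both without changing
    [[v, y]]; the new norm [[y, y] + t^2 [z, z]] vanishes for at most two values of [t]. *)
Lemma exists_move W v Q : ~ Lin W v -> exists y,
  [/\ forall w, w \in W -> bform w y = 0, bform v y != 0, ~ Lin Q y & anisotropic y].
Proof.
move=> /form_dual[y yW vy].
have [z [zW zQ az]] := exists_anisotropic (y :: v :: W) (y :: Q).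
have [yz vz zW'] : [/\ bform y z = 0, bform v z = 0 & forall w, w \in W -> bform w z = 0].
  by split=> [||w wW]; apply: zW; rewrite !inE ?eqxx ?orbT // wW !orbT.
pose rho := - bform y y / bform z z.
have [r hr] : exists r, forall t, t != r -> t != - r -> t ^+ 2 != rho.
  case: (pselect (exists r, r ^+ 2 = rho)) => [[r <-]|h]; last first.
    by exists 0 => t _ _; apply: contra_notN h => /eqP <-; exists t.
  by exists r => t t1 t2; rewrite eqf_sqr negb_or t1.
have [t t0 [tr tr' _]] := infinite_avoid2 r (- r) 0.
exists (y + t *: z); split.
- by move=> w wW; rewrite formDr formZr yW // zW' // mulr0 addr0.
- by rewrite formDr formZr vz mulr0 addr0.
- move=> h; apply: zQ; rewrite -(scale1r z) -(mulVf t0) -scalerA; apply: LinZ.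
  rewrite -(addKr y (t *: z)); apply: LinD; first by apply/LinN/Lin_mem; rewrite mem_head.
  by apply: Lin_subset h => x xQ; rewrite inE xQ orbT.
- move: az; rewrite /anisotropic; case: (boolP alt) => //= nalt zz.
  rewrite (formDl FN) !formDr !(formZl FN) !formZr (form_eq0C yz) yz !mulr0 addr0 add0r.
  rewrite addr_eq0; apply: contraNneq (hr t tr tr') => E.
  by rewrite /rho E opprK mulrA mulfK.
Qed.

End Infinite.
End FormSpace.

(** * The Fubini dimension of sets of tuples of scalars *)

Section ThinSets.
Variable K : fieldType.
Implicit Types (S T : seq K -> Prop) (D d n : nat) (z y : seq K).

Fixpoint null d S : Prop :=
  if d is d'.+1 then exists s : seq K, forall t, t \notin s -> null d' (fun z => S (t :: z))
  else ~ S [::].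

(** The lists have length exactly [D], repetitions allowed: padding makes the notion monotone in
    [D], and a list of known length can be quantified over in a formula. *)
Fixpoint thin D d S : Prop :=
  if d is d'.+1 then exists2 s : seq K, size s = D &
    forall t, t \notin s -> thin D d' (fun z => S (t :: z))
  else ~ S [::].

Lemma null_sub d S T : (forall z, size z = d -> S z -> T z) -> null d T -> null d S.
Proof.
elim: d S T => [|d IH] S T h /=; first by move=> hT hS; exact: hT (h _ _ hS).
move=> [s hs]; exists s => t /hs; apply: IH => z sz; apply: h; by rewrite /= sz.
Qed.

Lemma thin_sub D d S T : (forall z, size z = d -> S z -> T z) -> thin D d T -> thin D d S.
Proof.
elim: d S T => [|d IH] S T h /=; first by move=> hT hS; exact: hT (h _ _ hS).
move=> [s ss hs]; exists s => // t /hs; apply: IH => z sz; apply: h; by rewrite /= sz.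
Qed.

Lemma null_union d S T : null d S -> null d T -> null d (fun z => S z \/ T z).
Proof.
elim: d S T => [|d IH] S T /=; first by tauto.
move=> [s hs] [s' hs']; exists (s ++ s') => t; rewrite mem_cat negb_or => /andP[ts ts'].
exact: IH (hs t ts) (hs' t ts').
Qed.

Lemma thin_union D D' d S T : thin D d S -> thin D' d T -> thin (D + D') d (fun z => S z \/ T z).
Proof.
elim: d S T => [|d IH] S T /=; first by tauto.
move=> [s ss hs] [s' ss' hs']; exists (s ++ s'); first by rewrite size_cat ss ss'.
move=> t; rewrite mem_cat negb_or => /andP[ts ts'].
exact: IH (hs t ts) (hs' t ts').
Qed.

Lemma thin_empty D d : thin D d (fun _ => False).
Proof. by elim: d => [|d IH] //=; exists (nseq D 0); rewrite ?size_nseq. Qed.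

Lemma thin_leq D D' d S : (D <= D')%N -> thin D d S -> thin D' d S.
Proof.
move=> le h; rewrite -(subnKC le).
by apply: thin_sub (thin_union h (thin_empty (D' - D) d)) => z _; left.
Qed.

Lemma null_thin D d S : thin D d S -> null d S.
Proof.
elim: d S => [|d IH] S //= [s _ hs]; exists s => t /hs; exact: IH.
Qed.

Hypothesis inf_K : forall s : seq K, exists x, x \notin s.

Lemma null_full d S : (forall z, size z = d -> S z) -> ~ null d S.
Proof.
elim: d S => [|d IH] S h /=; first by move/(_ (h [::] erefl)).
move=> [s hs]; have [t ts] := inf_K s; apply: IH (hs t ts) => z sz.
by apply: h; rewrite /= sz.
Qed.

Lemma null_nonempty d S : ~ null d S -> exists2 z, size z = d & S z.
Proof.
move=> h; apply: contrapT => h'; apply: h; apply: null_thin (thin_sub _ (thin_empty 0 d)).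
by move=> z sz Sz; apply: h'; exists z.
Qed.

Lemma cothin_not_null D d S : thin D d (fun z => ~ S z) -> ~ null d S.
Proof.
move=> h h'; apply: (@null_full d (fun z => ~ S z \/ S z)); last exact: null_union (null_thin h) h'.
by move=> z _; case: (EM (S z)); [right|left].
Qed.

(** Exceptional sets are attached to coordinates from the front; this lemma and [null_rcons] make
    the last coordinate accessible. *)
Lemma thin_rcons D d S : thin D d.+1 S ->
  thin D d (fun z => ~ exists2 s : seq K, size s = D & forall t, S (rcons z t) -> t \in s).
Proof.
elim: d S => [|d IH] S /=.
  move=> [s ss hs]; apply; exists s => // t St; apply: contrapT => /negP ts.
  exact: hs ts St.
move=> [s ss hs]; exists s => // t /hs ht; exact: (IH (fun z => S (t :: z)) ht).
Qed.

Lemma null_rcons d E S : null d E ->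
  (forall z, size z = d -> ~ E z -> exists s : seq K, forall t, S (rcons z t) -> t \in s) ->
  null d.+1 S.
Proof.
elim: d E S => [|d IH] E S /=.
  move=> nE h; have [s hs] := h [::] erefl nE; exists s => t ts St.
  by move: ts; rewrite (hs t).
move=> [s hs] h; exists s => t /hs hE.
apply: (IH (fun z => E (t :: z)) (fun z => S (t :: z)) hE) => z sz nE.
by apply: (h (t :: z)); rewrite /= ?sz.
Qed.

Definition bounded_degree D n (f : seq K -> K) := forall z i, size z = n -> (i < n)%N ->
  exists2 p : {poly K}, (size p <= D.+1)%N & forall x, f (set_nth 0 z i x) = p.[x].

(** As [f] does not vanish at [z0], the polynomial obtained by freeing only the first coordinate is
    nonzero. Off its at most [D] roots, replacing that coordinate again gives a point where [f] does
    not vanish, and the next coordinate is treated with it. *)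
Lemma thin_zeros D n f z0 : bounded_degree D n f -> size z0 = n -> f z0 != 0 ->
  thin D n (fun z => f z = 0).
Proof.
move=> bf s0 f0.
suff H : forall d pre w, (size pre + d = n)%N -> size w = d -> f (pre ++ w) != 0 ->
    thin D d (fun z => f (pre ++ z) = 0).
  exact: (H n [::] z0).
elim=> [|d IH] pre w; first by case: w => // _ _ /eqP.
case: w => // x0 w sp [sw] fw /=.
have [||p sp' hp] := bf (pre ++ x0 :: w) (size pre); first by rewrite size_cat /= sw.
  by rewrite -sp addnS ltnS leq_addr.
have E x : f (pre ++ x :: w) = p.[x].
  by rewrite -hp; congr f; elim: (pre) => //= a l ->.
have p0 : p != 0 by apply: contraNneq fw => p0; rewrite E p0 horner0.
have [s [ss hs]] : exists s : seq K, size s = D /\ forall t, t \notin s -> p.[t] != 0.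
  (* The roots can be listed: otherwise distinct ones could be collected until there are more than
     the degree allows. *)
  have [r [ur rP sr]] : exists r : seq K, [/\ uniq r, all (root p) r &
      forall t, root p t -> t \in r].
    apply: contrapT => hr.
    have H q : exists r : seq K, [/\ uniq r, size r = q & all (root p) r].
      elim: q => [|q [r [ur sr rr]]]; first by exists [::].
      have [t rt tr] : exists2 t, root p t & t \notin r.
        apply: contrapT => ht; apply: hr; exists r; split=> // t rt.
        by apply: contrapT => /negP tr; apply: ht; exists t.
      by exists (t :: r); rewrite /= tr sr rt.
    have [r [ur sr rr]] := H (size p).
    by have := max_poly_roots p0 rr ur; rewrite sr ltnn.
  have lt_r : (size r <= D)%N.
    by rewrite -ltnS; apply: leq_trans sp'; exact: max_poly_roots p0 rP ur.
  (* Padding to length exactly [D]; enlarging an exceptional set does no harm. *)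
  exists (r ++ nseq (D - size r) 0); rewrite size_cat size_nseq subnKC //; split=> // t.
  by rewrite mem_cat negb_or => /andP[tr _]; apply: contra tr => /eqP rt; apply/sr/eqP.
exists s => // t /hs ht.
apply: thin_sub (IH (rcons pre t) w _ sw _); rewrite ?size_rcons ?addSnnS // ?cat_rcons ?E //.
by move=> z _; rewrite cat_rcons.
Qed.

Definition proj n (sg : seq nat) S z := exists y, [/\ size y = n, S y & z = [seq y`_i | i <- sg]].

(** The dimension itself is never named: [d] is a lower bound for it. *)
Definition gdim n S d := exists sg : seq nat,
  [/\ uniq sg, all (fun i => i < n)%N sg, size sg = d & ~ null d (proj n sg S)].

Lemma gdim_le n S d : gdim n S d -> (d <= n)%N.
Proof.
move=> [sg [u /allP a <- _]]; rewrite -(size_iota 0 n); apply: uniq_leq_size => // i /a.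
by rewrite mem_iota.
Qed.

Definition cylinder_mask (n : nat) (sg : seq nat) := filter (fun i => i < n)%N sg.

Lemma null_cylinder n c sg S : null (size (cylinder_mask n sg)) (proj n (cylinder_mask n sg) S) ->
  null (size sg) (proj (n + c) sg (fun e => S (take n e))).
Proof.
move=> h.
pose T sg' (P : seq K -> Prop) z := P (mask [seq (i < n)%N | i <- sg'] z).
have H : forall sg' P, null (size (cylinder_mask n sg')) P -> null (size sg') (T sg' P).
  elim=> [|i sg' IH] P //=; rewrite /T /=; case: (i < n)%N => /=.
    by move=> [s hs]; exists s => t /hs; exact: IH.
  by move=> hP; exists [::] => t _; exact: IH.
apply: null_sub (H _ _ h) => z _ [y [sy Sy ->]]; exists (take n y); split=> //.
  by rewrite size_takel // sy leq_addr.
rewrite -map_mask /cylinder_mask filter_mask.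
apply/eq_in_map => i; rewrite -filter_mask mem_filter => /andP[lt_i _].
by rewrite nth_take.
Qed.

(** The [c] coordinates on which the set does not depend account for at most [c] dimensions. In the
    orbit argument they carry the scalars not determined by the moved point. *)
Lemma gdim_cylinder n c S d : gdim (n + c) (fun e => S (take n e)) d ->
  exists2 d', (d <= d' + c)%N & gdim n S d'.
Proof.
move=> [sg [u a sz h]]; exists (size (cylinder_mask n sg)); last first.
  exists (cylinder_mask n sg); split=> //; first exact: filter_uniq.
    by apply/allP => i; rewrite mem_filter => /andP[].
  by move=> h'; apply: h; rewrite -sz; exact: null_cylinder.
rewrite -sz -(count_predC (fun i => i < n)%N sg) /cylinder_mask size_filter leq_add2l.
rewrite -size_filter -(size_iota n c); apply: uniq_leq_size; first exact: filter_uniq.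
move=> i; rewrite mem_filter mem_iota => /andP[/= h1 /(allP a) ->].
by rewrite leqNgt h1.
Qed.

(* Off a thin set, all the coordinates of a point of S are determined up to
   finitely many choices by those in J. *)
Lemma finite_fibres n S J D :
  uniq J -> all (fun i => i < n)%N J ->
  (forall l, (l < n)%N -> l \notin J -> thin D (size J).+1 (proj n (rcons J l) S)) ->
  exists D' D'' E, thin D'' (size J) E /\ forall z, size z = size J -> ~ E z ->
    exists2 L : seq (seq K), (size L <= D')%N & forall y, size y = n -> S y ->
      [seq y`_i | i <- J] = z -> y \in L.
Proof.
move=> uJ aJ h.
suff H : forall l, (l <= n)%N -> exists D' D'' E, thin D'' (size J) E /\
    forall z, size z = size J -> ~ E z ->
    exists2 L : seq (seq K), (size L <= D')%N & forall y, size y = n -> S y ->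
      [seq y`_i | i <- J] = z -> take l y \in L.
  have [D' [D'' [E [tE hE]]]] := H n (leqnn n); exists D', D'', E; split=> // z sz nz.
  have [L sL hL] := hE z sz nz; exists L => // y sy Sy yz.
  by rewrite -(take_size y) sy; exact: hL.
elim=> [|l IH] lt_l.
  exists 1%N, 0%N, (fun _ => False); split; first exact: thin_empty.
  by move=> z _ _; exists [:: [::]] => // y *; rewrite take0 inE.
have [D' [D'' [E [tE hE]]]] := IH (ltnW lt_l).
(* A coordinate in [J] is read off [z], any other takes at most [D] values off a thin set; [D.+1]
   bounds both cases. *)
have [D1 [E1 [tE1 hE1]]] : exists D1 E1, thin D1 (size J) E1 /\
    forall z, size z = size J -> ~ E1 z -> exists2 s : seq K, (size s <= D.+1)%N &
      forall y, size y = n -> S y -> [seq y`_i | i <- J] = z -> y`_l \in s.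
  case: (boolP (l \in J)) => lJ.
    exists 0%N, (fun _ => False); split; first exact: thin_empty.
    move=> z sz _; exists [:: z`_(index l J)] => // y sy Sy <-.
    by rewrite (nth_map 0%N) ?index_mem // nth_index // mem_head.
  have := thin_rcons (h l lt_l lJ) => tE1.
  exists D; eexists; split; first exact: tE1.
  move=> z sz /contrapT[s ss hs]; exists s; first by rewrite ss.
  move=> y sy Sy yz; apply: hs; exists y; split=> //.
  by rewrite map_rcons yz.
exists (D' * D.+1)%N, (D'' + D1)%N, (fun z => E z \/ E1 z); split; first exact: thin_union.
move=> z sz nE.
have [L sL hL] := hE z sz (fun e => nE (or_introl e)).
have [s ss hs] := hE1 z sz (fun e => nE (or_intror e)).
exists [seq rcons y t | y <- L, t <- s] => [|y sy Sy yz].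
  by rewrite size_allpairs; exact: leq_mul.
rewrite (take_nth 0) ?sy //; apply: allpairs_f; [exact: hL|exact: hs].
Qed.

End ThinSets.

(** The last coordinate is moved to the front. That nullity of a definable set is invariant under
    this rotation is the only exchange of coordinates on which the dimension theory relies. *)
Definition rot1 (T : Type) (S : seq T -> Prop) (e : seq T) := S (rotr 1 e).

Definition dfn (N : lstruct) k m (P : seq (vect N) -> seq (scal N) -> Prop) :=
  gdef (N := fun _ : unit => N) (fun (v : vect N) _ => v) (fun (c : scal N) _ => c) k m
    (fun _ vs ks => P vs ks).

Definition dKs (N : lstruct) k m j (F : seq (vect N) -> seq (scal N) -> seq (scal N)) :=
  gKs (N := fun _ : unit => N) (fun (v : vect N) _ => v) (fun (c : scal N) _ => c) k m j
    (fun _ vs ks => F vs ks).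

Definition dVs (N : lstruct) k m j (F : seq (vect N) -> seq (scal N) -> seq (vect N)) :=
  gVs (N := fun _ : unit => N) (fun (v : vect N) _ => v) (fun (c : scal N) _ => c) k m j
    (fun _ vs ks => F vs ks).

Lemma dKs_var N k m : @dKs N k m m (fun _ ks => ks).
Proof. exact: gKs_var. Qed.

Lemma dVs_var N k m : @dVs N k m k (fun vs _ => vs).
Proof. exact: gVs_var. Qed.

(** * Dimension of definable sets, from the dichotomy between thin and non-null *)

Section Dimension.
Variable N : lstruct.
Local Notation K := (scal N).
Implicit Types (S T : seq K -> Prop).

Definition dset n S := @dfn N 0 n (fun _ ks => S ks).

Hypothesis inf_K : forall s : seq K, exists x, x \notin s.
Hypothesis dichotomy : forall n S, dset n S ->
  (exists D, thin D n S /\ thin D n (rot1 S)) \/ (~ null n S /\ ~ null n (rot1 S)).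

Lemma dset_proj n sg S : dset n S -> dset (size sg) (proj n sg S).
Proof.
move=> dS.
have H : dset (size sg) (fun ks => exists2 y, size y = n & S y /\ ks = [seq y`_i | i <- sg]).
  apply: gdef_exKs; apply: gdef_and.
    apply: (gdef_comp (P := fun _ _ ks => S ks) dS (gVs_nil _ _ _ _)).
    exact: gKs_take (dKs_var N 0 (n + size sg)).
  apply: (gdef_eqKs (j := size sg)); first exact: gKs_drop (dKs_var N 0 (n + size sg)).
  apply: gKs_map => i; apply: gK_nth.
  exact: gKs_take (dKs_var N 0 (n + size sg)).
apply: gdef_ext H _ => _ _ ks _ _.
by split=> [[y [sy Sy ->]]|[y sy [Sy ->]]]; exists y.
Qed.

Lemma dset_null_thin n S : dset n S -> null n S -> exists D, thin D n S.
Proof. by move=> /dichotomy[[D [h _]]|[h _] /h//]; exists D. Qed.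

(** Every projection onto [J] and one further coordinate is null, hence thin by the dichotomy, and
    there are finitely many further coordinates, so one bound serves for all of them. *)
Lemma not_gdim_finite_fibres n S d J : dset n S -> ~ gdim n S d.+1 ->
  uniq J -> all (fun i => i < n)%N J -> size J = d ->
  exists D' D'' E, thin D'' d E /\ forall z, size z = d -> ~ E z ->
    exists2 L : seq (seq K), (size L <= D')%N & forall y, size y = n -> S y ->
      [seq y`_i | i <- J] = z -> y \in L.
Proof.
move=> dS nS uJ aJ sJ.
suff [D hD] : exists D, forall l, (l < n)%N -> l \notin J ->
    thin D (size J).+1 (proj n (rcons J l) S).
  by have := finite_fibres uJ aJ hD; rewrite sJ.
suff H : forall q, exists D, forall l, (l < q)%N -> (l < n)%N -> l \notin J ->
    thin D (size J).+1 (proj n (rcons J l) S).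
  by have [D hD] := H n; exists D => l lt_l; exact: hD.
elim=> [|q [D hD]]; first by exists 0%N.
have [D' hD'] : exists D', (q < n)%N -> q \notin J -> thin D' (size J).+1 (proj n (rcons J q) S).
  case: (boolP ((q < n)%N && (q \notin J))) => [/andP[lt_q qJ]|/negP h]; last first.
    by exists 0%N => h1 h2; case: h; rewrite h1.
  have := dset_proj (rcons J q) dS; rewrite size_rcons => dP.
  have [|D' hD'] := dset_null_thin dP; last by exists D'.
  apply: contrapT => nn; apply: nS; exists (rcons J q); split.
  - by rewrite rcons_uniq qJ.
  - by rewrite all_rcons lt_q.
  - by rewrite size_rcons sJ.
  - by rewrite -sJ.
exists (D + D')%N => l; rewrite ltnS leq_eqVlt => /orP[/eqP->|lt_l] h1 h2.
  by apply: thin_leq (hD' h1 h2); exact: leq_addl.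
by apply: thin_leq (hD l lt_l h1 h2); exact: leq_addr.
Qed.

Lemma finite_pigeonhole (T : finType) (A : K -> Prop) (B : T -> K -> Prop) :
  (forall s : seq K, exists2 t, A t & t \notin s) -> (forall t, A t -> exists x, B x t) ->
  exists x, forall s : seq K, exists2 t, B x t & t \notin s.
Proof.
move=> infA AB; apply: contrapT => h.
have /choice[f hf] (x : T) : exists s : seq K, forall t, B x t -> t \in s.
  apply: contrapT => hx; apply: h; exists x => s; apply: contrapT => hs.
  by apply: hx; exists s => t Bt; apply: contrapT => /negP ts; apply: hs; exists t.
have [t At /negP[]] := infA (flatten [seq f x | x <- enum T]).
have [x Bx] := AB t At; apply/flattenP; exists (f x); last exact: hf.
by apply: map_f; rewrite mem_enum.
Qed.

Lemma gdim_tuple n S d : gdim n S d <-> exists sg : d.-tuple 'I_n,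
  uniq sg /\ ~ null d (proj n (map val sg) S).
Proof.
split=> [[sg [u a sz h]]|[sg [u h]]]; last first.
  exists (map val sg); rewrite (map_inj_uniq val_inj) size_map size_tuple.
  by split=> //; apply/allP => _ /mapP[i _ ->]; exact: ltn_ord.
have E : map val (pmap (fun i => insub i : option 'I_n) sg) = sg.
  rewrite (pmap_filter (@insubK _ _ _)); apply/all_filterP.
  by apply: sub_all a => i /= lt_i; rewrite insubT.
have sE : size (pmap (fun i => insub i : option 'I_n) sg) == d by rewrite -(size_map val) E sz.
exists (Tuple sE); split; last by rewrite /= E.
by rewrite /= -(map_inj_uniq val_inj) E.
Qed.

(* A definable function does not raise dimension.  By induction on d: the
   fibres of its first coordinate have dimension d over infinitely many points,
   so that a d-dimensional projection of infinitely many of them is generic for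
   the same coordinates, contradicting finite fibres. *)
Lemma gdim_image n d (Y : seq K -> Prop) (G : seq K -> seq K -> Prop) :
  dset n Y -> dset (n + d) (fun e => G (take n e) (drop n e)) ->
  (forall y z z', size y = n -> Y y -> size z = d -> size z' = d -> G y z -> G y z' -> z = z') ->
  ~ null d (fun z => exists y, [/\ size y = n, Y y & G y z]) ->
  gdim n Y d.
Proof.
elim: d Y G => [|d IH] Y G dY dG fG nn.
  have [z _ [y [sy Yy _]]] := null_nonempty nn.
  by exists [::]; split=> //=; apply; exists y.
apply: contrapT => nY.
pose Yt t y := Y y /\ exists2 z, size z = d & G y (t :: z).
have dG' q (F H : seq K -> seq K) : dKs 0 q n (fun _ ks => F ks) ->
    dKs 0 q d.+1 (fun _ ks => H ks) -> dset q (fun ks => G (F ks) (H ks)).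
  move=> hF hH; have := gdef_comp dG (gVs_nil _ _ 0 q) (gKs_cat hF hH).
  move=> h; apply: gdef_ext h _ => _ vs ks sv sk.
  have sF := gKs_size (i := tt) hF sv sk.
  by rewrite take_size_cat // drop_size_cat.
pose A t := ~ null d (fun z => exists y, [/\ size y = n, Y y & G y (t :: z)]).
have infA (s : seq K) : exists2 t, A t & t \notin s.
  apply: contrapT => h; apply: nn; exists s => t ts; apply: contrapT => At.
  by apply: h; exists t.
pose B (sg : d.-tuple 'I_n) t := uniq sg /\ ~ null d (proj n (map val sg) (Yt t)).
have [|J infJ] := finite_pigeonhole (B := B) infA.
  move=> t At; apply/(gdim_tuple n (Yt t) d).
  apply: (IH (Yt t) (fun y z => G y (t :: z))).
  - apply: gdef_and => //; apply: gdef_exKs; apply: dG'.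
      exact: gKs_drop (dKs_var N 0 (d + n)).
    apply: gKs_cons; first exact: gK_const.
    exact: gKs_take (dKs_var N 0 (d + n)).
  - apply: dG'; first exact: gKs_take (dKs_var N 0 (n + d)).
    apply: gKs_cons; first exact: gK_const.
    exact: gKs_drop (dKs_var N 0 (n + d)).
  - move=> y z z' sy [Yy _] sz sz' h1 h2.
    by have /= := fG y (t :: z) (t :: z') sy Yy; rewrite sz sz' => /(_ erefl erefl h1 h2)[].
  - move=> h; apply: At; apply: null_sub h => z sz [y [sy Yy Gy]].
    by exists y; split=> //; split=> //; exists z.
(* The pairs of a first coordinate [t] and the [J]-coordinates of a point of [Y] over [t]. With [t]
   in front this set is not null, by the choice of [J]. With [t] at the end it is null: off a thin
   set the [J]-coordinates leave finitely many points of [Y], and each of them determines [t]. *)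
pose S' (e : seq K) := proj n (map val J) (Yt (head 0 e)) (behead e).
have dS' : dset d.+1 S'.
  have H : dset d.+1 (fun ks => exists2 y, size y = n & exists2 z, size z = d &
      Y y /\ G y (head 0 ks :: z) /\ behead ks = [seq y`_i | i <- map val J]).
    apply: gdef_exKs; apply: gdef_exKs.
    have hdr := gKs_drop (dKs_var N 0 (d + (n + d.+1))).
    have hy := gKs_take hdr; have hr := gKs_drop hdr.
    apply: gdef_and.
      by apply: (gdef_comp (P := fun _ _ ks => Y ks) dY (gVs_nil _ _ _ _) hy).
    apply: gdef_and.
      apply: (dG' _ (fun ks => take n (drop d ks))) => //.
      apply: gKs_cons.
        by apply: gK_ext (gK_nth 0 hr) _ => _ _ ks _ _; rewrite nth0.
      exact: gKs_take (dKs_var N 0 (d + (n + d.+1))).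
    apply: (gdef_eqKs (j := d)).
      apply: gKs_ext (gKs_drop (l := 1) (j := d) hr) _ => *.
      by rewrite drop1.
    rewrite -[X in gKs _ _ _ _ X](size_tuple J) -(size_map val).
    by apply: gKs_map => i; exact: gK_nth hy.
  apply: gdef_ext H _ => _ _ ks _ _.
  split=> [[y [sy [Yy [z sz Gz]] E]]|[y sy [z sz [Yy [Gz E]]]]].
    by exists y => //; exists z.
  by exists y; split=> //; split=> //; exists z.
have uJ : uniq (map val J).
  by have [t [u _] _] := infJ [::]; rewrite (map_inj_uniq val_inj).
have aJ : all (fun i => i < n)%N (map val J).
  by apply/allP => _ /mapP[i _ ->]; exact: ltn_ord.
have sJ : size (map val J) = d by rewrite size_map size_tuple.
have nS' : ~ null d.+1 S'.
  move=> [s hs]; have [t [_ nt] ts] := infJ s; exact: nt (hs t ts).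
have nS'' : ~ null d.+1 (rot1 S').
  by case: (dichotomy dS') => [[D [/null_thin //]]|[]].
apply: nS''.
have [D' [D'' [E [tE hE]]]] := not_gdim_finite_fibres dY nY uJ aJ sJ.
apply: null_rcons (null_thin tE) _ => z sz nE.
have [L _ hL] := hE z sz nE.
have /choice[f hf] (y : seq K) : exists t0, forall t, Yt t y -> size y = n -> t = t0.
  case: (pselect (exists t, Yt t y /\ size y = n)) => [[t0 [[Yy [z0 sz0 G0]] sy]]|h]; last first.
    by exists 0 => t ht sy; case: h; exists t.
  exists t0 => t [_ [z1 sz1 G1]] _.
  by have := fG _ (t :: z1) (t0 :: z0) sy Yy; rewrite /= sz0 sz1 => /(_ erefl erefl G1 G0)[].
exists [seq f y | y <- L] => t; rewrite /rot1 rotr1_rcons => -[y [sy hy yz]].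
have [Yy _] := hy.
by apply/mapP; exists y; [exact: (hL y sy Yy (esym yz))|exact: hf].
Qed.

Hypothesis zariski : forall n S, dset n S -> ~ null n S -> exists D, thin D n (fun z => ~ S z).

(** Infinitely many [Z i] are non-null on the same [d] coordinates, and by [zariski] their
    projections are co-thin. If [Y] had no larger dimension, its fibres over these coordinates would
    have at most [D'] points off a thin set; but [D'.+1] of the projections share a point off that
    set, and the disjoint [Z i] give as many points of [Y] over it. *)
Lemma gdim_disjoint n d (Y : seq K -> Prop) (Z : nat -> seq K -> Prop) :
  dset n Y -> (forall i, dset n (Z i)) -> (forall i y, size y = n -> Z i y -> Y y) ->
  (forall i j y, size y = n -> Z i y -> Z j y -> i = j) ->
  (forall i, gdim n (Z i) d) -> gdim n Y d.+1.
Proof.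
move=> dY dZ ZY disj hd; apply: contrapT => nY.
have /choice[sg hsg] i := (gdim_tuple n (Z i) d).1 (hd i).
have [J infJ] : exists J, forall s : seq nat, exists2 i, sg i = J & i \notin s.
  apply: contrapT => h.
  have /choice[f hf] (x : d.-tuple 'I_n) : exists s : seq nat, forall t, sg t = x -> t \in s.
    apply: contrapT => hx; apply: h; exists x => s; apply: contrapT => hs.
    by apply: hx; exists s => t Bt; apply: contrapT => /negP ts; apply: hs; exists t.
  pose l := flatten [seq f x | x <- enum {: d.-tuple 'I_n}].
  have tl t : t \in l.
    apply/flattenP; exists (f (sg t)); last exact: hf.
    by apply: map_f; rewrite mem_enum.
  have := tl (\max_(t <- l) t).+1; move/(@leq_bigmax_seq _ l xpredT id).
  by move/(_ isT); rewrite ltnn.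
have uJ : uniq (map val J).
  by have [i <- _] := infJ [::]; rewrite (map_inj_uniq val_inj) (hsg i).1.
have aJ : all (fun i => i < n)%N (map val J).
  by apply/allP => _ /mapP[i _ ->]; exact: ltn_ord.
have sJ : size (map val J) = d by rewrite size_map size_tuple.
have [D' [D'' [E [tE hE]]]] := not_gdim_finite_fibres dY nY uJ aJ sJ.
have [I [uI sI hI]] : exists I : seq nat, [/\ uniq I, size I = D'.+1 & forall i, i \in I -> sg i = J].
  elim: D'.+1 => [|q [I [uI sI hI]]]; first by exists [::].
  have [i iJ iI] := infJ I; exists (i :: I); split; rewrite /= ?iI ?sI //.
  by move=> j; rewrite inE => /orP[/eqP->|/hI].
have [D1 tI] : exists D1, thin D1 d (fun z => exists2 i, i \in I & ~ proj n (map val J) (Z i) z).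
  elim: I {uI sI} hI => [|i I IH] hI.
    by exists 0%N; apply: thin_sub (thin_empty _ _ _) => z _ [].
  have [D1 h1] := IH (fun j jI => hI j (mem_behead (s := i :: I) jI)).
  have := dset_proj (map val J) (dZ i); rewrite sJ => dP.
  have [|D2 h2] := zariski dP.
    by have := (hsg i).2; rewrite hI ?mem_head.
  exists (D2 + D1)%N; apply: thin_sub (thin_union h2 h1) => z _ [j].
  by rewrite inE => /orP[/eqP->|jI] hj; [left|right; exists j].
have [z sz nz] : exists2 z, size z = d & ~ (E z \/ exists2 i, i \in I & ~ proj n (map val J) (Z i) z).
  apply: contrapT => h; apply: (@null_full _ inf_K d _ _ (null_thin (thin_union tE tI))) => z sz.
  by apply: contrapT => nz; apply: h; exists z.
have [L sL hL] := hE z sz (fun h => nz (or_introl h)).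
have /choice[y hy] (i : nat) : exists y, i \in I -> [/\ size y = n, Z i y & z = [seq y`_j | j <- map val J]].
  case: (boolP (i \in I)) => iI; last by exists [::].
  apply: contrapT => h; apply: nz; right; exists i => // -[y [sy Zy zy]]; apply: h.
  by exists y.
have : (size [seq y i | i <- I] <= size L)%N.
  apply: uniq_leq_size.
    rewrite map_inj_in_uniq // => i j iI jI E1.
    have [si Zi _] := hy i iI; have [sj Zj _] := hy j jI.
    by apply: disj si Zi _; rewrite E1.
  move=> _ /mapP[i iI ->]; have [si Zi zi] := hy i iI.
  by apply: hL => //; exact: ZY Zi.
by rewrite size_map sI => /leq_trans/(_ sL); rewrite ltnn.
Qed.

End Dimension.

(** * Quantifier elimination for the scalars *)

Section Interpretation.
Variables (N : lstruct) (alt : bool) (bs : seq (vect N)).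
Hypothesis FN : form_space N alt.
Hypothesis spanning : forall v, Lin bs v.
Hypothesis free : lin_indep bs.
Local Notation K := (scal N).
Local Notation V := (vect N).
Variables (T : nat -> (seq K -> K) -> Prop) (D : nat -> (seq K -> Prop) -> Prop).
Hypotheses (T_ext : forall n f g, (forall e, size e = n -> f e = g e) -> T n f -> T n g)
  (T0 : forall n, T n (fun _ => 0)) (T1 : forall n, T n (fun _ => 1))
  (T_var : forall n i, (i < n)%N -> T n (fun e => e`_i))
  (TD : forall n f g, T n f -> T n g -> T n (fun e => f e + g e))
  (TM : forall n f g, T n f -> T n g -> T n (fun e => f e * g e))
  (T_gram : forall n x y, x \in bs -> y \in bs -> T n (fun _ => bform x y))
  (T_weak : forall n f, T n f -> T n.+1 (fun e => f (take n e))).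
Hypotheses (D_ext : forall n P Q, (forall e, size e = n -> (P e <-> Q e)) -> D n P -> D n Q)
  (D_eq : forall n f g, T n f -> T n g -> D n (fun e => f e = g e))
  (D_not : forall n P, D n P -> D n (fun e => ~ P e))
  (D_and : forall n P Q, D n P -> D n Q -> D n (fun e => P e /\ Q e))
  (D_ex : forall n (P : seq K -> K -> Prop),
     D n.+1 (fun e => P (take n e) e`_n) -> D n (fun e => exists x, P e x)).

(** A vector depending on scalars is represented by its coordinate functions in the basis [bs], all
    taken from the class [T]. *)
Definition TV n (F : seq K -> V) := exists ts : seq (seq K -> K),
  [/\ size ts = size bs, List.Forall (T n) ts &
    forall e, size e = n -> F e = comb [seq f e | f <- ts] bs].

Lemma T_weaks n j f : T n f -> T (n + j) (fun e => f (take n e)).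
Proof.
move=> hf; elim: j => [|j IH].
  by rewrite addn0; apply: T_ext hf => e se; rewrite -se take_size.
rewrite addnS; apply: T_ext (T_weak IH) => e se.
by rewrite take_takel // leq_addr.
Qed.

Lemma TV_weaks n j F : TV n F -> TV (n + j) (fun e => F (take n e)).
Proof.
move=> [ts [sts hts E]]; exists [seq (fun e => f (take n e)) | f <- ts]; split.
- by rewrite size_map.
- elim: hts => [|f s hf _ IH] /=; constructor => //; exact: T_weaks.
- move=> e se; rewrite E; last by rewrite size_takel // se leq_addr.
  by rewrite -map_comp.
Qed.

Lemma TV0 n : TV n (fun _ => 0).
Proof.
exists [seq (fun=> 0) | _ <- bs]; split; first by rewrite size_map.
  by elim: (bs) => /= [|x s IH]; constructor.
move=> e _; rewrite -map_comp -[LHS](comb0 bs); congr comb.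
by elim: (bs) => //= x s ->.
Qed.

Lemma TVD n F G : TV n F -> TV n G -> TV n (fun e => F e + G e).
Proof.
move=> [ts [sts hts E]] [us [sus hus E']].
exists [seq (fun e => p.1 e + p.2 e) | p <- zip ts us]; split.
- by rewrite size_map size_zip sts sus minnn.
- have {sus}sus : size us = size ts by rewrite sus.
  elim: hts us sus hus {E E' sts} => [|f s hf _ IH] [|g u] //=.
  by move=> [su] hu; inversion_clear hu; constructor; [exact: TD|exact: IH].
- move=> e se; rewrite E // E' // -combD ?size_map ?sts //; congr comb.
  rewrite -map_comp; elim: (ts) (us) => [|f s IH] [|g u] //=.
  by rewrite IH.
Qed.

Lemma TVZ n f F : T n f -> TV n F -> TV n (fun e => f e *: F e).
Proof.
move=> hf [ts [sts hts E]]; exists [seq (fun e => f e * g e) | g <- ts]; split.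
- by rewrite size_map.
- by elim: hts => [|g s hg _ IH] /=; constructor => //; exact: TM.
- by move=> e se; rewrite E // -combZ -!map_comp.
Qed.

Lemma T_form n F G : TV n F -> TV n G -> T n (fun e => bform (F e) (G e)).
Proof.
move=> [ts [sts hts E]] [us [sus hus E']].
apply: (@T_ext _ (fun e => bform (comb [seq f e | f <- ts] bs) (comb [seq f e | f <- us] bs))).
  by move=> e se; rewrite E // E'.
have H x : x \in bs -> T n (fun e => bform x (comb [seq f e | f <- us] bs)).
  move=> xb; have : {subset bs <= bs} by [].
  elim: hus {1 3}(bs) {E' sus} => [|f u hf _ IH] [|y b] /= sb;
    try by (apply: T_ext (T0 n) => e _; rewrite (form0r FN)).
  apply: T_ext (TD (TM hf (T_gram n xb (sb y (mem_head _ _)))) (IH b _)) => [e _|z zb].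
    by rewrite (formDr FN) (formZr FN).
  by apply: sb; rewrite inE zb orbT.
have : {subset bs <= bs} by [].
elim: hts {1 3}(bs) {E sts} => [|f s hf _ IH] [|y b] /= sb;
  try by (apply: T_ext (T0 n) => e _; rewrite (form0l FN)).
apply: T_ext (TD (TM hf (H y (sb y (mem_head _ _)))) (IH b _)) => [e _|z zb].
  by rewrite (formDl FN) (formZl FN).
by apply: sb; rewrite inE zb orbT.
Qed.

Lemma TV_var n : TV (n + size bs) (fun e => comb (drop n e) bs).
Proof.
exists [seq (fun e => e`_(n + i)) | i <- iota 0 (size bs)]; split.
- by rewrite size_map size_iota.
- suff : forall l, (forall i, i \in l -> i < size bs)%N ->
      List.Forall (T (n + size bs)) [seq (fun e => e`_(n + i)%N) | i <- l].
    by apply=> i; rewrite mem_iota.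
  elim=> [|i l IH] h /=; first by constructor.
  constructor; first by apply: T_var; rewrite ltn_add2l h ?mem_head.
  by apply: IH => j jl; apply: h; rewrite inE jl orbT.
- move=> e se; congr comb; rewrite -map_comp; apply: (@eq_from_nth _ 0).
    by rewrite size_drop se addKn size_map size_iota.
  move=> i; rewrite size_drop se addKn => lt_i.
  by rewrite (nth_map 0%N) ?size_iota // nth_iota // nth_drop.
Qed.

Lemma D_exs j n (P : seq K -> seq K -> Prop) :
  D (n + j) (fun e => P (take n e) (drop n e)) ->
  D n (fun e => exists2 z, size z = j & P e z).
Proof.
elim: j n P => [|j IH] n P h.
  rewrite addn0 in h; apply: D_ext h => e se; rewrite take_oversize ?drop_oversize ?se //.
  by split=> [h|[[]//]]; exists [::].
have H : D n (fun e => exists x, exists2 z, size z = j & P e (x :: z)).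
  apply: D_ex; apply: (IH n.+1 (fun e z => P (take n e) (e`_n :: z))).
  rewrite addSnnS; apply: D_ext h => e se.
  rewrite take_takel // nth_take //.
  by rewrite (drop_nth 0) // se addnS ltnS leq_addr.
apply: D_ext H => e se; split=> [[x [z sz hP]]|[[|x z] // [sz] hP]].
  by exists (x :: z); rewrite /= ?sz.
by exists x, z.
Qed.

Lemma interpret_terms n (FV : seq (seq K -> V)) (FK : seq (seq K -> K)) :
  List.Forall (TV n) FV -> List.Forall (T n) FK ->
  (forall t, TV n (fun e => veval [seq F e | F <- FV] [seq f e | f <- FK] t)) /\
  (forall t, T n (fun e => keval [seq F e | F <- FV] [seq f e | f <- FK] t)).
Proof.
move=> hV hK; apply: vkterm_ind => /=.
- elim: hV => [|F s hF _ IH] [|i] /=; try exact: TV0; [exact: hF|exact: IH].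
- exact: TV0.
- by move=> *; exact: TVD.
- by move=> *; exact: TVZ.
- elim: hK => [|F s hF _ IH] [|i] /=; try exact: T0; [exact: hF|exact: IH].
- exact: T0.
- exact: T1.
- by move=> *; exact: TD.
- by move=> *; exact: TM.
- by move=> *; exact: T_form.
Qed.

Lemma D_list_eq n (ts us : seq (seq K -> K)) : size ts = size us ->
  List.Forall (T n) ts -> List.Forall (T n) us ->
  D n (fun e => [seq f e | f <- ts] = [seq f e | f <- us]).
Proof.
move=> stu hts; elim: hts us stu => [|f s hf _ IH] [|g u] //=.
  by move=> _ _; apply: D_ext (D_eq (T0 n) (T0 n)).
move=> [su] hu; inversion_clear hu.
apply: D_ext (D_and (D_eq hf H) (IH u su H0)) => e _.
by split=> [[-> ->]|[-> ->]].
Qed.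

Lemma comb_inj c d : size c = size bs -> size d = size bs -> comb c bs = comb d bs -> c = d.
Proof.
have ind : lin_indep_over (Lin [::]) bs by move=> c' /Lin_nil; exact: free.
move=> sc sd E; have /indepP h := ind.
have E0 : [seq p.1 + p.2 | p <- zip c (map ( *%R (-1)) d)] = nseq (size bs) 0.
  apply: h; first by rewrite size_map size_zip size_map sc sd minnn.
  by rewrite combD ?size_map ?sc ?sd // combZ E scaleN1r subrr; exact: Lin0.
apply: (@eq_from_nth _ 0); rewrite sc ?sd // => i lt_i.
move: (congr1 (fun l => nth 0 l i) E0); rewrite nth_nseq if_same (nth_map (0, 0)); last first.
  by rewrite size_zip size_map sc sd minnn.
rewrite nth_zip ?size_map ?sc ?sd //= (nth_map 0) ?sd // mulN1r => /eqP.
by rewrite subr_eq0 => /eqP.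
Qed.

(** A vector quantifier becomes a block of [size bs] scalar quantifiers, since [bs] spans, and
    equality of vectors becomes equality of coordinates, since [bs] is free. New variables are
    appended at the end, so that the functions already present are only weakened. The classes [T]
    and [D] stay abstract in order to serve both ring formulas and ordered formulas. *)
Lemma interpret phi : forall n (FV : seq (seq K -> V)) (FK : seq (seq K -> K)),
  List.Forall (TV n) FV -> List.Forall (T n) FK ->
  D n (fun e => holds [seq F e | F <- FV] [seq f e | f <- FK] phi).
Proof.
elim: phi => [t1 t2|t1 t2|phi IH|phi IH psi IH'|phi IH|phi IH] n FV FK hV hK /=.
- have [/(_ t1) [ts [sts hts E]] _] := interpret_terms hV hK.
  have [/(_ t2) [us [sus hus E']] _] := interpret_terms hV hK.
  apply: D_ext (D_list_eq _ hts hus) => [e se|]; last by rewrite sts.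
  by rewrite E // E' //; split=> [->//|/comb_inj]; apply; rewrite size_map.
- by apply: D_eq; exact: (interpret_terms hV hK).2.
- exact: D_not (IH _ _ _ hV hK).
- exact: D_and (IH _ _ _ hV hK) (IH' _ _ _ hV hK).
- have H : D n (fun e => exists2 z, size z = size bs &
      holds (comb z bs :: [seq F e | F <- FV]) [seq f e | f <- FK] phi).
    apply: D_exs.
    have := IH (n + size bs)%N ((fun e => comb (drop n e) bs) :: [seq (fun e => F (take n e)) | F <- FV])
      [seq (fun e => f (take n e)) | f <- FK].
    move=> h; apply: D_ext (h _ _) => [e se||].
    + by rewrite /= -!map_comp.
    + constructor; first exact: TV_var.
      by elim: hV => [|F s hF _ IH'] /=; constructor => //; exact: TV_weaks.
    + by elim: hK => [|F s hF _ IH'] /=; constructor => //; exact: T_weaks.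
  apply: D_ext H => e _; split=> [[z _ hz]|[v hv]]; first by exists (comb z bs).
  by have /LinP[c sc E] := spanning v; exists c => //; rewrite -E.
- apply: D_ex.
  have := IH n.+1 [seq (fun e => F (take n e)) | F <- FV]
    ((fun e => e`_n) :: [seq (fun e => f (take n e)) | f <- FK]).
  move=> h; apply: D_ext (h _ _) => [e se||].
  + by rewrite /= -!map_comp.
  + rewrite -addn1.
    by elim: hV => [|F s hF _ IH'] /=; constructor => //; exact: TV_weaks.
  + constructor; first exact: T_var.
    by elim: hK => [|F s hF _ IH'] /=; constructor => //; exact: T_weak.
Qed.

End Interpretation.

(** * Ring terms as polynomial functions with thin zero sets *)

Section RingTerms.
Variables (K R : fieldType) (phi : {rmorphism K -> R}) (psi : R -> K).
Hypotheses (phiK : cancel phi psi) (psiK : cancel psi phi).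
Implicit Types (t : GRing.term R) (e z : seq K).

Definition ring_fun n (f : seq K -> K) := exists2 t, GRing.rterm t &
  forall e, (n <= size e)%N -> phi (f (take n e)) = GRing.eval (map phi e) t.

Lemma nth_phi e i : (map phi e)`_i = phi e`_i.
Proof. by rewrite (@nth_map_default _ _ 0) // rmorph0. Qed.

Lemma ring_fun_ext n f g : (forall e, size e = n -> f e = g e) -> ring_fun n f -> ring_fun n g.
Proof.
move=> fg [t rt E]; exists t => // e se; rewrite -E // fg //.
by rewrite size_takel.
Qed.

Lemma ring_fun_const n a : ring_fun n (fun _ => a).
Proof. by exists (GRing.Const (phi a)). Qed.

Lemma ring_fun_var n i : (i < n)%N -> ring_fun n (fun e => e`_i).
Proof. by move=> lt_i; exists (GRing.Var R i) => // e _; rewrite /= nth_phi nth_take. Qed.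

Lemma ring_funD n f g : ring_fun n f -> ring_fun n g -> ring_fun n (fun e => f e + g e).
Proof.
move=> [t rt E] [u ru E']; exists (GRing.Add t u); rewrite /= ?rt // => e se.
by rewrite rmorphD E // E'.
Qed.

Lemma ring_funM n f g : ring_fun n f -> ring_fun n g -> ring_fun n (fun e => f e * g e).
Proof.
move=> [t rt E] [u ru E']; exists (GRing.Mul t u); rewrite /= ?rt // => e se.
by rewrite rmorphM E // E'.
Qed.

Lemma ring_fun_weak n f : ring_fun n f -> ring_fun n.+1 (fun e => f (take n e)).
Proof.
move=> [t rt E]; exists t => // e se; rewrite take_takel ?leqnSn // E //.
exact: ltnW.
Qed.

Lemma eval_poly_in t : GRing.rterm t -> exists D, forall e i,
  exists2 p : {poly K}, (size p <= D.+1)%N &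
    forall x, GRing.eval (map phi (set_nth 0 e i x)) t = phi p.[x].
Proof.
elim: t => //=.
- move=> j _; exists 1%N => e i; case: (eqVneq j i) => [->|ji].
    exists 'X; first by rewrite size_polyX.
    by move=> x; rewrite nth_phi nth_set_nth /= eqxx hornerX.
  exists (e`_j)%:P; first by rewrite (leq_trans (size_polyC_leq1 _)).
  by move=> x; rewrite nth_phi nth_set_nth /= (negPf ji) hornerC.
- move=> a _; exists 0%N => e i; exists (psi a)%:P; first exact: size_polyC_leq1.
  by move=> x; rewrite hornerC psiK.
- move=> a _; exists 0%N => e i; exists (a%:R)%:P; first exact: size_polyC_leq1.
  by move=> x; rewrite hornerC rmorph_nat.
- move=> t IHt u IHu /andP[/IHt[D hD] /IHu[D' hD']]; exists (D + D')%N => e i.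
  have [p sp hp] := hD e i; have [q sq hq] := hD' e i.
  exists (p + q); last by move=> x; rewrite hp hq hornerD rmorphD.
  apply: leq_trans (size_polyD _ _) _; rewrite geq_max.
  by rewrite (leq_trans sp) ?ltnS ?leq_addr // (leq_trans sq) ?ltnS ?leq_addl.
- move=> t IHt /IHt[D hD]; exists D => e i; have [p sp hp] := hD e i.
  by exists (- p); rewrite ?size_polyN // => x; rewrite hp hornerN rmorphN.
- move=> t IHt q /IHt[D hD]; exists D => e i; have [p sp hp] := hD e i.
  exists (p *+ q); last by move=> x; rewrite hp hornerMn rmorphMn.
  by rewrite -scaler_nat (leq_trans (size_scale_leq _ _)).
- move=> t IHt u IHu /andP[/IHt[D hD] /IHu[D' hD']]; exists (D + D')%N => e i.
  have [p sp hp] := hD e i; have [q sq hq] := hD' e i.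
  exists (p * q); last by move=> x; rewrite hp hq hornerM rmorphM.
  apply: leq_trans (size_polyMleq _ _) _; rewrite -subn1 leq_subLR.
  by rewrite (leq_trans (leq_add sp sq)) // addnS addSn add1n.
- move=> t IHt q /IHt[D hD]; exists (D * q)%N => e i; have [p sp hp] := hD e i.
  exists (p ^+ q); last by move=> x; rewrite hp horner_exp rmorphXn.
  apply: leq_trans (size_poly_exp_leq _ _) _; rewrite ltnS leq_mul2r.
  by case: (size p) sp => [|s] /=; rewrite ?leq0n ?orbT // ltnS => ->; rewrite orbT.
Qed.

Lemma bounded_degree_rot D n (f : seq K -> K) :
  bounded_degree D n f -> bounded_degree D n (fun z => f (rotr 1 z)).
Proof.
move=> hf z i sz lt_i; case/lastP: z sz => [|z t] sz; first by rewrite -sz in lt_i.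
rewrite size_rcons in sz; have [lt_iz|le_zi] := ltnP i (size z).
  have [||p sp hp] := hf (t :: z) i.+1; [by []|by rewrite -sz ltnS|].
  exists p => // x; rewrite -hp; congr f.
  have -> : set_nth 0 (rcons z t) i x = rcons (set_nth 0 z i x) t.
    by elim: z i lt_iz {sz lt_i hp} => // a z IH [|i] //= lt_i; rewrite IH.
  by rewrite rotr1_rcons.
have [||p sp hp] := hf (t :: z) 0%N; [by []|by rewrite -sz|].
exists p => // x; rewrite -hp; congr f.
have -> : set_nth 0 (rcons z t) i x = rcons z x.
  have -> : i = size z by apply/eqP; rewrite eqn_leq le_zi andbT -ltnS sz.
  by elim: (z) => //= a l ->.
by rewrite rotr1_rcons.
Qed.

Definition term_fun t (z : seq K) : K := psi (GRing.eval (map phi z) t).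

Lemma term_fun0 t z : (term_fun t z = 0) <-> (GRing.eval (map phi z) t = 0).
Proof.
rewrite /term_fun; split=> [|->]; last by rewrite -(rmorph0 phi) phiK.
by move/(congr1 phi); rewrite psiK rmorph0.
Qed.

Lemma thin_term_zeros n t : GRing.rterm t ->
  (forall z, size z = n -> GRing.eval (map phi z) t = 0) \/
  exists D, thin D n (fun z => GRing.eval (map phi z) t = 0) /\
            thin D n (rot1 (fun z => GRing.eval (map phi z) t = 0)).
Proof.
move=> /eval_poly_in[D hD].
case: (pselect (exists2 z, size z = n & GRing.eval (map phi z) t <> 0)) => [[z0 s0 h0]|h]; last first.
  by left=> z sz; apply: contrapT => hz; apply: h; exists z.
right; exists D.
have bd : bounded_degree D n (term_fun t).
  move=> z i _ _; have [p sp hp] := hD z i; exists p => // x.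
  by rewrite /term_fun hp phiK.
split; apply: thin_sub.
- by move=> z _ /(term_fun0 t z).2 hz; exact: hz.
- by apply: thin_zeros bd s0 _; apply/eqP => /term_fun0.
- by move=> z _ /(term_fun0 t (rotr 1 z)).2 hz; exact: hz.
- apply: (thin_zeros (bounded_degree_rot bd) (z0 := rot 1 z0)); first by rewrite size_rot.
  by rewrite rotK; apply/eqP => /term_fun0.
Qed.

(** Off one thin set, each of finitely many terms either vanishes identically or has no zero. So a
    quantifier-free formula is constant there if only vanishing of terms matters, and locally
    constant if signs matter. *)
Lemma thin_terms_zeros n (ts : seq (GRing.term R)) : (forall t, List.In t ts -> GRing.rterm t) ->
  exists D E, [/\ thin D n E, thin D n (rot1 E) & forall t, List.In t ts ->
    (forall z, size z = n -> GRing.eval (map phi z) t = 0) \/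
    (forall z, size z = n -> ~ E z -> GRing.eval (map phi z) t <> 0)].
Proof.
elim: ts => [|t ts IH] rts.
  exists 0%N, (fun _ => False); split=> //; exact: thin_empty.
have [|D [E [tE tE' hE]]] := IH; first by move=> u uts; apply: rts; right.
have [h|[D' [h h']]] := thin_term_zeros n (rts t (or_introl erefl)).
  by exists D, E; split=> // u [<-|/hE]; [left|].
exists (D + D')%N, (fun z => E z \/ GRing.eval (map phi z) t = 0); split.
- exact: thin_union.
- exact: thin_union tE' h'.
- move=> u [<-|/hE[]h1]; [right|by left|right] => z sz nE.
    by move=> h0; apply: nE; right.
  by apply: h1 => // Ez; apply: nE; left.
Qed.

End RingTerms.

Section QuantifierElimination.
Variables (N : lstruct) (alt : bool) (bs : seq (vect N)).
Hypothesis FN : form_space N alt.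
Hypothesis spanning : forall v, Lin bs v.
Hypothesis free : lin_indep bs.
Local Notation K := (scal N).

Lemma Forall_constants (T : nat -> (seq K -> K) -> Prop) n (s : seq (vect N)) :
  (forall a, T n (fun _ => a)) -> List.Forall (TV bs T n) [seq (fun=> v) | v <- s].
Proof.
move=> T_const; elim: s => [|v l IH] /=; constructor => //.
have [c sc E] := (LinP bs v).1 (spanning v).
exists [seq (fun=> a) | a <- c]; split; first by rewrite size_map.
  by elim: (c) => [|a c' IH'] /=; constructor.
by move=> e _; rewrite -map_comp E; congr comb; rewrite -[LHS]map_id.
Qed.

Lemma Forall_variables (T : nat -> (seq K -> K) -> Prop) n (s : seq K) :
  (forall a, T n (fun _ => a)) -> (forall i, (i < n)%N -> T n (fun e => e`_i)) ->
  List.Forall (T n) ([seq (fun e => e`_i) | i <- iota 0 n] ++ [seq (fun=> c) | c <- s]).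
Proof.
move=> T_const T_var.
suff H l : (forall i, i \in l -> (i < n)%N) ->
    List.Forall (T n) ([seq (fun e => e`_i) | i <- l] ++ [seq (fun=> c) | c <- s]).
  by apply: H => i; rewrite mem_iota.
elim: l => [|i l IH] hl /=.
  by elim: (s) => [|a c' IH'] /=; constructor.
constructor; first by apply: T_var; apply: hl; rewrite mem_head.
by apply: IH => j jl; apply: hl; rewrite inE jl orbT.
Qed.

Lemma eval_variables n (e s : seq K) : size e = n ->
  [seq f e | f <- [seq (fun e : seq K => e`_i) | i <- iota 0 n] ++ [seq (fun=> c) | c <- s]] = e ++ s.
Proof.
move=> se; rewrite map_cat -!map_comp; congr cat; last by rewrite -[RHS]map_id.
apply: (@eq_from_nth _ 0); rewrite size_map size_iota // => i lt_i.
by rewrite (nth_map 0%N) ?size_iota // nth_iota.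
Qed.

Lemma dset_interpret (T : nat -> (seq K -> K) -> Prop) (D : nat -> (seq K -> Prop) -> Prop) :
  (forall n f g, (forall e, size e = n -> f e = g e) -> T n f -> T n g) ->
  (forall n a, T n (fun _ => a)) ->
  (forall n i, (i < n)%N -> T n (fun e => e`_i)) ->
  (forall n f g, T n f -> T n g -> T n (fun e => f e + g e)) ->
  (forall n f g, T n f -> T n g -> T n (fun e => f e * g e)) ->
  (forall n f, T n f -> T n.+1 (fun e => f (take n e))) ->
  (forall n P Q, (forall e, size e = n -> (P e <-> Q e)) -> D n P -> D n Q) ->
  (forall n f g, T n f -> T n g -> D n (fun e => f e = g e)) ->
  (forall n P, D n P -> D n (fun e => ~ P e)) ->
  (forall n P Q, D n P -> D n Q -> D n (fun e => P e /\ Q e)) ->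
  (forall n (P : seq K -> K -> Prop),
     D n.+1 (fun e => P (take n e) e`_n) -> D n (fun e => exists x, P e x)) ->
  forall n S, dset n S -> D n S.
Proof.
move=> T_ext T_const T_var TD TM T_weak D_ext D_eq D_not D_and D_ex n S dS.
have [s [s' /(_ s s')]] := dS.
case=> [||phi hphi]; try exact: List.incl_refl.
have := @interpret N alt bs FN spanning free T D T_ext (fun n => T_const n 0) (fun n => T_const n 1)
  T_var TD TM (fun n x y _ _ => T_const n (bform x y)) T_weak D_ext D_eq D_not D_and D_ex
  phi n [seq (fun=> v) | v <- s]
  ([seq (fun e => e`_i) | i <- iota 0 n] ++ [seq (fun=> c) | c <- s']).
move=> h; apply: D_ext (h _ _).
- move=> e se; rewrite (hphi tt [::] e erefl se) eval_variables //.
  by rewrite /vconst /kconst -map_comp !map_id.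
- by apply: Forall_constants => a; exact: T_const.
- by apply: Forall_variables => [a|i]; [exact: T_const|exact: T_var].
Qed.

Definition acf_def n (P : seq K -> Prop) := exists2 F : GRing.formula K, GRing.rformula F &
  forall e, (n <= size e)%N -> (P (take n e) <-> GRing.holds e F).

Lemma dset_acf n S : dset n S -> acf_def n S.
Proof.
apply: (@dset_interpret (ring_fun (idfun : {rmorphism K -> K}))) => {n S}.
- exact: ring_fun_ext.
- exact: ring_fun_const.
- exact: ring_fun_var.
- exact: ring_funD.
- exact: ring_funM.
- exact: ring_fun_weak.
- move=> n P Q PQ [F rF h]; exists F => // e se; rewrite -h // PQ //.
  by rewrite size_takel.
- move=> n f g [t rt E] [u ru E']; exists (GRing.Equal t u); rewrite /= ?rt // => e se.
  by rewrite -[f _]/(idfun (f _)) -[g _]/(idfun (g _)) E // E' // map_id.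
- by move=> n P [F rF h]; exists (GRing.Not F) => // e se /=; rewrite h.
- by move=> n P Q [F rF h] [G rG h']; exists (GRing.And F G); rewrite /= ?rF // => e se; rewrite h // h'.
- move=> n P [F rF h]; exists (GRing.Exists n F) => // e se /=.
  have E x : P (take n e) x <-> GRing.holds (set_nth 0 e n x) F.
    rewrite -h; last by rewrite size_set_nth leq_max leqnn.
    rewrite take_takel // nth_take // nth_set_nth /= eqxx.
    suff -> : take n (set_nth 0 e n x) = take n e by [].
    by elim: (e) (n) se => [|a l IH] [|q] //= se; rewrite IH.
  by split=> -[x /E hx]; exists x.
Qed.

End QuantifierElimination.

(** * Quantifier-free formulas as conditions on finitely many terms, and their behaviour near a
    point *)

Section Atoms.

Lemma acf_atoms (K : fieldType) (F : GRing.formula K) : GRing.qf_form F -> GRing.rformula F ->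
  exists2 ts : seq (GRing.term K), forall t, List.In t ts -> GRing.rterm t &
    forall e e', (forall t, List.In t ts -> (GRing.eval e t == 0) = (GRing.eval e' t == 0)) ->
    GRing.qf_eval e F = GRing.qf_eval e' F.
Proof.
elim: F => //=.
- by exists [::].
- move=> t u _ /andP[rt ru]; exists [:: GRing.Add t (GRing.Opp u)] => [w [<-|//]|e e' h].
    by rewrite /= rt.
  by have /= := h _ (or_introl erefl); rewrite !subr_eq0.
- move=> F IHF G IHG /andP[/IHF{}IHF /IHG{}IHG] /andP[/IHF[ts rts hF] /IHG[us rus hG]].
  exists (ts ++ us) => [w /(@List.in_app_or _ _ _ _)[/rts|/rus]//|e e' h].
  by rewrite (hF e e') ?(hG e e') // => t ht; apply: h; apply: List.in_or_app; [right|left].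
- move=> F IHF G IHG /andP[/IHF{}IHF /IHG{}IHG] /andP[/IHF[ts rts hF] /IHG[us rus hG]].
  exists (ts ++ us) => [w /(@List.in_app_or _ _ _ _)[/rts|/rus]//|e e' h].
  by rewrite (hF e e') ?(hG e e') // => t ht; apply: h; apply: List.in_or_app; [right|left].
- move=> F IHF G IHG /andP[/IHF{}IHF /IHG{}IHG] /andP[/IHF[ts rts hF] /IHG[us rus hG]].
  exists (ts ++ us) => [w /(@List.in_app_or _ _ _ _)[/rts|/rus]//|e e' h].
  by rewrite (hF e e') ?(hG e e') // => t ht; apply: h; apply: List.in_or_app; [right|left].
- by move=> F IHF /IHF{}IHF /IHF[ts rts hF]; exists ts => // e e' /hF ->.
Qed.

Lemma rcf_atoms (R : rcfType) (F : ordered_qelim.ord.formula R) : ordered_qelim.ord.qf_form F -> ordered_qelim.ord.rformula F ->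
  exists2 ts : seq (GRing.term R), forall t, List.In t ts -> GRing.rterm t &
    forall e e', (forall t, List.In t ts -> Num.sg (GRing.eval e t) = Num.sg (GRing.eval e' t)) ->
    ordered_qelim.ord.qf_eval e F = ordered_qelim.ord.qf_eval e' F.
Proof.
elim: F => //=.
- by exists [::].
- move=> t u _ /andP[rt ru]; exists [:: GRing.Add t (GRing.Opp u)] => [w [<-|//]|e e' h].
    by rewrite /= rt.
  have /= := h _ (or_introl erefl) => E.
  by rewrite -subr_eq0 -[in RHS]subr_eq0 -sgr_eq0 E sgr_eq0.
- move=> t u _ /andP[rt ru]; exists [:: GRing.Add t (GRing.Opp u)] => [w [<-|//]|e e' h].
    by rewrite /= rt.
  have /= := h _ (or_introl erefl) => E.
  by rewrite -subr_lt0 -[in RHS]subr_lt0 -sgr_lt0 E sgr_lt0.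
- move=> t u _ /andP[rt ru]; exists [:: GRing.Add t (GRing.Opp u)] => [w [<-|//]|e e' h].
    by rewrite /= rt.
  have /= := h _ (or_introl erefl) => E.
  by rewrite -subr_le0 -[in RHS]subr_le0 -sgr_le0 E sgr_le0.
- move=> F IHF G IHG /andP[/IHF{}IHF /IHG{}IHG] /andP[/IHF[ts rts hF] /IHG[us rus hG]].
  exists (ts ++ us) => [w /(@List.in_app_or _ _ _ _)[/rts|/rus]//|e e' h].
  by rewrite (hF e e') ?(hG e e') // => t ht; apply: h; apply: List.in_or_app; [right|left].
- move=> F IHF G IHG /andP[/IHF{}IHF /IHG{}IHG] /andP[/IHF[ts rts hF] /IHG[us rus hG]].
  exists (ts ++ us) => [w /(@List.in_app_or _ _ _ _)[/rts|/rus]//|e e' h].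
  by rewrite (hF e e') ?(hG e e') // => t ht; apply: h; apply: List.in_or_app; [right|left].
- move=> F IHF G IHG /andP[/IHF{}IHF /IHG{}IHG] /andP[/IHF[ts rts hF] /IHG[us rus hG]].
  exists (ts ++ us) => [w /(@List.in_app_or _ _ _ _)[/rts|/rus]//|e e' h].
  by rewrite (hF e e') ?(hG e e') // => t ht; apply: h; apply: List.in_or_app; [right|left].
- by move=> F IHF /IHF{}IHF /IHF[ts rts hF]; exists ts => // e e' /hF ->.
Qed.

End Atoms.

Section Continuity.
Variable R : rcfType.
Implicit Types (e : seq R) (g h : seq R -> R).

Definition continuous_at g e := forall eps, 0 < eps -> exists2 dl, 0 < dl &
  forall e', (forall i, `|e'`_i - e`_i| < dl) -> `|g e' - g e| < eps.

Lemma continuous_const a e : continuous_at (fun _ => a) e.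
Proof. by move=> eps e0; exists 1 => // e' _; rewrite subrr normr0. Qed.

Lemma continuousD g h e : continuous_at g e -> continuous_at h e ->
  continuous_at (fun e => g e + h e) e.
Proof.
move=> cg ch eps e0; have e2 : 0 < eps / 2 by rewrite divr_gt0.
have [d1 d10 h1] := cg _ e2; have [d2 d20 h2] := ch _ e2.
exists (Num.min d1 d2); first by rewrite lt_min d10.
move=> e' he'; have {}h1 : `|g e' - g e| < eps / 2.
  by apply: h1 => i; have := he' i; rewrite lt_min => /andP[].
have {}h2 : `|h e' - h e| < eps / 2.
  by apply: h2 => i; have := he' i; rewrite lt_min => /andP[].
rewrite opprD addrACA (splitr eps); exact: le_lt_trans (ler_normD _ _) (ltrD h1 h2).
Qed.

Lemma continuousM g h e : continuous_at g e -> continuous_at h e ->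
  continuous_at (fun e => g e * h e) e.
Proof.
move=> cg ch eps e0.
pose M := `|g e| + `|h e| + 1.
have M0 : 0 < M by rewrite ltr_wpDl // addr_ge0.
pose eta := Num.min 1 (eps / M).
have eta0 : 0 < eta by rewrite lt_min ltr01 divr_gt0.
have [d1 d10 h1] := cg _ eta0; have [d2 d20 h2] := ch _ eta0.
exists (Num.min d1 d2); first by rewrite lt_min d10.
move=> e' he'; have {}h1 : `|g e' - g e| < eta.
  by apply: h1 => i; have := he' i; rewrite lt_min => /andP[].
have {}h2 : `|h e' - h e| < eta.
  by apply: h2 => i; have := he' i; rewrite lt_min => /andP[].
have -> : g e' * h e' - g e * h e = (g e' - g e) * (h e' - h e) + (g e' - g e) * h e + g e * (h e' - h e).
  by ring.
have etaM : eta * M <= eps.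
  by rewrite -(ler_pdivlMr _ _ M0) ge_min lexx orbT.
apply: lt_le_trans etaM.
have eta1 : eta <= 1 by rewrite ge_min lexx.
apply: le_lt_trans (ler_normD _ _) _.
apply: le_lt_trans (lerD (ler_normD _ _) (lexx _)) _; rewrite !normrM.
move: h1 h2 (normr_ge0 (g e)) (normr_ge0 (h e)) (normr_ge0 (g e' - g e)) (normr_ge0 (h e' - h e)).
rewrite /M; move: (`|g e' - g e|) (`|h e' - h e|) (`|g e|) (`|h e|) => a b c d.
by clear -eta1 eta0 => *; nra.
Qed.

Lemma continuous_eval t e : GRing.rterm t -> continuous_at (fun e => GRing.eval e t) e.
Proof.
elim: t => //=.
- by move=> i _ eps e0; exists eps.
- by move=> *; exact: continuous_const.
- by move=> *; exact: continuous_const.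
- by move=> t IHt u IHu /andP[/IHt h /IHu]; exact: continuousD.
- move=> t IHt /IHt h eps e0; have [dl dl0 hd] := h _ e0.
  by exists dl => // e' /hd; rewrite -opprD normrN.
- move=> t IHt q /IHt h; elim: q => [|q IH]; first exact: continuous_const.
  by have := continuousD h IH => H eps /H[dl dl0 hd]; exists dl => // e' /hd; rewrite !mulrS.
- by move=> t IHt u IHu /andP[/IHt h /IHu]; exact: continuousM.
- move=> t IHt q /IHt h; elim: q => [|q IH]; first exact: continuous_const.
  by have := continuousM h IH => H eps /H[dl dl0 hd]; exists dl => // e' /hd; rewrite !exprS.
Qed.

Lemma continuous_sg t e : GRing.rterm t -> GRing.eval e t <> 0 -> exists2 dl, 0 < dl &
  forall e', (forall i, `|e'`_i - e`_i| < dl) ->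
    Num.sg (GRing.eval e' t) = Num.sg (GRing.eval e t).
Proof.
move=> rt /eqP t0; have [|dl dl0 hd] := continuous_eval e rt (eps := `|GRing.eval e t|).
  by rewrite normr_gt0.
exists dl => // e' /hd; move: t0; move: (GRing.eval e t) (GRing.eval e' t) => a b.
case: (ltgtP a 0) => // a0 _.
  rewrite (ltr0_norm a0) ltr_norml => /andP[h1 h2]; rewrite !ltr0_sg //; lra.
rewrite (gtr0_norm a0) ltr_norml => /andP[h1 h2]; rewrite !gtr0_sg //; lra.
Qed.

Lemma continuous_sgs (ts : seq (GRing.term R)) e :
  (forall t, List.In t ts -> GRing.rterm t) ->
  exists2 dl, 0 < dl & forall e', (forall i, `|e'`_i - e`_i| < dl) ->
    forall t, List.In t ts -> GRing.eval e t <> 0 ->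
    Num.sg (GRing.eval e' t) = Num.sg (GRing.eval e t).
Proof.
elim: ts => [|t ts IH] rts; first by exists 1.
have [|d1 d10 h1] := IH; first by move=> u hu; apply: rts; right.
case: (pselect (GRing.eval e t = 0)) => [E|t0].
  by exists d1 => // e' he' u [<- //|hu]; exact: h1.
have [d2 d20 h2] := continuous_sg (rts t (or_introl erefl)) t0.
exists (Num.min d1 d2); first by rewrite lt_min d10.
move=> e' he' u [<-|hu] hu0.
  by apply: h2 => i; have := he' i; rewrite lt_min => /andP[].
by apply: h1 => // i; have := he' i; rewrite lt_min => /andP[].
Qed.

End Continuity.

Section Boxes.
Variable K : fieldType.

Fixpoint in_box (lo hi z : seq K) : Prop :=
  match lo, hi, z with
  | l :: lo', h :: hi', x :: z' => (sq_lt l x /\ sq_lt x h) /\ in_box lo' hi' z'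
  | [::], [::], [::] => True
  | _, _, _ => False
  end.

Fixpoint box_ok (lo hi : seq K) : Prop :=
  match lo, hi with
  | l :: lo', h :: hi' => sq_lt l h /\ box_ok lo' hi'
  | [::], [::] => True
  | _, _ => False
  end.

Lemma in_box_rcons lo hi z l h x : size lo = size hi -> size lo = size z ->
  in_box (rcons lo l) (rcons hi h) (rcons z x) <-> in_box (l :: lo) (h :: hi) (x :: z).
Proof.
elim: lo hi z => [|l' lo IH] [|h' hi] [|x' z] //= [s1] [s2].
by rewrite IH //=; tauto.
Qed.

Lemma box_ok_rcons lo hi l h : size lo = size hi ->
  box_ok (rcons lo l) (rcons hi h) <-> box_ok (l :: lo) (h :: hi).
Proof. by elim: lo hi => [|l' lo IH] [|h' hi] //= [s1]; rewrite IH //=; tauto. Qed.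

Lemma box_ok_size lo hi : box_ok lo hi -> size lo = size hi.
Proof. by elim: lo hi => [|l lo IH] [|h hi] //= [_ /IH ->]. Qed.

Hypothesis sq_lt_infinite : forall l h : K, sq_lt l h ->
  forall s : seq K, exists2 t, sq_lt l t /\ sq_lt t h & t \notin s.

Lemma box_not_null d lo hi S : box_ok lo hi -> size lo = d ->
  (forall z, in_box lo hi z -> S z) -> ~ null d S.
Proof.
elim: d lo hi S => [|d IH] [|l lo] [|h hi] S //=; first by move=> _ _ /(_ [::] I) hS /(_ hS).
move=> [lh ok] [sl] hS [s hs].
have [t lt ts] := sq_lt_infinite lh s.
by apply: (IH lo hi _ ok sl _ (hs t ts)) => z hz; apply: hS.
Qed.

End Boxes.

Section RealClosed.
Variables (K : fieldType) (R : rcfType) (phi : {rmorphism K -> R}) (psi : R -> K).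
Hypotheses (phiK : cancel phi psi) (psiK : cancel psi phi).

Lemma sq_ltP (x y : K) : sq_lt x y <-> phi x < phi y.
Proof.
split=> [[z z0 E]|lt_xy].
  rewrite -subr_gt0 -rmorphB E rmorphXn exprn_even_gt0 //=.
  by rewrite fmorph_eq0.
exists (psi (Num.sqrt (phi y - phi x))).
  by rewrite -(fmorph_eq0 phi) psiK gt_eqF // sqrtr_gt0 subr_gt0.
apply: (can_inj phiK); rewrite rmorphB rmorphXn psiK sqr_sqrtr //.
by rewrite subr_ge0 ltW.
Qed.

Lemma sq_lt_avoid (l h : K) : sq_lt l h ->
  forall s : seq K, exists2 t, sq_lt l t /\ sq_lt t h & t \notin s.
Proof.
move=> /sq_ltP lh s; apply: contrapT => hs.
(* Infinitely many points of the interval; the denominators start at 2 because the quotient by 1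
   would give the end point [h]. *)
pose q (i : nat) := psi (phi l + (phi h - phi l) / i.+2%:R).
have d0 : 0 < phi h - phi l by rewrite subr_gt0.
have qs i : q i \in s.
  apply: contrapT => /negP qi; apply: hs; exists (q i) => //.
  split; apply/sq_ltP; rewrite psiK; first by rewrite ltrDl divr_gt0 // ltr0n.
  rewrite addrC -ltrBrDr ltr_pdivrMr ?ltr0n // ltr_pMr // ltr1n.
  by [].
have q_inj : injective q.
  move=> i j /(can_inj psiK) /addrI /(mulfI (lt0r_neq0 d0)) /invr_inj /eqP.
  by rewrite eqr_nat => /eqP[].
have : (size [seq q i | i <- iota 0 (size s).+1] <= size s)%N.
  apply: uniq_leq_size; first by rewrite map_inj_uniq // iota_uniq.
  by move=> _ /mapP[i _ ->]; exact: qs.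
by rewrite size_map size_iota ltnn.
Qed.

End RealClosed.

Lemma real_closed_cancel (K : fieldType) : real_closed K ->
  exists (R : rcfType) (phi : {rmorphism K -> R}) (psi : R -> K), cancel phi psi /\ cancel psi phi.
Proof. by move=> [R [phi [psi phiK psiK]]]; exists R, phi, psi. Qed.

Lemma scal_infinite (F : scal_theory) (K : fieldType) : scal_model F K ->
  forall s : seq K, exists x, x \notin s.
Proof.
case: F => [p [closed _]|/real_closed_cancel[R [phi [psi [phiK psiK]]]]] s.
  case: s => [|x s]; first by exists 0.
  (* Euclid's trick: a root of this polynomial differs from every element of the list. The list must
     be nonempty for the polynomial not to be constant. *)
  pose P := \prod_(y <- x :: s) ('X - y%:P) + 1 : {poly K}.
  have sP : size P != 1%N.
    by rewrite /P size_polyDl size_prod_XsubC // size_poly1.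
  have [y /rootP hy] := PreClosedField.closed_rootP closed P sP.
  exists y; apply/negP => ys; move: hy; rewrite /P hornerD hornerC horner_prod.
  rewrite (big_rem y) //= hornerXsubC subrr mul0r add0r => /eqP.
  by rewrite oner_eq0.
have lt01 : sq_lt (0 : K) 1 by apply/(sq_ltP phiK psiK); rewrite rmorph0 rmorph1 ltr01.
by have [t _ ts] := sq_lt_avoid phiK psiK lt01 s; exists t.
Qed.

Lemma scal_two (F : scal_theory) (K : fieldType) : admissible F -> scal_model F K ->
  2%:R != 0 :> K.
Proof.
case: F => [p /= hp [_ hc]|_ /real_closed_cancel[R [phi _]]]; last first.
  by rewrite -(fmorph_eq0 phi) rmorph_nat pnatr_eq0.
apply/negP => two0.
have c2 : 2%N \in [pchar K] by rewrite inE.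
case: hp hc => [->|[pp p2]] /=; first by move/(_ 2%N); rewrite c2.
by case: p pp p2 => // p _ /negP p2; rewrite /has_char (pcharf_eq c2) inE.
Qed.

(** * The dichotomy for definable sets of scalars *)

Section Dichotomy.
Variables (N : lstruct) (alt : bool) (bs : seq (vect N)).
Hypothesis FN : form_space N alt.
Hypothesis spanning : forall v, Lin bs v.
Hypothesis free : lin_indep bs.
Local Notation K := (scal N).
Implicit Types S : seq K -> Prop.

(** After quantifier elimination, membership depends only on which of finitely many terms vanish,
    and off a thin set this pattern does not vary. So the set or its complement is contained in the
    thin set. *)
Lemma dichotomy_acf n S : GRing.closed_field_axiom K -> dset n S ->
  (exists D, thin D n S /\ thin D n (rot1 S)) \/
  (exists D, thin D n (fun z => ~ S z) /\ thin D n (rot1 (fun z => ~ S z))).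
Proof.
move=> closed /(dset_acf FN spanning free)[F rF hF].
pose G := GRing.quantifier_elim (@ClosedFieldQE.ex_elim K) F.
have /andP[qG rG] : GRing.qf_form G && GRing.rformula G.
  exact: GRing.quantifier_elim_wf (@ClosedFieldQE.wf_ex_elim K) _ rF.
have hG z : size z = n -> (S z <-> GRing.qf_eval z G).
  move=> sz; rewrite -{1}(take_size z) sz hF ?sz //.
  have := GRing.quantifier_elim_rformP (@ClosedFieldQE.wf_ex_elim K)
    (ClosedFieldQE.holds_ex_elim closed) z rF.
  by move/rwP.
have [ts rts hts] := acf_atoms qG rG.
have idK : cancel (idfun : {rmorphism K -> K}) idfun by [].
have [D [E [tE tE' hE]]] := thin_terms_zeros idK idK n rts.
have cst z z' : size z = n -> size z' = n -> ~ E z -> ~ E z' -> S z -> S z'.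
  move=> sz sz' nz nz' /(hG z sz) Gz; apply/(hG z' sz'); rewrite -(hts z) // => t ht.
  case: (hE t ht) => h; first by have := h z sz; have := h z' sz'; rewrite !map_id => -> ->.
  have := h z sz nz; have := h z' sz' nz'; rewrite !map_id.
  by move=> /eqP/negPf-> /eqP/negPf->.
case: (pselect (exists2 z, size z = n & ~ E z /\ S z)) => [[z0 s0 [n0 S0]]|h].
  right; exists D; split; [apply: thin_sub tE|apply: thin_sub tE'] => z sz nS;
    apply: contrapT => nE; apply: nS; apply: cst n0 nE S0 => //.
  by rewrite size_rotr.
left; exists D; split; [apply: thin_sub tE|apply: thin_sub tE'] => z sz Sz;
  apply: contrapT => nE; apply: h.
  by exists z.
by exists (rotr 1 z); rewrite ?size_rotr.
Qed.

Lemma dset_rcf (R : rcfType) (phi : {rmorphism K -> R}) (psi : R -> K) n S :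
  cancel phi psi -> cancel psi phi -> dset n S ->
  exists2 F : ordered_qelim.ord.formula R, ordered_qelim.ord.rformula F &
    forall e, (n <= size e)%N -> (S (take n e) <-> ordered_qelim.ord.holds (map phi e) F).
Proof.
move=> phiK psiK; apply: (@dset_interpret N alt bs FN spanning free (ring_fun phi)
  (fun n S => exists2 F : ordered_qelim.ord.formula R, ordered_qelim.ord.rformula F &
    forall e, (n <= size e)%N -> (S (take n e) <-> ordered_qelim.ord.holds (map phi e) F))) => {n S}.
- exact: ring_fun_ext.
- exact: ring_fun_const.
- exact: ring_fun_var.
- exact: ring_funD.
- exact: ring_funM.
- exact: ring_fun_weak.
- move=> n P Q PQ [F rF h]; exists F => // e se; rewrite -h // PQ //.
  by rewrite size_takel.
- move=> n f g [t rt E] [u ru E']; exists (ordered_qelim.ord.Equal t u); rewrite /= ?rt // => e se.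
  by rewrite -E // -E' //; split=> [->|/(can_inj phiK)].
- by move=> n P [F rF h]; exists (ordered_qelim.ord.Not F) => // e se /=; rewrite h.
- by move=> n P Q [F rF h] [G rG h']; exists (ordered_qelim.ord.And F G); rewrite /= ?rF // => e se; rewrite h // h'.
- move=> n P [F rF h]; exists (ordered_qelim.ord.Exists n F) => // e se /=.
  have E x : P (take n e) x <-> ordered_qelim.ord.holds (set_nth 0 (map phi e) n (phi x)) F.
    have -> : set_nth 0 (map phi e) n (phi x) = map phi (set_nth 0 e n x).
      by elim: (e) (n) se {h} => [|a l IH] [|q] //= se; rewrite IH.
    rewrite -h; last by rewrite size_set_nth leq_max leqnn.
    rewrite take_takel // nth_take // nth_set_nth /= eqxx.
    suff -> : take n (set_nth 0 e n x) = take n e by [].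
    by elim: (e) (n) se => [|a l IH] [|q] //= se; rewrite IH.
  split=> -[x hx]; first by exists (phi x); apply/E.
  by exists (psi x); apply/E; rewrite psiK.
Qed.

(** At a point of the set off the thin set, the terms that are not identically zero are nonzero and
    keep their signs on a box by continuity. The quantifier-free formula then has the same truth
    value on the whole box. *)
Lemma dichotomy_rcf n S : real_closed K -> dset n S ->
  (exists D, thin D n S /\ thin D n (rot1 S)) \/
  exists lo hi, [/\ box_ok lo hi, size lo = n & forall z, in_box lo hi z -> S z].
Proof.
move=> /real_closed_cancel[R [phi [psi [phiK psiK]]]] /(dset_rcf phiK psiK)[F rF hF].
pose G := ordered_qelim.ord.quantifier_elim (fun i bc => qe_rcf.qfr_to_formula (@qe_rcf.wproj R i bc)) F.
have /andP[qG rG] : ordered_qelim.ord.qf_form G && ordered_qelim.ord.rformula G.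
  exact: ordered_qelim.ord.quantifier_elim_wf (@qe_rcf.wf_QE_wproj R) _ rF.
have hG z : size z = n -> (S z <-> ordered_qelim.ord.qf_eval (map phi z) G).
  move=> sz; rewrite -{1}(take_size z) sz hF ?sz //.
  have := ordered_qelim.ord.quantifier_elim_rformP (@qe_rcf.wf_QE_wproj R)
    (@qe_rcf.valid_QE_wproj R) (map phi z) rF.
  by move/rwP.
have [ts rts hts] := rcf_atoms qG rG.
have [D [E [tE tE' hE]]] := thin_terms_zeros phiK psiK n rts.
case: (pselect (exists2 z, size z = n & ~ E z /\ S z)) => [[z0 s0 [n0 S0]]|h]; last first.
  left; exists D; split; [apply: thin_sub tE|apply: thin_sub tE'] => z sz Sz;
    apply: contrapT => nE; apply: h.
    by exists z.
  by exists (rotr 1 z); rewrite ?size_rotr.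
right; have [dl dl0 hdl] := continuous_sgs (map phi z0) rts.
exists [seq psi (phi x - dl) | x <- z0], [seq psi (phi x + dl) | x <- z0]; split.
- elim: (z0) => //= x l IH; split=> //; apply/(sq_ltP phiK psiK).
  rewrite !psiK; lra.
- by rewrite size_map.
- move=> z hz.
  have [sz near] : size z = size z0 /\ forall i, `|(map phi z)`_i - (map phi z0)`_i| < dl.
    elim: (z0) z hz => [|x l IH] [|y z] //=.
      by split=> // i; rewrite nth_nil subrr normr0.
    move=> [[/(sq_ltP phiK psiK) h1 /(sq_ltP phiK psiK) h2] /IH[-> h]]; split=> // -[|i] //=.
    by move: h1 h2; rewrite !psiK ltr_distl => h1 h2; apply/andP; split; lra.
  rewrite s0 in sz.
  apply/(hG z sz); move/(hG z0 s0): S0; rewrite (hts (map phi z)  (map phi z0)) // => t ht.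
  case: (hE t ht) => h; first by rewrite !h.
  by apply: hdl => //; exact: h.
Qed.

Lemma dichotomy (F : scal_theory) n S : scal_model F K -> dset n S ->
  (exists D, thin D n S /\ thin D n (rot1 S)) \/ (~ null n S /\ ~ null n (rot1 S)).
Proof.
move=> hF; have inf := scal_infinite hF; case: F hF => [p [closed _]|rc] dS.
  case: (dichotomy_acf closed dS) => [h|[D [h1 h2]]]; [by left|right].
  by split; [exact: (cothin_not_null inf h1)|exact: (cothin_not_null inf h2)].
case: (dichotomy_rcf rc dS) => [h|[lo [hi [ok sl hS]]]]; [by left|right].
have [R [phi [psi [phiK psiK]]]] := real_closed_cancel rc.
have avoid := sq_lt_avoid phiK psiK.
split; first exact: (box_not_null avoid ok sl).
have sh := box_ok_size ok.
case: n sl hS dS => [|n] sl hS dS.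
  case: lo hi ok sl hS {sh} => [|//] [|//] _ _ hS; apply: (box_not_null avoid (lo := [::]) (hi := [::])) => //.
  by case=> // _; exact: hS.
case: lo hi ok sl sh hS => [//|l lo] [//|h hi] ok [sl] [sh] hS.
apply: (box_not_null avoid (lo := rcons lo l) (hi := rcons hi h)).
- exact/box_ok_rcons.
- by rewrite size_rcons sl.
- move=> z hz; have sz : size z = (size lo).+1.
    have : forall lo hi z : seq K, in_box lo hi z -> size z = size lo.
      by elim=> [|a x IH] [|b y] [|c w] //= [_ /IH ->].
    by move/(_ _ _ _ hz); rewrite size_rcons.
  case/lastP: z sz hz => // z t; rewrite size_rcons => -[sz] /in_box_rcons hz.
  by rewrite /rot1 rotr1_rcons; apply: hS; apply: hz.
Qed.

Lemma zariski n S : GRing.closed_field_axiom K -> dset n S -> ~ null n S ->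
  exists D, thin D n (fun z => ~ S z).
Proof.
move=> closed /(dichotomy_acf closed)[[D [h _]]|[D [h _]] _]; last by exists D.
by move/(_ (null_thin h)).
Qed.

End Dichotomy.

(** * Coordinates and rank *)

Section Coordinates.
Variables (N : lstruct) (alt : bool) (bs : seq (vect N)).
Hypothesis FN : form_space N alt.
Hypothesis spanning : forall v, Lin bs v.
Hypothesis free : lin_indep bs.
Local Notation K := (scal N).
Local Notation V := (vect N).

Lemma comb_cat c c' (s s' : seq V) : size c = size s ->
  comb (c ++ c') (s ++ s') = comb c s + comb c' s'.
Proof. by elim: s c => [|x s IH] [|a c] //= => [_|[/IH ->]]; rewrite ?add0r ?addrA. Qed.

Lemma free_notin (s : seq V) i : lin_indep s -> (i < size s)%N ->
  ~ Lin (take i s ++ drop i.+1 s) s`_i.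
Proof.
move=> ind lt_i /LinP[c sc E].
have ind' : lin_indep_over (Lin [::]) s by move=> c' /Lin_nil; exact: ind.
have si : size (take i s) = i by rewrite size_takel // ltnW.
have sc' : size c = (size s).-1 by rewrite sc size_cat si size_drop; lia.
have sci : size (take i c) = i by rewrite size_takel // sc'; lia.
have := (indepP [::] s).1 ind' (take i c ++ (-1) :: drop i c).
rewrite size_cat /= sci size_drop sc'.
have -> : (i + ((size s).-1 - i).+1 = size s)%N by lia.
have -> : comb (take i c ++ -1 :: drop i c) s = 0.
  have E2 : s`_i = comb (take i c) (take i s) + comb (drop i c) (drop i.+1 s).
    by rewrite {1}E -[X in comb X _](cat_take_drop i c) comb_cat // sci si.
  rewrite -[X in comb _ X](cat_take_drop i s) (drop_nth 0 lt_i) comb_cat ?sci ?si //=.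
  by rewrite scaleN1r E2 opprD addrA addrA subrr add0r addNr.
move=> /(_ erefl (Lin0 _)) /(congr1 (fun l => l`_i)).
by rewrite nth_cat sci ltnn subnn nth_nseq if_same /= => /eqP; rewrite oppr_eq0 oner_eq0.
Qed.

(** Coordinates become values of the form on fixed vectors, hence terms of the language with
    parameters [ws]. They remain meaningful in elementary extensions, where [bs] need not be
    available as a basis. *)
Lemma dual_basis : exists ws : seq V, size ws = size bs /\
  forall c, size c = size bs -> [seq bform (comb c bs) w | w <- ws] = c.
Proof.
have /choice[w hw] (i : nat) : exists w, (i < size bs)%N ->
    forall j, (j < size bs)%N -> bform bs`_j w = (i == j)%:R.
  have [lt_i|le_i] := ltnP i (size bs); last by exists 0.
  have [y yo yi] := form_dual FN (free_notin free lt_i).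
  exists ((bform bs`_i y)^-1 *: y) => _ j lt_j; rewrite (formZr FN).
  case: (eqVneq i j) => [<-|ij]; first by rewrite mulVf.
  suff /yo -> : bs`_j \in take i bs ++ drop i.+1 bs by rewrite mulr0.
  rewrite mem_cat; case: (ltngtP j i) ij => // ji _.
    by rewrite -(nth_take _ ji) mem_nth // size_takel // ltnW.
  apply/orP; right; have -> : bs`_j = (drop i.+1 bs)`_(j - i.+1).
    by rewrite nth_drop subnKC.
  by rewrite mem_nth // size_drop ltn_sub2r // (leq_ltn_trans ji).
exists [seq w i | i <- iota 0 (size bs)]; split; first by rewrite size_map size_iota.
move=> c sc; rewrite -map_comp; apply: (@eq_from_nth _ 0).
  by rewrite size_map size_iota sc.
rewrite size_map size_iota => i lt_i; rewrite (nth_map 0%N) ?size_iota // nth_iota //= add0n.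
have H b c' : bform (comb c' b) (w i) = \sum_(j < size b) c'`_j * bform b`_j (w i).
  rewrite combE; have h0 : bform 0 (w i) = 0 by rewrite (form0l FN).
  by elim/big_ind2: _ => // [x1 x2 y1 y2 <- <-|j _]; rewrite ?(formDl FN) ?(formZl FN).
rewrite H (bigD1 (Ordinal lt_i)) //= hw // eqxx mulr1 big1 ?addr0 // => j ji.
by rewrite hw //; move: ji; rewrite eq_sym -val_eqE /= => /negPf ->; rewrite mulr0.
Qed.

End Coordinates.

Definition coords (N : lstruct) (ws vs : seq (vect N)) : seq (scal N) :=
  flatten [seq [seq bform v w | w <- ws] | v <- vs].

Fixpoint vecs (N : lstruct) (bs : seq (vect N)) k (z : seq (scal N)) : seq (vect N) :=
  if k is k'.+1 then comb (take (size bs) z) bs :: vecs bs k' (drop (size bs) z) else [::].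

Section DefinableCoordinates.
Variables (I : Type) (N : I -> lstruct) (CV CK : Type).
Variables (cv : CV -> forall i, vect (N i)) (ck : CK -> forall i, scal (N i)).

Lemma gV_comb k m j
    (C : forall i, seq (vect (N i)) -> seq (scal (N i)) -> seq (scal (N i)))
    (X : forall i, seq (vect (N i)) -> seq (scal (N i)) -> seq (vect (N i))) :
  gKs cv ck k m j C -> gVs cv ck k m j X ->
  gV cv ck k m (fun i vs ks => comb (C i vs ks) (X i vs ks)).
Proof.
move=> hC hX.
have H : gV cv ck k m (fun i vs ks => \sum_(l <- iota 0 j) (C i vs ks)`_l *: (X i vs ks)`_l).
  by apply: gV_sum => l; apply: gVZ; [exact: gK_nth hC|exact: gV_nth hX].
apply: gV_ext H _ => i vs ks sv sk; rewrite combE (gVs_size (i := i) hX sv sk).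
have -> : iota 0 j = index_iota 0 j by rewrite /index_iota subn0.
by rewrite big_mkord.
Qed.

Lemma gKs_forms k m j
    (v : forall i, seq (vect (N i)) -> seq (scal (N i)) -> vect (N i))
    (W : forall i, seq (vect (N i)) -> seq (scal (N i)) -> seq (vect (N i))) :
  gV cv ck k m v -> gVs cv ck k m j W ->
  gKs cv ck k m j (fun i vs ks => [seq bform (v i vs ks) w | w <- W i vs ks]).
Proof.
move=> hv hW.
have H : gKs cv ck k m j (fun i vs ks => [seq bform (v i vs ks) (W i vs ks)`_l | l <- iota 0 j]).
  rewrite -[X in gKs _ _ _ _ X](size_iota 0 j); apply: gKs_map => l; apply: gKF => //.
  exact: gV_nth hW.
apply: gKs_ext H _ => i vs ks sv sk; have sW := gVs_size (i := i) hW sv sk.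
apply: (@eq_from_nth _ 0); rewrite !size_map sW ?size_iota // => l lt_l.
by rewrite (nth_map 0) ?sW // (nth_map 0%N) ?size_iota // nth_iota.
Qed.

Lemma gKs_coords k m j r
    (X W : forall i, seq (vect (N i)) -> seq (scal (N i)) -> seq (vect (N i))) :
  gVs cv ck k m j X -> gVs cv ck k m r W ->
  gKs cv ck k m (j * r) (fun i vs ks => coords (W i vs ks) (X i vs ks)).
Proof.
move=> hX hW; elim: j X hX => [|j IH] X hX.
  apply: gKs_ext (gKs_nil _ _ _ _) _ => i vs ks sv sk.
  by have /size0nil -> := gVs_size (i := i) hX sv sk.
have H := gKs_cat (gKs_forms (gV_nth 0 hX) hW) (IH _ (gVs_drop (l := 1) hX)).
apply: gKs_ext H _ => i vs ks sv sk; have := gVs_size (i := i) hX sv sk.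
by case: (X i vs ks) => //= x l _; rewrite drop0.
Qed.

Lemma gVs_vecs k m j r
    (C : forall i, seq (vect (N i)) -> seq (scal (N i)) -> seq (scal (N i)))
    (W : forall i, seq (vect (N i)) -> seq (scal (N i)) -> seq (vect (N i))) :
  gVs cv ck k m r W -> gKs cv ck k m (j * r) C ->
  gVs cv ck k m j (fun i vs ks => vecs (W i vs ks) j (C i vs ks)).
Proof.
move=> hW; elim: j C => [|j IH] C hC; first exact: gVs_nil.
rewrite mulSn in hC; apply: gVs_cons.
  apply: gV_ext (gV_comb (gKs_take hC) hW) _ => i vs ks sv sk.
  by rewrite (gVs_size (i := i) hW sv sk).
apply: gVs_ext (IH _ (gKs_drop hC)) _ => i vs ks sv sk.
by rewrite (gVs_size (i := i) hW sv sk).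
Qed.

Lemma vecs_Lin (M : lstruct) (W l : seq (vect M)) : (forall v, v \in l -> Lin W v) <->
  exists2 z, size z = (size l * size W)%N & l = vecs W (size l) z.
Proof.
elim: l => [|v l [IH1 IH2]]; first by split=> // _; exists [::].
split=> [h|[z sz [Ev El]] x]; last first.
  rewrite inE => /orP[/eqP->|]; first by rewrite Ev; exact: Lin_comb.
  by apply: IH2; exists (drop (size W) z) => //; rewrite size_drop sz addKn.
have [c sc Ev] := (LinP W v).1 (h v (mem_head _ _)).
have [|z sz El] := IH1; first by move=> x xl; apply: h; rewrite inE xl orbT.
by exists (c ++ z); rewrite ?size_cat ?sc ?sz //= take_size_cat // drop_size_cat // -Ev -El.
Qed.

Lemma gdef_all_Lin k m j w
    (L W : forall i, seq (vect (N i)) -> seq (scal (N i)) -> seq (vect (N i))) :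
  gVs cv ck k m j L -> gVs cv ck k m w W ->
  gdef cv ck k m (fun i vs ks => forall v, v \in L i vs ks -> Lin (W i vs ks) v).
Proof.
move=> hL hW; have H : gdef cv ck (j + w) 0
    (fun i vs _ => exists2 z, size z = (j * w)%N & take j vs = vecs (drop j vs) j z).
  apply: (gdef_exKs (P := fun i z vs _ => take j vs = vecs (drop j vs) j z)).
  have hv := gVs_var cv ck (j + w) (j * w + 0).
  apply: gdef_eqVs (gVs_take hv) (gVs_vecs (gVs_drop hv) _).
  exact: gKs_take (gKs_var _ _ _ _).
apply: gdef_ext (gdef_comp H (gVs_cat hL hW) (gKs_nil _ _ _ _)) _ => i vs ks sv sk.
have sL := gVs_size (i := i) hL sv sk.
by rewrite take_size_cat // drop_size_cat // vecs_Lin (gVs_size (i := i) hW sv sk) sL.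
Qed.

(* Bounded Fubini thinness is first order, since the exceptional sets have a
   prescribed number of elements. *)
Lemma gdef_thin D d k m
    (Q : forall i, seq (scal (N i)) -> seq (vect (N i)) -> seq (scal (N i)) -> Prop) :
  gdef cv ck k (d + m) (fun i vs ks => Q i (take d ks) vs (drop d ks)) ->
  gdef cv ck k m (fun i vs ks => thin D d (fun z => Q i z vs ks)).
Proof.
elim: d m Q => [|d IH] m Q hQ.
  by apply: gdef_ext (gdef_not hQ) _ => i vs ks _ _; rewrite /= take0 drop0.
apply: gdef_exKs; apply: gdef_allK; apply: gdef_imp.
  apply: gdef_ext (gdef_not (P := fun i vs ks => exists2 j, (j < D)%N & ks`_0 = ks`_(1 + j)) _) _.
    have H l : gdef cv ck k (D + m).+1 (fun i vs ks => exists2 j, (j < l)%N & ks`_0 = ks`_(1 + j)%N).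
      elim: l => [|l IHl]; first by apply: gdef_ext (gdef_cst cv ck k _ False) _ => *; split=> [[]|].
      apply: gdef_ext (gdef_or IHl (gdef_eqK (gK_nth 0 (gKs_var cv ck k _)) (gK_nth (1 + l) (gKs_var cv ck k _)))) _.
      move=> i vs ks _ _; split=> [[j]|[[j lt_j E]|E]].
      - by rewrite ltnS leq_eqVlt => /orP[/eqP->|lt_j] E; [right|left; exists j].
      - by exists j => //; exact: ltnW.
      - by exists l.
    exact: H.
  move=> i vs [|c ks] //= _ [sk].
  have sD : size (take D ks) = D by rewrite size_takel // sk leq_addr.
  split=> [/negP h [j lt_j E]|h].
    by apply: h; rewrite E -(nth_take _ lt_j) mem_nth ?sD.
  apply/negP => /(nthP 0)[j]; rewrite sD => lt_j E; apply: h; exists j => //.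
  by rewrite -E nth_take.
apply: (IH _ (fun i z vs ks => Q i (head 0 ks :: z) vs (drop D (behead ks)))).
have hv := gKs_var cv ck k (d + (D + m).+1).
have hd := gKs_drop hv.
have h1 := gKs_drop (l := 1) hd; have h2 := gKs_drop h1.
have H := gdef_comp hQ (gVs_var cv ck k (d + (D + m).+1))
  (gKs_cat (gKs_cons (gK_nth 0 hd) (gKs_take hv)) h2).
apply: gdef_ext H _ => i vs ks sv sk.
have st : size (take d ks) = d by rewrite size_takel // sk leq_addr.
rewrite take_size_cat /= ?st // drop_size_cat /= ?st //.
by rewrite nth0 -drop1.
Qed.

End DefinableCoordinates.

Section LinearCoordinates.
Variables (N : lstruct) (bs ws : seq (vect N)).
Hypothesis spanning : forall v, Lin bs v.
Hypothesis sws : size ws = size bs.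
Hypothesis dual : forall c, size c = size bs -> [seq bform (comb c bs) w | w <- ws] = c.
Local Notation r := (size bs).

Lemma size_vecs k (z : seq (scal N)) : size (vecs bs k z) = k.
Proof. by elim: k z => //= k IH z; rewrite IH. Qed.

Lemma size_coords (vs : seq (vect N)) : size (coords ws vs) = (size vs * r)%N.
Proof.
elim: vs => //= v vs IH; rewrite /coords /= size_cat size_map sws mulSn.
by congr addn.
Qed.

Lemma vecsK k (z : seq (scal N)) : size z = (k * r)%N -> coords ws (vecs bs k z) = z.
Proof.
elim: k z => [|k IH] z /=; first by rewrite mul0n => /size0nil->.
rewrite mulSn => sz; rewrite /coords /= -/(coords _ _) dual; last by rewrite size_takel // sz leq_addr.
by rewrite IH ?cat_take_drop // size_drop sz addKn.
Qed.

Lemma coordsK k (vs : seq (vect N)) : size vs = k -> vecs bs k (coords ws vs) = vs.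
Proof.
elim: k vs => [|k IH] [|v vs] //= [sv].
have [c sc ->] := (LinP bs v).1 (spanning v).
rewrite /coords /= -/(coords _ _) dual // take_size_cat // drop_size_cat //.
by rewrite IH.
Qed.

End LinearCoordinates.

Section DefinableSets.
Variable N : lstruct.
Local Notation K := (scal N).
Local Notation V := (vect N).

Definition lset k m (Z : set (pt N k m)) (vs : seq V) (ks : seq K) : Prop :=
  exists x : pt N k m, [/\ Z x, x.1 = vs :> seq V & x.2 = ks :> seq K].

Lemma pt_of_seqs k m (vs : seq V) (ks : seq K) : size vs = k -> size ks = m ->
  exists x : pt N k m, x.1 = vs :> seq V /\ x.2 = ks :> seq K.
Proof. by move=> /eqP sv /eqP sk; exists (Tuple sv, Tuple sk). Qed.

Lemma pt_eq k m (x y : pt N k m) : x.1 = y.1 :> seq V -> x.2 = y.2 :> seq K -> x = y.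
Proof. by case: x y => [x1 x2] [y1 y2] /= /val_inj -> /val_inj ->. Qed.

Lemma lset_pt k m (Z : set (pt N k m)) (x : pt N k m) : lset Z x.1 x.2 <-> Z x.
Proof. by split=> [[y [Zy /pt_eq h /h <-]]|Zx] //; exists x. Qed.

Lemma lset_defset k m phi pv pk (vs : seq V) (ks : seq K) : size vs = k -> size ks = m ->
  lset (defset phi pv pk : set (pt N k m)) vs ks <-> holds (vs ++ pv) (ks ++ pk) phi.
Proof.
move=> sv sk; split=> [[x [hx <- <-]] //|h].
by have [x [Ev Ek]] := pt_of_seqs sv sk; exists x; rewrite /defset /= Ev Ek.
Qed.

Lemma dfn_lset k m (Z : set (pt N k m)) : definable Z -> dfn k m (lset Z).
Proof.
move=> [phi [pv [pk [_ _ ->]]]].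
pose cv := fun (v : V) (_ : unit) => v; pose ck := fun (c : K) (_ : unit) => c.
have H := gdef_holds phi (gVs_cat (gVs_var cv ck k m) (gVs_const cv ck k m pv))
  (gKs_cat (gKs_var cv ck k m) (gKs_const cv ck k m pk)).
apply: gdef_ext H _ => -[] vs ks sv sk; rewrite lset_defset //.
by rewrite /vconst /kconst /cv /ck !map_id.
Qed.

Lemma definable_dfn k m (P : seq V -> seq K -> Prop) : dfn k m P ->
  definable [set x : pt N k m | P x.1 x.2].
Proof.
move=> [s [s' /(_ s s')]] [||phi hphi]; try exact: List.incl_refl.
exists phi, (vconst (fun (v : V) (_ : unit) => v) s tt),
  (kconst (fun (c : K) (_ : unit) => c) s' tt); split=> //.
by apply/seteqP; split=> x /(hphi tt); rewrite !size_tuple; exact.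
Qed.

Lemma infinite_sequence : (forall s : seq K, exists x, x \notin s) -> forall s : seq K,
  exists c : nat -> K, injective c /\ forall i, c i \notin s.
Proof.
move=> /choice[f hf] s.
pose fix l n := if n is n'.+1 then f (l n') :: l n' else s.
have l_mem i j : (i < j)%N -> f (l i) \in l j.
  elim: j => // j IH; rewrite ltnS leq_eqVlt => /orP[/eqP->|/IH h]; first by rewrite /= mem_head.
  by rewrite /= inE h orbT.
have sl i : {subset s <= l i}.
  by elim: i => [//|i IH] x /IH h; rewrite /= inE h orbT.
exists (fun i => f (l i)); split=> [i j E|i]; last by apply: contra (hf (l i)) => /sl.
case: (ltngtP i j) => // /l_mem; first by rewrite E (negPf (hf (l j))).
by rewrite -E (negPf (hf (l i))).
Qed.

(** The fibres of the first coordinate of [FT] over infinitely many values outside the exceptional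
    list are disjoint definable subsets, and each has co-thin image under the remaining
    coordinates. *)
Lemma cothin_morley D d k m (Z : set (pt N k m)) (FT : seq V -> seq K -> seq K) :
  (forall s : seq K, exists x, x \notin s) ->
  definable Z -> dKs k m d FT ->
  thin D d (fun z => ~ exists vs ks, lset Z vs ks /\ FT vs ks = z) -> morley_ge d Z.
Proof.
move=> inf; elim: d Z FT => [|d IH] Z FT dZ dF /=.
  by move=> /contrapT[vs [ks [[x [Zx _ _]] _]]]; exists x.
move=> [s ss hs]; have [c [c_inj cs]] := infinite_sequence inf s.
pose P i vs ks := lset Z vs ks /\ (FT vs ks)`_0 = c i.
have dP i : dfn k m (P i).
  apply: gdef_and; first exact: dfn_lset.
  by apply: gdef_eqK; [exact: gK_nth dF|exact: (gK_const _ _ k m (c i))].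
exists (fun i => [set x : pt N k m | P i x.1 x.2]); split.
- by move=> i; exact: definable_dfn.
- by move=> i x [/lset_pt].
- move=> i j ij; apply/seteqP; split=> // x [[_ E] [_ E']].
  by apply: ij; apply: c_inj; rewrite -E.
- move=> i; apply: (IH _ (fun vs ks => drop 1 (FT vs ks))).
  + exact: definable_dfn.
  + exact: (gKs_drop (l := 1) dF).
  + apply: thin_sub (hs (c i) (cs i)) => z sz h [vs [ks [[x [Zx Ev Ek]] E]]]; apply: h.
    exists vs, ks; split.
      exists x; split=> //=; split; first exact/lset_pt.
      by rewrite Ev Ek E.
    by rewrite E /= drop0.
Qed.

End DefinableSets.

(** * Transfer along elementary maps *)

Section ElementaryTransfer.
Variables (M N : lstruct) (e : elementary M N).

(** Both structures form a family over [bool], a constant denoting an element of [M] and its image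
    in [N]. A condition uniformly definable over this family is then expressed by one formula with
    corresponding parameters, which is what elementarity transfers. *)
Definition elem_family (b : bool) : lstruct := if b then M else N.

Definition elem_vconst (v : vect M) (b : bool) : vect (elem_family b) :=
  if b return vect (elem_family b) then v else elV e v.

Definition elem_kconst (c : scal M) (b : bool) : scal (elem_family b) :=
  if b return scal (elem_family b) then c else elK e c.

Lemma elementary_transfer
    (P : forall b, seq (vect (elem_family b)) -> seq (scal (elem_family b)) -> Prop) :
  gdef elem_vconst elem_kconst 0 0 P -> P true [::] [::] <-> P false [::] [::].
Proof.
move=> [s [s' /(_ s s')]] [||phi hphi]; try exact: List.incl_refl.
rewrite (hphi true [::] [::]) // (hphi false [::] [::]) //.
have -> : vconst elem_vconst s true = s by rewrite /vconst /= map_id.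
have -> : kconst elem_kconst s' true = s' by rewrite /kconst /= map_id.
exact: elP.
Qed.

Lemma elK_inj : injective (elK e).
Proof.
move=> a b E; have := (elP e [::] [:: a; b] (KEq (KVar 0) (KVar 1))).2.
by move=> /=; apply.
Qed.

Lemma elementary_infinite : (forall s : seq (scal M), exists x, x \notin s) ->
  forall s : seq (scal N), exists x, x \notin s.
Proof.
move=> inf s; have [c [c_inj _]] := infinite_sequence inf [::].
apply: contrapT => h.
have hs x : x \in s by apply: contrapT => /negP xs; apply: h; exists x.
have : (size [seq elK e (c i) | i <- iota 0 (size s).+1] <= size s)%N.
  apply: uniq_leq_size => [|x _]; last exact: hs.
  by rewrite map_inj_uniq ?iota_uniq // => i j /elK_inj /c_inj.
by rewrite size_map size_iota ltnn.
Qed.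

End ElementaryTransfer.

Definition coord_set (N : lstruct) (bs : seq (vect N)) k (Z : set (pt N k 0)) z : Prop :=
  lset Z (vecs bs k z) [::].

(** * Comparison of both ranks with the combinatorial dimension *)

Section Rank.
Variables (F : scal_theory) (N : lstruct) (alt : bool) (bs ws : seq (vect N)).
Hypothesis FN : form_space N alt.
Hypothesis spanning : forall v, Lin bs v.
Hypothesis free : lin_indep bs.
Hypothesis sws : size ws = size bs.
Hypothesis dual : forall c, size c = size bs -> [seq bform (comb c bs) w | w <- ws] = c.
Hypothesis FK : scal_model F (scal N).
Local Notation K := (scal N).
Local Notation V := (vect N).
Local Notation r := (size bs).
Local Notation cset := (coord_set bs).

Let inf_K : forall s : seq K, exists x, x \notin s := form_infinite FN.

Lemma dset_dichotomy n (S : seq K -> Prop) : dset n S ->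
  (exists D, thin D n S /\ thin D n (rot1 S)) \/ (~ null n S /\ ~ null n (rot1 S)).
Proof. exact: dichotomy FN spanning free _ _ _ FK. Qed.

Lemma dKs_coords k m j (X : seq V -> seq K -> seq V) : dVs k m j X ->
  dKs k m (j * r) (fun vs ks => coords ws (X vs ks)).
Proof.
move=> hX; apply: gKs_coords hX _; rewrite -sws.
apply: gVs_ext (gVs_const _ _ k m ws) _ => -[] vs ks _ _.
by rewrite /vconst map_id.
Qed.

Lemma dVs_vecs k m j (C : seq V -> seq K -> seq K) : dKs k m (j * r) C ->
  dVs k m j (fun vs ks => vecs bs j (C vs ks)).
Proof.
apply: (gVs_vecs (W := fun _ _ _ => bs)).
by apply: gVs_ext (gVs_const _ _ k m bs) _ => -[] vs ks _ _; rewrite /vconst map_id.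
Qed.

(** Each coordinate projection of the set is contained in a definable image of K^D, so [gdim_image]
    applies. *)
Lemma gdim_param k (Z : set (pt N k 0)) D (P : seq K -> seq V) :
  dVs 0 D k (fun _ ks => P ks) ->
  (forall x, Z x -> exists2 t, size t = D & x.1 = P t :> seq V) ->
  forall d, gdim (k * r) (cset Z) d -> (d <= D)%N.
Proof.
move=> hP hZ d [sg [_ _ ssg ns]].
have H : dset (D + d) (fun t => drop D t = [seq (coords ws (P (take D t)))`_i | i <- sg]).
  apply: (gdef_eqKs (j := d)); first exact: gKs_drop (gKs_var _ _ _ _).
  rewrite -[X in gKs _ _ _ _ X]ssg; apply: gKs_map => i; apply: gK_nth.
  apply: dKs_coords; apply: (gVs_comp hP (gVs_nil _ _ _ _)).
  exact: gKs_take (gKs_var _ _ _ _).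
apply: (@gdim_le _ D (fun=> True)).
apply: (gdim_image (G := fun t z => z = [seq (coords ws (P t))`_i | i <- sg]) dset_dichotomy _ H).
- exact: gdef_cst.
- by move=> t z z' _ _ _ _ -> ->.
move=> h; apply: ns; apply: null_sub h => z _ [y [sy [x [Zx Ex _]] ->]].
have [t st Et] := hZ x Zx; exists t; split=> //.
by rewrite -Et Ex (vecsK dual).
Qed.

Lemma dset_coord_set k (Z : set (pt N k 0)) : definable Z -> dset (k * r) (cset Z).
Proof.
move=> /dfn_lset dZ.
have H := gdef_comp dZ (dVs_vecs (dKs_var N 0 (k * r))) (gKs_nil _ _ 0 (k * r)).
exact: gdef_ext H _.
Qed.

Lemma coord_set_coords k (Z : set (pt N k 0)) (x : pt N k 0) : Z x <-> cset Z (coords ws x.1).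
Proof.
rewrite /coord_set coordsK ?size_tuple //.
have -> : [::] = x.2 :> seq K by case: x => x1 x2; rewrite /= tuple0.
by rewrite lset_pt.
Qed.

(** By [zariski] a non-null projection is co-thin with some bound [D]. This is a first-order
    statement about the formula defining the set, the coordinates being given by the form on [ws];
    so it holds in the saturated extension, where [cothin_morley] applies. *)
Lemma morley_rank_lower k (Z : set (pt N k 0)) z d : GRing.closed_field_axiom K ->
  definable Z -> morley_rank Z z -> gdim (k * r) (cset Z) d -> d%:Z <= z.
Proof.
move=> closed dZ [N' [e [phi [pv [pk [_ EZ hz]]]]]] [sg [usg asg ssg nsg]].
have := dset_proj sg (dset_coord_set dZ); rewrite ssg => dP.
have [D thD] := zariski FN spanning free closed dP nsg.
pose W b := vconst (elem_vconst e) ws b.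
pose X b := vconst (elem_vconst e) pv b; pose A b := kconst (elem_kconst e) pk b.
pose P b z := exists2 x : seq (vect (elem_family N N' b)), size x = k &
    holds (x ++ X b) (A b) phi /\ [seq (coords (W b) x)`_i | i <- sg] = z.
have hP : gdef (elem_vconst e) (elem_kconst e) 0 0 (fun b _ _ => thin D d (fun z => ~ P b z)).
  apply: (@gdef_thin _ _ _ _ _ _ D d 0 0 (fun b z _ _ => ~ P b z)).
  apply: gdef_not; apply: gdef_exVs; apply: gdef_and.
    apply: gdef_holds; last exact: gKs_const.
    apply: gVs_cat; [exact: gVs_take (gVs_var _ _ (k + 0) (d + 0))|exact: gVs_const].
  apply: (gdef_eqKs (j := d)); last exact: gKs_take (gKs_var _ _ (k + 0) (d + 0)).
  rewrite -[X in gKs _ _ _ _ X]ssg; apply: gKs_map => i; apply: gK_nth; apply: gKs_coords; last exact: gVs_const.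
  exact: gVs_take (gVs_var _ _ (k + 0) (d + 0)).
have XE : X true = pv by rewrite /X /vconst /= map_id.
have WE : W true = ws by rewrite /W /vconst /= map_id.
have AE : A true = pk by rewrite /A /kconst /= map_id.
have hT : thin D d (fun z => ~ P true z).
  apply: thin_sub thD => c _ nP [y [sy Cy cE]]; apply: nP.
  exists (vecs bs k y); first exact: size_vecs.
  rewrite XE WE AE vecsK //; split=> //.
  by move: Cy; rewrite /coord_set EZ lset_defset ?size_vecs.
have hF := (elementary_transfer hP).1 hT.
have ge_d : morley_ge d (defset phi (map (elV e) pv) (map (elK e) pk) : set (pt N' k 0)).
  apply: (cothin_morley (D := D) (FT := fun vs _ => [seq (coords (W false) vs)`_i | i <- sg])).
  - exact: elementary_infinite e inf_K.
  - by exists phi, (map (elV e) pv), (map (elK e) pk); split.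
  - rewrite /dKs -[X in gKs _ _ _ _ X]ssg; apply: gKs_map => i; apply: gK_nth; apply: gKs_coords; first exact: dVs_var.
    by apply: gVs_ext (gVs_const _ _ k 0 (W false)) _ => -[] vs ks _ _; rewrite /vconst map_id.
  - apply: thin_sub hF => c _ nc [x sx [hx Ex]]; apply: nc; exists x, [::]; split=> //.
    by rewrite lset_defset.
case: hz => [[_ n0]|[d' [-> _ max]]]; last by rewrite lez_nat; exact: max.
have H q (Y : set (pt N' k 0)) : morley_ge q Y -> Y !=set0.
  elim: q Y => [//|q IH] Y [Yi [_ sub _ /(_ 0%N) /IH[x hx]]].
  by exists x; exact: sub hx.
by case: n0; exact: H ge_d.
Qed.

Lemma in_box_nth (lo hi z : seq K) : size lo = size hi -> size lo = size z ->
  (in_box lo hi z <-> forall i, (i < size lo)%N -> sq_lt lo`_i z`_i /\ sq_lt z`_i hi`_i).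
Proof.
elim: lo hi z => [|l lo IH] [|h hi] [|x z] //= [s1] [s2].
rewrite IH //; split=> [[h1 h2] [|i] //=|H]; first exact: h2.
by split=> [|i lt_i]; [exact: (H 0%N)|exact: (H i.+1)].
Qed.

Lemma box_ok_nth (lo hi : seq K) : size lo = size hi ->
  (box_ok lo hi <-> forall i, (i < size lo)%N -> sq_lt lo`_i hi`_i).
Proof.
elim: lo hi => [|l lo IH] [|h hi] //= [s1].
rewrite IH //; split=> [[h1 h2] [|i] //=|H]; first exact: h2.
by split=> [|i lt_i]; [exact: (H 0%N)|exact: (H i.+1)].
Qed.

Lemma nth_ord_map d (f : 'I_d -> K) (i : 'I_d) : [seq f j | j <- enum 'I_d]`_i = f i.
Proof. by rewrite (nth_map i) ?size_enum_ord // nth_ord_enum. Qed.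

(** A box has infinitely many points in every direction, so a projection containing one is not null.
    The converse [gdim_omin] is the second alternative of [dichotomy_rcf]. *)
Lemma omin_gdim n d (Y : set (pt N 0 n)) : real_closed K -> omin_ge Y d ->
  gdim n (lset Y [::]) d.
Proof.
move=> rc [sg [sg_inj [lo [hi [lohi hY]]]]].
have [R [phi [psi [phiK psiK]]]] := real_closed_cancel rc.
pose l f := [seq f j | j <- enum 'I_d] : seq K.
have sl f : size (l f) = d by rewrite size_map size_enum_ord.
apply/gdim_tuple; exists [tuple sg i | i < d]; split.
  by rewrite map_inj_uniq ?enum_uniq.
apply: (box_not_null (sq_lt_avoid phiK psiK) (lo := l lo) (hi := l hi)) => //.
  by apply/box_ok_nth; rewrite !sl // => i lt_i; rewrite !(nth_ord_map _ (Ordinal lt_i)).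
move=> z hz; have sz : size z = d.
  have : forall lo hi z : seq K, in_box lo hi z -> size z = size lo.
    by elim=> [|a x IH] [|b y] [|c w] //= [_ /IH ->].
  by move/(_ _ _ _ hz); rewrite sl.
have {}hz : forall i : 'I_d, sq_lt (lo i) z`_i /\ sq_lt z`_i (hi i).
  move=> i; move/in_box_nth: hz; rewrite !sl sz => /(_ erefl erefl i (ltn_ord i)).
  by rewrite !nth_ord_map.
have [y Yy Ey] := hY (fun i => z`_i) hz.
exists y.2; split; first by rewrite size_tuple.
  exists y; split=> //; by case: (y) => y1 y2; rewrite /= tuple0.
apply: (@eq_from_nth _ 0); rewrite sz; first by rewrite size_map size_map size_tuple.
move=> i lt_i; rewrite -map_comp (nth_map (sg (Ordinal lt_i))) ?size_tuple //.
rewrite -(tnth_nth _ [tuple sg i | i < d] (Ordinal lt_i)) tnth_mktuple /=.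
by rewrite -(Ey (Ordinal lt_i)) (tnth_nth 0).
Qed.

Lemma gdim_omin n d (Y : set (pt N 0 n)) : real_closed K -> definable Y ->
  gdim n (lset Y [::]) d -> omin_ge Y d.
Proof.
move=> rc /dfn_lset dY /gdim_tuple[sg [usg nn]].
have dS : dset n (lset Y [::]).
  apply: gdef_ext dY _ => -[] [|//] ks _ _; by [].
have dP := dset_proj (map val sg) dS; rewrite size_map size_tuple in dP.
case: (dichotomy_rcf FN spanning free rc dP) => [[D [/null_thin//]]|[lo [hi [ok sl hS]]]].
have sh : size hi = d by rewrite -(box_ok_size ok).
exists (tnth sg); split; first exact/tuple_uniqP.
exists (fun i => lo`_i), (fun i => hi`_i); split=> [i|z hz].
  by apply: (box_ok_nth _).1 => //; rewrite ?sh ?sl.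
have [|y [sy [x [Yx _ x2]] zE]] := hS [seq z j | j <- enum 'I_d].
  have sz : size [seq z j | j <- enum 'I_d] = d by rewrite size_map size_enum_ord.
  apply/in_box_nth; rewrite ?sl ?sh ?sz // => i lt_i.
  by rewrite (nth_ord_map _ (Ordinal lt_i)); exact: hz.
exists x => // i; rewrite (tnth_nth 0) x2 -(nth_ord_map z i) zE -map_comp.
by rewrite (nth_map (tnth sg i)) ?size_tuple // -tnth_nth.
Qed.

(** The bijection in [omin_dim] is an arbitrary definable one and may have nothing to do with the
    coordinates; [gdim_image] carries the dimension across it. *)
Lemma omin_dim_lower k (Z : set (pt N k 0)) z d : real_closed K ->
  definable Z -> omin_dim Z z -> gdim (k * r) (cset Z) d -> d%:Z <= z.
Proof.
move=> rc dZ [n [Y [_ dY [f [fZ f_inj f_surj] dGr] hz]]] [sg [usg asg ssg nsg]].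
set Gr := [set w | exists2 x, Z x & w = pt_cat x (f x)] in dGr.
have dGr' : @dfn N k n (lset Gr).
  have h0 : @dVs N k n (k + 0) (fun vs _ => vs) by rewrite addn0; exact: dVs_var.
  exact: gdef_comp (dfn_lset dGr) h0 (dKs_var N k n).
pose G y c := exists2 x : seq V, size x = k & lset Gr x y /\ [seq (coords ws x)`_i | i <- sg] = c.
have GrE x y : lset Gr x y -> exists a : pt N k 0, [/\ Z a, x = a.1 & y = (f a).2].
  move=> [w [[a Za ->] /= <- <-]]; exists a; split=> //.
    by case: (f a) => [f1 f2]; rewrite /= tuple0 cats0.
  by case: (a) => [a1 a2]; rewrite /= tuple0.
have gY : gdim n (lset Y [::]) d.
  apply: (gdim_image (G := G) dset_dichotomy).
  - apply: gdef_ext (dfn_lset dY) _ => -[] [|//] ks _ _; by [].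
  - apply: gdef_exVs; apply: gdef_and.
      have := gdef_comp dGr' (gVs_take (dVs_var N (k + 0) (n + d))) (gKs_take (dKs_var N (k + 0) (n + d))).
      by apply.
    apply: (gdef_eqKs (j := d)); last exact: gKs_drop (dKs_var N (k + 0) (n + d)).
    rewrite -[X in gKs _ _ _ _ X]ssg; apply: gKs_map => i; apply: gK_nth; apply: dKs_coords.
    exact: gVs_take (dVs_var N (k + 0) _).
  - move=> y c c' sy _ _ _ [x sx [/GrE[a [Za -> ya]] <-]] [x' sx' [/GrE[a' [Za' -> ya']] <-]].
    have -> // : a = a'.
    apply: f_inj; rewrite ?inE //; apply: pt_eq; last by rewrite -ya -ya'.
    by case: (f a) (f a') => [u u'] [v v']; rewrite /= (tuple0 u) (tuple0 v).
  - move=> h; apply: nsg; apply: null_sub h => c sc [y [sy Cy ->]].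
    have [x [Zx x1 x2]] := Cy.
    exists (f x).2; split; first by rewrite size_tuple.
      exists (f x); split=> //; first exact: fZ.
      by case: (f x) => u v; rewrite /= tuple0.
    exists x.1; first by rewrite size_tuple.
    split; last by rewrite x1 vecsK.
    exists (pt_cat x (f x)); split; first by exists x.
      by case: (f x) => u v; rewrite /= tuple0 cats0.
    by rewrite /= x2.
have := gdim_omin rc dY gY; case: hz => [[_ n0]|[d' [-> _ max]] /max //].
have [sg' [_ _ _ nn]] := gY; have [c _ [_ [_ [y [Yy _ _]] _]]] := null_nonempty nn.
have f0 T : 'I_0 -> T by case.
move=> _; case: n0; exists (f0 'I_n); split; first by case.
by exists (f0 K), (f0 K); split=> [|c' _]; [case|exists y => //; case].
Qed.

Lemma rk_lower k (Z : set (pt N k 0)) z d : definable Z -> rk F Z z ->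
  gdim (k * r) (cset Z) d -> d%:Z <= z.
Proof.
move: FK; case: F => [p [closed _]|rc]; first exact: morley_rank_lower.
exact: omin_dim_lower.
Qed.

(** The recursion defining Morley rank asks for infinitely many disjoint definable subsets of
    smaller rank, which is the situation of [gdim_disjoint]. *)
Lemma morley_gdim k (Z : set (pt N k 0)) d : GRing.closed_field_axiom K -> definable Z ->
  morley_ge d Z -> gdim (k * r) (cset Z) d.
Proof.
move=> closed; elim: d Z => [|d IH] Z dZ /=.
  move=> [x Zx]; exists [::]; split=> //=; apply.
  exists (coords ws x.1); split=> //; last exact/coord_set_coords.
  by rewrite (size_coords sws) size_tuple.
move=> [Y [dY sub disj hY]].
apply: (gdim_disjoint inf_K dset_dichotomy (fun n S => zariski FN spanning free closed)
  (Z := fun i => cset (Y i))).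
- exact: dset_coord_set.
- by move=> i; exact: dset_coord_set.
- by move=> i y _ [x [/sub Zx Ev Ek]]; exists x.
- move=> i j y _ [x [Yx Ev Ek]] [x' [Yx' Ev' Ek']]; apply: contrapT => ij.
  have E : x = x' by apply: pt_eq; rewrite ?Ev ?Ev' ?Ek ?Ek'.
  by have : (Y i `&` Y j) x; [split; rewrite // E|rewrite disj].
- by move=> i; apply: IH.
Qed.

Lemma rank_of_bounded (ge : nat -> Prop) D : (forall d, ge d -> (d <= D)%N) ->
  exists2 z : int, rank_of ge z & z <= D%:Z.
Proof.
move=> hD; case: (pselect (ge 0%N)) => g0; last by exists (-1); [left|].
have ex : exists d, `[<ge d>] by exists 0%N; exact/asboolP.
have bd d : `[<ge d>] -> (d <= D)%N by move/asboolP; exact: hD.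
case: (ex_maxnP ex bd) => d /asboolP gd max; exists d%:Z; last by rewrite lez_nat; exact: hD.
by right; exists d; split=> // d' gd'; apply: max; exact/asboolP.
Qed.

Definition elementary_refl : elementary N N.
Proof.
apply: (@Elementary N N id id) => vs ks phi; by rewrite !map_id.
Defined.

(** Existence of the rank is part of the claim. Saturation allows Morley rank to be computed in [N]
    itself, as its own elementary extension; in the real closed case the coordinate map serves as
    the bijection. *)
Lemma rk_upper k (Z : set (pt N k 0)) D : definable Z ->
  (F <> RCF -> aleph0_saturated N) ->
  (forall d, gdim (k * r) (cset Z) d -> (d <= D)%N) ->
  exists2 z, rk F Z z & z <= D%:Z.
Proof.
move=> dZ; move: FK; case: F => [p [closed _]|rc] /= sat hD.
  have [|z hz zD] := @rank_of_bounded (fun n => morley_ge n Z) D.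
    by move=> d /(morley_gdim closed dZ)/hD.
  exists z => //; have [phi [pv [pk [_ _ E]]]] := dZ.
  exists N, elementary_refl, phi, pv, pk; split=> //; first exact: sat.
  by rewrite /= !map_id -E.
pose Y := [set y : pt N 0 (k * r) | cset Z y.2].
have dY : definable Y.
  apply: (definable_dfn (P := fun _ ks => cset Z ks)); exact: dset_coord_set.
have E c : size c = (k * r)%N -> lset Y [::] c <-> cset Z c.
  move=> sc; split=> [[x [hx _ <-]]//|h].
  have [x [Ev Ek]] := pt_of_seqs (N := N) (k := 0) (vs := [::]) erefl sc.
  by exists x; split=> //; rewrite /Y /= Ek.
have [|z hz zD] := @rank_of_bounded (omin_ge Y) D.
  move=> d /(omin_gdim rc)[sg [u a s h]]; apply: hD; exists sg; split=> //.
  move=> h'; apply: h; apply: null_sub h' => c _ [y [sy /(E y sy) hy ->]].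
  by exists y.
exists z => //; exists (k * r)%N, Y; split=> //.
have sc (x : pt N k 0) : size (coords ws x.1) == (k * r)%N.
  by rewrite (size_coords sws) size_tuple.
pose f (x : pt N k 0) : pt N 0 (k * r) := ([tuple], Tuple (sc x)).
exists f; first split.
- by move=> x /coord_set_coords hx.
- move=> x x' _ _ E1.
  have /(congr1 (vecs bs k)) : (f x).2 = (f x').2 :> seq K by rewrite E1.
  rewrite /f /=.
  rewrite !(coordsK spanning dual) ?size_tuple // => E2; apply: pt_eq => //.
  by case: (x) (x') => [u u'] [v v']; rewrite /= (tuple0 u') (tuple0 v').
- move=> y [x [Zx Ev Ek]]; exists x => //; apply: pt_eq; rewrite /f /=.
    by case: (y) => y1 y2; rewrite /= tuple0.
  by rewrite Ev (vecsK dual) // size_tuple.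
have H : @dfn N (k + 0) (0 + k * r) (fun vs ks => lset Z (take k vs) [::] /\ ks = coords ws (take k vs)).
  have ht := gVs_take (dVs_var N (k + 0) (0 + k * r)).
  apply: gdef_and.
    exact: (gdef_comp (dfn_lset dZ) ht (gKs_nil _ _ _ _)).
  apply: (gdef_eqKs (j := k * r)); first exact: dKs_var.
  exact: dKs_coords ht.
have {H} := definable_dfn H; congr definable; apply/seteqP; split=> w /=.
  move=> [[x [Zx Ev Ek]] Ew]; exists x => //; apply: pt_eq => /=.
    by rewrite cats0 Ev take_oversize // size_tuple addn0.
  by rewrite Ek Ev.
move=> [x Zx ->] /=; rewrite cats0 take_oversize ?size_tuple //; split.
  exists x; split=> //; by case: (x) => x1 x2; rewrite /= tuple0.
by case: (x) => x1 x2; rewrite /= tuple0.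
Qed.

End Rank.

(** * Orbits of transvections and the lower bound *)

Section PolynomialFunctions.
Variables (N : lstruct) (alt : bool) (bs : seq (vect N)).
Hypothesis FN : form_space N alt.
Hypothesis spanning : forall v, Lin bs v.
Hypothesis free : lin_indep bs.
Local Notation K := (scal N).

Definition dK k m (F : seq (vect N) -> seq K -> K) :=
  gK (N := fun _ : unit => N) (fun v _ => v) (fun c _ => c) k m (fun _ vs ks => F vs ks).

Definition dV k m (F : seq (vect N) -> seq K -> vect N) :=
  gV (N := fun _ : unit => N) (fun v _ => v) (fun c _ => c) k m (fun _ vs ks => F vs ks).

Lemma dK_bounded_degree n (f : seq K -> K) : dK 0 n (fun _ ks => f ks) ->
  exists D, bounded_degree D n f.
Proof.
pose T := ring_fun (idfun : {rmorphism K -> K}).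
move=> [s [s' /(_ s s')]] [||t ht]; try exact: List.incl_refl.
have [_ /(_ t) [u ru Eu]] := @interpret_terms N alt bs FN T (@ring_fun_ext _ _ _)
  (fun n => ring_fun_const _ n 0) (fun n => ring_fun_const _ n 1)
  (@ring_funD _ _ _) (@ring_funM _ _ _) (fun n x y _ _ => ring_fun_const _ n (bform x y))
  n [seq (fun=> v) | v <- s]
  ([seq (fun e => e`_i) | i <- iota 0 n] ++ [seq (fun=> c) | c <- s'])
  (Forall_constants spanning s (ring_fun_const _ n))
  (Forall_variables s' (ring_fun_const _ n) (@ring_fun_var _ _ _ n)).
have idK : cancel (idfun : {rmorphism K -> K}) idfun by [].
have [D hD] := eval_poly_in idK ru.
exists D => z i sz lt_i; have [p sp hp] := hD z i; exists p => // x.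
have sz' : size (set_nth 0 z i x) = n by rewrite size_set_nth sz; apply/maxn_idPr.
rewrite -[RHS]hp -Eu ?sz' // take_oversize ?sz' // (ht tt [::] _ erefl sz').
by rewrite eval_variables // -map_comp /vconst /kconst !map_id.
Qed.

Lemma dK_thin n (f : seq K -> K) : dK 0 n (fun _ ks => f ks) ->
  (exists2 z, size z = n & f z != 0) -> exists D, thin D n (fun z => f z = 0).
Proof.
move=> /dK_bounded_degree[D bd] [z sz fz]; exists D; exact: thin_zeros bd sz fz.
Qed.

End PolynomialFunctions.

Section Isometries.
Variables (N : lstruct) (alt : bool).
Hypothesis FN : form_space N alt.
Local Notation V := (vect N).
Local Notation K := (scal N).
Local Notation tau := (@transvection N).

(** Restricting to products of transvections along axes orthogonal to [W] reduces every invariance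
    statement to a single transvection. *)
Inductive isometry_fixing (W : seq V) : (V -> V) -> Prop :=
| iso_id : isometry_fixing W id
| iso_move c y g : isometric alt c y -> (forall w, w \in W -> bform w y = 0) ->
    isometry_fixing W g -> isometry_fixing W (fun x => tau c y (g x)).

Lemma isometry_fix W g x : isometry_fixing W g -> x \in W -> g x = x.
Proof.
move=> Wg xW; elim: Wg => {g} [//|c y g _ yW _ ->].
by rewrite transvection_fix ?yW.
Qed.

Lemma isometry0 W g : isometry_fixing W g -> g 0 = 0.
Proof.
by elim=> {g} [//|c y g _ _ _ ->]; rewrite transvection_fix ?(form0l FN).
Qed.

Lemma isometry_sub W W' g : {subset W' <= W} -> isometry_fixing W g -> isometry_fixing W' g.
Proof.
move=> sub; elim=> {g} [|c y g cy yW _ IH]; first exact: iso_id.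
by apply: iso_move => // w /sub; exact: yW.
Qed.

(** One stage of the motion: the vector to be moved, and a projection onto the orthogonal complement
    of what must stay fixed. The axis of the stage is the projection of a freely chosen target, so a
    stage has as many free scalars as the space has dimensions. *)
Record move_data := MoveData { md_point : V; md_span : seq V; md_proj : V -> V }.

Definition move_ok W (m : move_data) :=
  [/\ size (md_span m) = size W, orthoprojection W (md_span m) (md_proj m),
      exists v, bform (md_point m) (md_proj m v) != 0 &
      exists v, anisotropic alt (md_proj m v)].

Fixpoint moves_ok W (ms : seq move_data) :=
  if ms is m :: ms' then move_ok W m /\ moves_ok (md_point m :: W) ms' else True.

Fixpoint moves_cost (ms : seq move_data) :=
  if ms is m :: ms' then (2 + size (md_span m) + moves_cost ms')%N else 0%N.

Fixpoint good_targets (ms : seq move_data) (vs : seq V) : Prop :=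
  if ms is m :: ms' then
    (bform (md_point m) (md_proj m (head 0 vs)) != 0 /\ anisotropic alt (md_proj m (head 0 vs)))
    /\ good_targets ms' (behead vs)
  else True.

(* Reads off the successive axes of the transvections from the images of the
   points; the scalars mu supply what the images do not determine. *)
Fixpoint decode (ms : seq move_data) (xs : seq V) (mu : seq K) : seq V :=
  if ms is m :: ms' then
    let y := mu`_0 *: (xs`_0 + - md_point m) in
    (y + comb (take (size (md_span m)) (drop 2 mu)) (md_span m)) ::
    decode ms' [seq tau mu`_1 y x | x <- drop 1 xs] (drop (size (md_span m)) (drop 2 mu))
  else [::].

(** The transvections of all later stages fix the point [a] of the present one and are applied
    before it, so the image of [a] is [a + c [a, y] y] and reveals the axis [y] up to a factor.
    Undoing this transvection on the other images leaves the images under the later stages. *)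
Lemma decode_onto ms W vs : moves_ok W ms -> size vs = size ms -> good_targets ms vs ->
  exists g mu, [/\ size mu = moves_cost ms, isometry_fixing W g &
    decode ms [seq g (md_point m) | m <- ms] mu = vs].
Proof.
elim: ms W vs => [|m ms IH] W [|v vs] //=.
  by move=> _ _ _; exists id, [::]; split=> //; exact: iso_id.
move=> [[sF [piD piZ piW piF piK] _ _] ok] [sv] [[mv av] good].
set a := md_point m in mv ok *; set y := md_proj m v in mv av.
have [c c0 cy] := anisotropic_isometric FN av.
have [c' cy' inv] := transvection_inverse FN cy.
have [g [mu [smu hg E]]] := IH _ _ ok sv good.
have ga : g a = a by apply: isometry_fix hg _; rewrite mem_head.
have yW w : w \in W -> bform w y = 0 by exact: piW.
have /LinP[b sb Eb] := piF v.
(* The first scalar recovers the axis from the image of [a], the second inverts the transvection,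
   and the coefficients [b] recover the target from its projection: these are the
   [2 + size (md_span m)] scalars counted in [moves_cost]. *)
exists (fun x => tau c y (g x)), [:: (c * bform a y)^-1, c' & b ++ mu]; split.
- by rewrite /= size_cat sb smu.
- apply: iso_move => //; apply: isometry_sub hg => x xW; by rewrite inE xW orbT.
- rewrite /= !drop0 take_size_cat // drop_size_cat //.
  have -> : (c * bform a y)^-1 *: (tau c y (g a) + - a) = y.
    rewrite ga /tau addrAC subrr add0r scalerA mulVf ?scale1r //.
    by rewrite mulf_neq0.
  congr cons; first by rewrite -Eb addrC subrK.
  rewrite -E -map_comp; congr decode; apply: eq_map => x /=.
  exact: (inv _).1.
Qed.

End Isometries.

Section OrbitDimension.
Variables (F : scal_theory) (N : lstruct) (alt : bool) (bs ws : seq (vect N)).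
Hypothesis FN : form_space N alt.
Hypothesis spanning : forall v, Lin bs v.
Hypothesis free : lin_indep bs.
Hypothesis sws : size ws = size bs.
Hypothesis dual : forall c, size c = size bs -> [seq bform (comb c bs) w | w <- ws] = c.
Hypothesis FK : scal_model F (scal N).
Local Notation K := (scal N).
Local Notation V := (vect N).
Local Notation r := (size bs).
Implicit Types (ms : seq (move_data N)).

Lemma dV_const k m v : @dV N k m (fun _ _ => v).
Proof. exact: (gV_const (N := fun _ : unit => N) (fun v _ => v) (fun c _ => c) k m v). Qed.

Lemma dVs_map_iota k m j (X : seq V -> seq K -> seq V) (f : V -> seq V -> seq K -> V) :
  dVs k m j X -> (forall v, dV k m v -> dV k m (fun vs ks => f (v vs ks) vs ks)) ->
  dVs k m j (fun vs ks => [seq f x vs ks | x <- X vs ks]).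
Proof.
move=> hX hf.
have H : dVs k m j (fun vs ks => [seq f (X vs ks)`_l vs ks | l <- iota 0 j]).
  rewrite /dVs -[X in gVs _ _ _ _ X](size_iota 0 j); apply: gVs_map => l.
  by apply: (hf (fun vs ks => (X vs ks)`_l)); exact: gV_nth hX.
apply: gVs_ext H _ => -[] vs ks sv sk; have sX := gVs_size (i := tt) hX sv sk.
apply: (@eq_from_nth _ 0); rewrite !size_map sX ?size_iota // => l lt_l.
by rewrite (nth_map 0) ?sX // (nth_map 0%N) ?size_iota // nth_iota.
Qed.

Lemma dVs_const k m (s : seq V) : dVs k m (size s) (fun _ _ => s).
Proof.
by apply: gVs_ext (gVs_const _ _ k m s) _ => -[] vs ks _ _; rewrite /vconst map_id.
Qed.

Lemma dVs_decode k m ms (X : seq V -> seq K -> seq V) (M : seq V -> seq K -> seq K) :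
  dVs k m (size ms) X -> dKs k m (moves_cost ms) M ->
  dVs k m (size ms) (fun vs ks => decode ms (X vs ks) (M vs ks)).
Proof.
elim: ms X M => [|a ms IH] X M hX hM /=; first exact: gVs_nil.
have hM2 := gKs_drop (l := 2) hM.
have hy : dV k m (fun vs ks => (M vs ks)`_0 *: ((X vs ks)`_0 + - md_point a)).
  by apply: gVZ; [exact: gK_nth hM|apply: gVD; [exact: gV_nth hX|exact: dV_const]].
apply: gVs_cons.
  apply: gVD => //; apply: gV_comb; first exact: gKs_take hM2.
  exact: dVs_const.
apply: IH; last exact: gKs_drop hM2.
apply: (@dVs_map_iota _ _ _ (fun vs ks => drop 1 (X vs ks))
  (fun x vs ks => transvection (M vs ks)`_1 ((M vs ks)`_0 *: ((X vs ks)`_0 + - md_point a)) x)).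
  exact: (gVs_drop (l := 1) hX).
move=> v hv; apply: gVD => //; apply: gVZ => //.
by apply: gKM; [exact: gK_nth hM|exact: gKF].
Qed.

Lemma dV_linear k m (pi : V -> V) (v : seq V -> seq K -> V) :
  (forall u v, pi (u + v) = pi u + pi v) -> (forall a v, pi (a *: v) = a *: pi v) ->
  dV k m v -> dV k m (fun vs ks => pi (v vs ks)).
Proof.
move=> piD piZ hv.
have hb : dVs k m (size ws) (fun _ _ => [seq pi b | b <- bs]).
  by rewrite sws -(size_map pi); exact: dVs_const.
apply: gV_ext (gV_comb (gKs_forms hv (dVs_const k m ws)) hb) _ => -[] vs ks _ _.
have [c sc ->] := (LinP bs (v vs ks)).1 (spanning _).
rewrite dual //; elim: (bs) (c) sc => [|b l IH] [|a c0] //=.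
  by rewrite -(scale0r 0) piZ !scale0r.
by move=> [sc]; rewrite piD piZ IH.
Qed.

Lemma moves_ok_nth W ms i : moves_ok alt W ms -> (i < size ms)%N ->
  exists W', move_ok alt W' (nth (MoveData 0 [::] id) ms i).
Proof.
elim: ms W i => [|m ms IH] W [|i] //= [h1 h2] lt_i; first by exists W.
exact: IH h2 lt_i.
Qed.

(** Each condition on a target says that a polynomial in its coordinates is nonzero, and [move_ok]
    provides a vector where it is; so the failures form a thin set. *)
Lemma thin_bad_targets W ms : moves_ok alt W ms ->
  exists D, thin D (size ms * r) (fun z => ~ good_targets alt ms (vecs bs (size ms) z)).
Proof.
move=> ok; pose nm := nth (MoveData 0 [::] id) ms.
pose bad i v := ~ (bform (md_point (nm i)) (md_proj (nm i) v) != 0 /\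
                   anisotropic alt (md_proj (nm i) v)).
suff H q : exists D, thin D (size ms * r) (fun z =>
    exists2 i, (i < q)%N /\ (i < size ms)%N & bad i (vecs bs (size ms) z)`_i).
  have [D hD] := H (size ms); exists D; apply: thin_sub hD => z sz nz.
  apply: contrapT => h; apply: nz; rewrite /bad /nm in h.
  elim: (ms) (vecs _ _ _) (size_vecs bs (size ms) z) h => [|m l IH] [|v vs] //= [sv] h.
  split; first by apply: contrapT => h0; apply: h; exists 0%N.
  by apply: IH => // -[i [lt_i _] hi]; apply: h; exists i.+1.
elim: q => [|q [D hD]]; first by exists 0%N; apply: thin_sub (thin_empty _ 0 _) => z _ [i []].
have [lt_q|le_q] := ltnP q (size ms); last first.
  exists D; apply: thin_sub hD => z _ [i [lt_i lt_i'] hi]; exists i => //.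
  by split=> //; exact: leq_trans lt_i' le_q.
have [W' [_ [piD piZ _ _ _] [v1 hv1] [v2 hv2]]] := moves_ok_nth ok lt_q.
rewrite -/(nm q) in piD piZ hv1 hv2.
have dpi : @dV N 0 (size ms * r) (fun _ z => md_proj (nm q) (vecs bs (size ms) z)`_q).
  apply: (dV_linear piD piZ); apply: gV_nth; exact: dVs_vecs (dKs_var _ _ _).
have wit v : exists2 z, size z = (size ms * r)%N & (vecs bs (size ms) z)`_q = v.
  exists (coords ws (nseq (size ms) v)); first by rewrite (size_coords sws) size_nseq.
  by rewrite (coordsK spanning dual) ?size_nseq // nth_nseq lt_q.
have [D1 h1] : exists D, thin D (size ms * r) (fun z =>
    bform (md_point (nm q)) (md_proj (nm q) (vecs bs (size ms) z)`_q) = 0).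
  apply: (dK_thin FN spanning); first by apply: gKF => //; exact: dV_const.
  by have [z sz Ez] := wit v1; exists z; rewrite ?Ez.
have [D2 h2] : exists D, thin D (size ms * r) (fun z =>
    ~~ anisotropic alt (md_proj (nm q) (vecs bs (size ms) z)`_q)).
  move: hv2; rewrite /anisotropic; case: (alt) => /= hv2.
    by exists 0%N; apply: thin_sub (thin_empty _ 0 _).
  have [||D2 h2] := dK_thin FN spanning (n := size ms * r) (f := fun z =>
     let v := md_proj (nm q) (vecs bs (size ms) z)`_q in bform v v); first exact: gKF.
    by have [z sz Ez] := wit v2; exists z; rewrite ?Ez.
  by exists D2; apply: thin_sub h2 => z _; rewrite negbK => /eqP.
exists (D + (D1 + D2))%N; apply: thin_sub (thin_union hD (thin_union h1 h2)) => z _.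
move=> [i [lt_i lt_i'] hi]; move: lt_i; rewrite ltnS leq_eqVlt => /orP[/eqP E|lt_i].
  right; rewrite E in hi; apply: contrapT => h; apply: hi; split.
    by apply/eqP => h0; apply: h; left.
  by apply: contrapT => /negP h0; apply: h; right.
by left; exists i.
Qed.

(** Decoding is a definable map from the coordinates of a point of [Z] and [moves_cost ms] further
    scalars to lists of targets. By invariance of [Z] its image contains all good targets, which are
    co-thin among tuples of [size ms * r] scalars; so the cylinder over [Z] has at least that
    dimension, and [gdim_cylinder] removes the further scalars. *)
Lemma gdim_orbit k (Z : set (pt N k 0)) (x0 : seq V) (P : seq V) ms (iota0 : seq nat) :
  definable Z -> size x0 = k -> lset Z x0 [::] -> moves_ok alt P ms ->
  (forall c y x, isometric alt c y -> (forall w, w \in P -> bform w y = 0) ->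
    lset Z x [::] -> lset Z [seq transvection c y v | v <- x] [::]) ->
  [seq md_point m | m <- ms] = [seq x0`_i | i <- iota0] ->
  exists2 d, (size ms * r <= d + moves_cost ms)%N & gdim (k * r) (coord_set bs Z) d.
Proof.
move=> dZ sx0 Zx0 ok Zinv Ex0.
have siota : size iota0 = size ms by rewrite -(size_map (fun i => x0`_i)) -Ex0 size_map.
apply: (gdim_cylinder (c := moves_cost ms)).
pose X z := [seq (vecs bs k (take (k * r) z))`_i | i <- iota0].
pose G e z := coords ws (decode ms (X e) (drop (k * r) e)) = z.
have ht := gKs_take (dKs_var N 0 (k * r + moves_cost ms + size ms * r)).
have inf_K := form_infinite FN.
apply: (gdim_image (G := G) (dset_dichotomy FN spanning free FK)).
- exact: (gdef_comp (dset_coord_set bs dZ) (gVs_nil _ _ 0 _)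
    (gKs_take (dKs_var N 0 (k * r + moves_cost ms)))).
- apply: (gdef_eqKs (j := size ms * r)); last exact: gKs_drop (dKs_var _ _ _).
  apply: (dKs_coords sws); apply: dVs_decode.
    rewrite /dVs -[Y in gVs _ _ _ _ Y _]siota; apply: gVs_map => i; apply: gV_nth.
    apply: (@dVs_vecs N bs _ _ k (fun _ e => take (k * r) (take (k * r + moves_cost ms) e))).
    exact: gKs_take ht.
  exact: gKs_drop ht.
- by move=> y z z' _ _ _ _ <- <-.
- have [D tD] := thin_bad_targets ok.
  apply: (cothin_not_null inf_K (D := D)).
  apply: thin_sub tD => z sz nz good; apply: nz.
  have [g [mu [smu hg E]]] := decode_onto FN ok (size_vecs bs (size ms) z) good.
  have Zg : lset Z [seq g v | v <- x0] [::].
    elim: hg {E} => {g} [|c y g cy yP _ IH]; first by rewrite map_id.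
    by have := Zinv _ _ _ cy yP IH; rewrite -map_comp.
  have sc : size (coords ws [seq g v | v <- x0]) = (k * r)%N.
    by rewrite (size_coords sws) size_map sx0.
  exists (coords ws [seq g v | v <- x0] ++ mu); split.
  + by rewrite size_cat sc smu.
  + by rewrite take_size_cat // /coord_set (coordsK spanning dual) ?size_map.
  + rewrite /G /X take_size_cat // drop_size_cat // (coordsK spanning dual) ?size_map //.
    rewrite -[RHS](vecsK dual sz) -E; congr (coords ws (decode ms _ mu)).
    have g0 : g 0 = 0 by exact: isometry0 hg.
    under eq_map => i do rewrite (@nth_map_default _ _ 0) //.
    by rewrite map_comp -Ex0 -map_comp.
Qed.

End OrbitDimension.

Definition is_alternating (B : form_theory) : bool := if B is Alternating then true else false.

Lemma model_form_space F B m N : admissible F -> model F B m N -> form_space N (is_alternating B).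
Proof.
move=> adm [hF _ [[bl br] hB]].
have two := scal_two adm hF; have inf := scal_infinite hF.
have Dl u v w : bform (u + v) w = bform u w + bform v w :> scal N.
  by have := bl w 1 u v; rewrite /= scale1r mul1r.
have Dr u v w : bform u (v + w) = bform u v + bform u w :> scal N.
  by have := br u 1 v w; rewrite /= scale1r mul1r.
have f0 w : bform 0 w = 0 :> scal N.
  by apply: (addrI (bform 0 w)); rewrite -Dl !addr0.
have Zl c u w : bform (c *: u) w = c * bform u w :> scal N.
  by have := bl w c u 0; rewrite /= addr0 f0 addr0.
have nd : nondegenerate_form N -> forall u : vect N, u != 0 -> exists v, bform u v != 0.
  move=> h u; apply: contra_neqP => h'; apply: h => v; apply: contrapT => /eqP uv.
  by apply: h'; exists v.
case: B hB => /= [[sym hB]|[alt /nd h]]; split=> //.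
- by move=> u v; rewrite /form_sign mul1r sym.
- move: hB; case: F hF adm => [p|] _ _ hB; first exact: nd.
  by move=> u /hB[z z0]; rewrite subr0 => E; exists u; rewrite E expf_neq0.
- move=> u v; rewrite /form_sign mulN1r; apply/eqP; rewrite -addr_eq0.
  by have := alt (u + v); rewrite Dl !Dr !alt add0r addr0 addrC => ->.
Qed.

(** * Moving a point into general position *)

Section GenericPoint.
Variables (C : lstruct) (alt : bool).
Hypothesis FC : form_space C alt.
Hypothesis inf_dim : forall n, ~ has_dim (vect C) n.
Local Notation V := (vect C).
Local Notation K := (scal C).
Local Notation tau := (@transvection C).

Lemma indep_shift (P : seq V) x s : lin_indep_over (Lin P) (x :: s) ->
  lin_indep_over (Lin (x :: P)) s.
Proof.
move=> /indepP h; apply/indepP => c sc /Lin_cons[a [w [hw E]]].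
have := h (- a :: c); rewrite /= sc => /(_ erefl).
by rewrite E scaleNr addKr => /(_ hw)[].
Qed.

Lemma isometry_linear W (g : V -> V) : isometry_fixing alt W g ->
  (forall u v, g (u + v) = g u + g v) /\ (forall c v, g (c *: v) = c *: g v).
Proof.
elim=> {g} [|c y g _ _ _ [gD gZ]]; first by [].
by split=> *; rewrite ?gD ?gZ ?(transvectionD FC) ?(transvectionZ FC).
Qed.

Lemma holds_isometry W (g : V -> V) phi vs ks : isometry_fixing alt W g ->
  holds (map g vs) ks phi <-> holds vs ks phi.
Proof.
elim=> {g} [|c y g cy _ _ IH]; first by rewrite map_id.
by rewrite (map_comp (tau c y) g) (holds_transvection FC).
Qed.

(** The tail is first moved into general position over [x] and [P] by an isometry fixing [W] and
    [x]; one more transvection then moves [x] as well. *)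
Lemma generic_isometry (s W P : seq V) : lin_indep_over (Lin W) s ->
  exists2 g : V -> V, isometry_fixing alt W g & lin_indep_over (Lin P) (map g s).
Proof.
elim: s W P => [|x s IH] W P ind; first by exists id; [exact: iso_id|exact: indep_nil].
have [g' Wg' ind'] := IH (x :: W) (x :: P) (indep_shift ind).
have xW : ~ Lin W x.
  by have [h _] := (indep_cons _ _ _).1 ind; move=> /(Lin_catr s).
(* As [y] lies outside the span of [x], the moved tail and [P], a combination [u] whose image falls
   into the span of [P] cannot acquire a [y]-component: [[u, y] = 0] and [u] itself is in that span.
   The general position of the tail kills its coefficients, and [[x, y] != 0] kills that of [x]. *)
have [y [yW xy yQ ay]] := exists_move FC inf_dim (x :: map g' s ++ P) xW.
have [c c0 cy] := anisotropic_isometric FC ay.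
have sub : {subset W <= x :: W} by move=> w wW; rewrite inE wW orbT.
exists (fun v => tau c y (g' v)); first by apply: iso_move => //; exact: isometry_sub sub Wg'.
have g'x : g' x = x by apply: isometry_fix Wg' _; rewrite mem_head.
apply/indepP => -[|a b] //= [sb]; rewrite size_map in sb.
pose u := a *: x + comb b (map g' s).
have -> : a *: tau c y (g' x) + comb b [seq tau c y (g' v) | v <- s] = tau c y u.
  rewrite g'x (transvectionD FC) (transvectionZ FC); congr (_ + _).
  rewrite (map_comp (tau c y) g') -[in LHS](map_id b).
  apply: (comb_semilinear (phi := id)); [exact: transvectionD FC c y| |exact: transvectionZ FC c y].
  by rewrite transvection_fix ?(form0l FC).
move=> hu.
have uQ : Lin (x :: map g' s ++ P) u.
  apply: LinD; first by apply/LinZ/Lin_mem; rewrite mem_head.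
  have := Lin_catl P (Lin_comb b (map g' s)).
  by apply: Lin_subset => z; rewrite inE => ->; rewrite orbT.
have cuy : c * bform u y = 0.
  apply: contrapT => /eqP h; apply: yQ.
  rewrite -(scale1r y) -(mulVf h) -scalerA; apply: LinZ.
  rewrite -(addKr u (_ *: y)) addrC; apply: LinB => //.
  by apply: Lin_subset hu => z zP; rewrite inE mem_cat zP !orbT.
have uP : Lin P u by move: hu; rewrite /tau /transvection cuy scale0r addr0.
have /indepP h := ind'; have {h}b0 : b = nseq (size (map g' s)) 0.
  apply: h; first by rewrite size_map.
  apply/Lin_cons; exists (- a), u; split=> //.
  by rewrite /u scaleNr addKr.
rewrite !size_map in b0 *; rewrite b0; congr cons.
move: cuy; rewrite /u b0 -(size_map g') comb0 addr0 (formZl FC) => /eqP.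
by rewrite !mulf_eq0 (negPf c0) (negPf xy) orbF => /eqP.
Qed.

Lemma bijection_indep k m k' (X : set (pt C k m)) (X' : set (pt C k' 0))
    phi bv bk psi pv pk (a : pt C k m) (s : seq V) :
  X = defset phi bv bk -> X' = defset psi pv pk -> def_bijection X X' -> X a ->
  {subset s <= a.1} -> lin_indep_over (Lin bv) s ->
  exists x' t, [/\ X' x', {subset t <= x'.1}, size t = size s & lin_indep_over (Lin pv) t].
Proof.
move=> EX EX' [f [fX f_inj _] [theta [qv [qk [_ _ EG]]]]] Xa sa ind.
(* All parameters involved: those of the set, of the graph of the bijection, and of the image. *)
pose P := bv ++ qv ++ pv.
have [g Wg indg] := generic_isometry P ind.
pose ga : pt C k m := (map_tuple g a.1, a.2).
have gb : map g bv = bv.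
  by rewrite -[RHS]map_id; apply/eq_in_map => v; exact: isometry_fix Wg.
have Xga : X ga.
  move: Xa; rewrite EX /defset /= => /(holds_isometry phi (a.1 ++ bv) _ Wg).
  by rewrite map_cat gb.
pose x' := f ga.
have X'x' : X' x' by exact: fX.
have hs v : v \in map g s -> Lin (x'.1 ++ P) v.
  move=> /mapP[w ws ->]; apply: contrapT => hv.
  have [y [yW vy _ ay]] := exists_move FC inf_dim [::] hv.
  have [c c0 cy] := anisotropic_isometric FC ay.
  have fix_ u : u \in x'.1 ++ P -> tau c y u = u by move=> /yW; exact: transvection_fix.
  have fixs l : {subset l <= x'.1 ++ P} -> map (tau c y) l = l.
    by move=> h; rewrite -[RHS]map_id; apply/eq_in_map => u /h; exact: fix_.
  have : (defset theta qv qk : set (pt C (k + k') (m + 0))) (pt_cat ga x') by rewrite -EG; exists ga.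
  rewrite /defset /= => /(holds_transvection FC theta (_ ++ qv) _ cy).
  rewrite map_cat map_cat [map _ qv]fixs; last by move=> u uq; rewrite !mem_cat uq !orbT.
  rewrite [map _ x'.1]fixs; last by move=> u ux; rewrite mem_cat ux.
  (* The transvection preserves the graph and fixes [x'], so [tga] has the same image as [ga] and
     equals it by injectivity. But [g w] occurs in [ga] and is moved, as [[g w, y] != 0]. *)
  pose tga : pt C k m := (map_tuple (tau c y) ga.1, ga.2).
  move=> h; have : (defset theta qv qk : set (pt C (k + k') (m + 0))) (pt_cat tga x').
    by rewrite /defset /=.
  rewrite -EG => -[x1 Xx1 E].
  have /(congr1 (fun p : pt C (k + k') (m + 0) => val p.1)) /= E1 := E.
  have /(congr1 (fun p : pt C (k + k') (m + 0) => val p.2)) /= E2 := E.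
  move/eqP: E1; rewrite eqseq_cat ?size_tuple // => /andP[/eqP E1 /eqP E1'].
  move/eqP: E2; rewrite eqseq_cat ?size_tuple // => /andP[/eqP E2 /eqP E2'].
  have f1 : f x1 = f ga by apply: pt_eq; [rewrite -E1'|rewrite -E2'].
  have x1ga : x1 = ga by apply: f_inj; rewrite ?inE.
  have : tau c y (g w) = g w.
    move: E1; rewrite x1ga => /= E1.
    have gwa : g w \in map g a.1 by apply: map_f; exact: sa.
    have /nthP := gwa => /(_ 0)[i lt_i <-].
    by have := congr1 (fun l => l`_i) E1; rewrite (nth_map 0).
  rewrite /tau -[RHS]addr0 => /addrI /eqP; rewrite scaler_eq0 mulf_eq0 (negPf c0) (negPf vy) /=.
  by move=> /eqP y0; move: vy; rewrite y0 (form0r FC) eqxx.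
have [t [tx it ht]] := maximal_indep_sublist P x'.1.
have le_st : (size s <= size t)%N.
  rewrite -(size_map g s); apply: (Steinitz indg) => v /hs; apply: Lin_sub => u.
  rewrite mem_cat => /orP[/ht//|uP]; apply: Lin_catr; exact: Lin_mem.
exists x', (take (size s) t); split=> //.
- by move=> v /mem_take /tx.
- by rewrite size_takel.
- have := @indep_take _ _ _ _ (size s) it; apply: indep_subset => v; apply: Lin_subset => u up.
  by rewrite !mem_cat up !orbT.
Qed.

End GenericPoint.

Section Transfer.
Variables (M C : lstruct) (e : elementary M C).

(** Independence of a list over finitely many parameters is a statement about two tuples of
    coefficients of fixed length, hence first order. The positions [il] name the independent vectors
    inside the point. *)
Lemma indep_transfer k psi (pv : seq (vect M)) (pk : seq (scal M)) (x' : seq (vect C)) (il : seq nat) :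
  size x' = k -> holds (x' ++ map (elV e) pv) (map (elK e) pk) psi ->
  lin_indep_over (Lin (map (elV e) pv)) [seq x'`_i | i <- il] ->
  exists x, [/\ size x = k, holds (x ++ pv) pk psi & lin_indep_over (Lin pv) [seq x`_i | i <- il]].
Proof.
move=> sx hx ind.
pose X b := vconst (elem_vconst e) pv b; pose A b := kconst (elem_kconst e) pk b.
pose Q b (x : seq (vect (elem_family M C b))) := holds (x ++ X b) (A b) psi /\
  forall c, size c = size il -> forall d, size d = size pv ->
    comb c [seq x`_i | i <- il] = comb d (X b) -> c = nseq (size il) 0.
have hP : gdef (elem_vconst e) (elem_kconst e) 0 0 (fun b _ _ => exists2 x, size x = k & Q b x).
  apply: gdef_exVs; apply: gdef_and.
    apply: gdef_holds; last exact: gKs_const.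
    apply: gVs_cat; [exact: gVs_take (gVs_var _ _ (k + 0) 0)|exact: gVs_const].
  apply: gdef_allKs; apply: gdef_allKs; apply: gdef_imp.
    apply: gdef_eqV.
      apply: gV_comb; first exact: gKs_take (gKs_drop (gKs_var _ _ (k + 0) (size pv + (size il + 0)))).
      apply: gVs_map => i; apply: gV_nth; exact: gVs_take (gVs_var _ _ (k + 0) _).
    apply: gV_comb; first exact: gKs_take (gKs_var _ _ (k + 0) (size pv + (size il + 0))).
    exact: gVs_const.
  apply: (gdef_eqKs (j := size il)).
    exact: gKs_take (gKs_drop (gKs_var _ _ (k + 0) (size pv + (size il + 0)))).
  have H : gKs (elem_vconst e) (elem_kconst e) (k + 0) (size pv + (size il + 0)) (size il)
      (fun _ _ _ => [seq 0 | _ <- il]) by apply: gKs_map => i; exact: gK0.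
  apply: gKs_ext H _ => b vs ks _ _.
  by elim: (il) => //= i l ->.
have [|x sx' [hx' ind']] := (elementary_transfer hP).2.
  exists x' => //; split=> // c sc d sd E.
  have /indepP h := ind; have := h c; rewrite size_map; apply=> //.
  by apply/LinP; exists d; rewrite ?size_map.
have EX : X true = pv by rewrite /X /vconst /= map_id.
have EA : A true = pk by rewrite /A /kconst /= map_id.
exists x; split=> //; first by rewrite EX EA in hx'.
apply/indepP => c sc /LinP[d sd E]; rewrite size_map in sc *.
by apply: (ind' c sc d sd); rewrite EX.
Qed.

End Transfer.

Section Independence.
Variables (K : fieldType) (V : lmodType K).

Lemma lin_indep_nil (s : seq V) : lin_indep s <-> lin_indep_over (Lin [::]) s.
Proof.
split=> h c hc; apply: h; first by move/Lin_nil: hc.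
by rewrite [X in Lin _ X]hc; exact: Lin0.
Qed.

Lemma countable_dim_infinite : countably_infinite_dim V -> forall n, ~ has_dim V n.
Proof.
move=> [e [ind _]] n [b [sb _ gen]].
have /lin_indep_nil/Steinitz h := ind n.+1.
have : (size (mkseq e n.+1) <= size b)%N.
  by apply: h => x _; rewrite cats0; exact: gen.
by rewrite size_mkseq sb ltnn.
Qed.

End Independence.

(** A finite certificate for [moves_ok]: it involves finitely many vectors of the
    infinite-dimensional model, so it descends to all sufficiently large members of an approximating
    sequence, where the projections are then constructed. *)
Fixpoint axes_ok (N : lstruct) alt (W s ys : seq (vect N)) : Prop :=
  match s, ys with
  | a :: s', y :: ys' => [/\ forall w, w \in W -> bform w y = 0, bform a y != 0,
      anisotropic alt y & axes_ok alt (a :: W) s' ys']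
  | [::], [::] => True
  | _, _ => False
  end.

Lemma exists_axes (N : lstruct) alt (W s : seq (vect N)) : form_space N alt ->
  (forall n, ~ has_dim (vect N) n) -> lin_indep_over (Lin W) s ->
  exists ys, axes_ok alt W s ys.
Proof.
move=> FN inf; elim: s W => [|a s IH] W ind; first by exists [::].
have aW : ~ Lin W a.
  by have [h _] := (indep_cons _ _ _).1 ind; move=> /(Lin_catr s).
have [y [yW ay _ an]] := exists_move FN inf [::] aW.
have [ys h] := IH (a :: W) (indep_shift ind).
by exists (y :: ys).
Qed.

(** The projection fixes an axis already orthogonal to [W], so the axis witnesses both nonvanishing
    conditions. Each of the [size s] stages costs 2 scalars plus the number of vectors fixed so far,
    at most [size W + size s]; the bound does not involve the dimension of the space. *)
Lemma axes_moves (N : lstruct) alt (W s ys : seq (vect N)) : form_space N alt ->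
  axes_ok alt W s ys -> exists ms : seq (move_data N), [/\ map (@md_point N) ms = s,
    moves_ok alt W ms & (moves_cost ms <= size s * (2 + size W + size s))%N].
Proof.
move=> FN; elim: s W ys => [|a s IH] W [|y ys] //=; first by exists [::].
move=> [yW ay an /IH[ms [Ems ok cost]]].
have [F [pi sF op]] := form_projection FN W.
have piy : pi y = y by case: op => _ _ _ _; apply.
exists (MoveData a F pi :: ms); split; rewrite /= ?Ems //.
  by split=> //; split=> //; exists y; rewrite /= piy.
by rewrite sF; move: cost => /=; lia.
Qed.

Section Embedding.
Variables (N M : lstruct) (j : lembedding N M).

Lemma emb_axes alt (W s ys : seq (vect N)) :
  axes_ok alt (map (embV j) W) (map (embV j) s) (map (embV j) ys) -> axes_ok alt W s ys.
Proof.
elim: s W ys => [|a s IH] W [|y ys] //= [yW ay an /(IH (a :: W)) h].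
have F0 u v : (bform (embV j u) (embV j v) == 0) = (bform u v == 0).
  by rewrite embF fmorph_eq0.
split=> //.
- by move=> w wW; apply/eqP; rewrite -F0; apply/eqP/yW/map_f.
- by rewrite -F0.
- by move: an; rewrite /anisotropic F0.
Qed.

Lemma emb_transvection c y v :
  embV j (transvection c y v) = transvection (embK j c) (embV j y) (embV j v).
Proof. by rewrite /transvection raddfD /= embZ embF rmorphM. Qed.

Lemma emb_isometric alt c y : isometric alt c y -> isometric alt (embK j c) (embV j y).
Proof.
move=> h; have := congr1 (embK j) h; rewrite /isometric /form_sign embF.
by case: alt {h}; rewrite rmorphD !rmorphM !rmorphD rmorph0 ?rmorphN !rmorph1.
Qed.

End Embedding.

(** * The lower bound in the members of an approximating sequence *)

Section Approximation.
Variables (F : scal_theory) (B : form_theory) (M : lstruct) (N : nat -> lstruct).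
Variable j : forall r, lembedding (N r) M.
Hypothesis adm : admissible F.
Hypothesis app : approximating F B j.

Lemma form_index_ge n : exists2 r, (n <= r)%N & form_index B r.
Proof.
case: (B) => /=; first by exists n.
by exists n.*2.+2; rewrite /= ?odd_double //; lia.
Qed.

Lemma approx_range (vs : seq (vect M)) : exists r0, forall r, (r0 <= r)%N -> form_index B r ->
  exists us, map (embV (j r)) us = vs.
Proof.
have [_ _ mono cover] := app.
elim: vs => [|v vs [r0 IH]]; first by exists 0%N => r _ _; exists [::].
have [r1 i1 rv] := cover v.
exists (maxn r0 r1) => r; rewrite geq_max => /andP[le0 le1] ir.
have [us <-] := IH r le0 ir; have [u _ <-] := mono _ _ i1 ir le1 _ rv.
by exists (u :: us).
Qed.

Lemma approx_scal r : form_index B r -> forall c, exists c', embK (j r) c' = c.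
Proof.
move=> ir c; have [_ /(_ r ir) h _ _] := app.
have [c' _ <-] : range (embK (j r)) c by rewrite h.
by exists c'.
Qed.

(** Each law concerns finitely many vectors, which lie together in some member of the sequence, a
    model of the finite-dimensional theory with the same scalars. *)
Lemma approx_form_space : form_space M (is_alternating B).
Proof.
have fs r : form_index B r -> form_space (N r) (is_alternating B).
  by have [h _ _ _] := app; move=> /h; exact: model_form_space.
have pull (vs : seq (vect M)) : exists r us, [/\ form_index B r,
    map (embV (j r)) us = vs & form_space (N r) (is_alternating B)].
  have [r0 h] := approx_range vs; have [r le ir] := form_index_ge r0.
  by have [us E] := h r le ir; exists r, us; split=> //; exact: fs.
have sgn r : embK (j r) (form_sign _ (is_alternating B)) = form_sign (scal M) (is_alternating B).
  by rewrite /form_sign; case: is_alternating; rewrite ?rmorphN rmorph1.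
split.
- move=> u v w; have [r [us [ir + fr]]] := pull [:: u; v; w].
  by case: us => [|u' [|v' [|w' []]]] //= [<- <- <-]; rewrite -raddfD !embF (formDl fr) rmorphD.
- move=> c u w; have [r [us [ir + fr]]] := pull [:: u; w].
  case: us => [|u' [|w' []]] //= [<- <-]; have [c' <-] := approx_scal ir c.
  by rewrite -embZ !embF (formZl fr) rmorphM.
- move=> u w; have [r [us [ir + fr]]] := pull [:: u; w].
  by case: us => [|u' [|w' []]] //= [<- <-]; rewrite !embF (form_sym fr) rmorphM sgn.
- move=> u ha; have [r [us [ir + fr]]] := pull [:: u].
  by case: us => [|u' []] //= [<-]; rewrite !embF (form_alt fr) ?rmorph0.
- have [r [_ [_ _ fr]]] := pull [::].
  by have := form_two fr; rewrite -(fmorph_eq0 (embK (j r))) rmorph_nat.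
- move=> u; have [r [us [ir + fr]]] := pull [:: u].
  case: us => [|u' []] //= [<-] u0.
  have /(form_nondeg fr)[v' h] : u' != 0 by apply: contraNneq u0 => ->; rewrite raddf0.
  by exists (embV (j r) v'); rewrite embF fmorph_eq0.
- move=> s; have [r [_ [ir _ fr]]] := pull [::].
  have [s' <-] : exists s', map (embK (j r)) s' = s.
    elim: s => [|c s [s' <-]]; first by exists [::].
    by have [c' <-] := approx_scal ir c; exists (c' :: s').
  have [x xs] := form_infinite fr s'; exists (embK (j r) x).
  by rewrite mem_map //; exact: fmorph_inj.
Qed.

End Approximation.

Section LowerBound.
Variables (F : scal_theory) (B : form_theory) (C : lstruct).
Hypothesis adm : admissible F.

Lemma seq_preimage (T T' : eqType) (f : T -> T') (s : seq T') :
  (forall x, x \in s -> exists y, f y = x) -> exists t, map f t = s.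
Proof.
elim: s => [|x s IH] h; first by exists [::].
have [|t <-] := IH; first by move=> y ys; apply: h; rewrite inE ys orbT.
by have [y <-] := h x (mem_head _ _); exists (y :: t).
Qed.

Lemma rk_definable (N : lstruct) k (Z : set (pt N k 0)) z : rk F Z z -> definable Z.
Proof.
case: F => [p [N' [e [phi [pv [pk [_ -> _]]]]]]|[n [Y []]]] //.
by exists phi, pv, pk.
Qed.

(** The model over which [X'] is defined, and with it the parameters, appears only when the
    dimension is unpacked; therefore the hypothesis supplies an independent tuple for every
    definition of [X']. *)
Lemma dim_vect_set_lower k (X' : set (pt C k 0)) s e :
  (forall psi pv pk, X' = defset psi pv pk -> exists (x' : pt C k 0) (t : seq (vect C)),
     [/\ X' x', {subset t <= x'.1}, size t = e & lin_indep_over (Lin pv) t]) ->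
  dim_vect_set F B X' s ->
  exists f c, s = germ B f /\ exists n0, forall r, (n0 <= r)%N -> form_index B r ->
    (e * r)%:Z <= f r + c%:Z.
Proof.
move=> hX [M [el [N [j [f [cdim [psi [pv [pk [hpv hpk EX]]]] app [n0 hf] ->]]]]]].
have [pv' Epv] : exists pv', map (elV el) pv' = pv.
  by apply: seq_preimage => v /hpv[v' _ <-]; exists v'.
have [pk' Epk] : exists pk', map (elK el) pk' = pk.
  by apply: seq_preimage => v /hpk[v' _ <-]; exists v'.
have [x' [t [X'x' tx st it]]] := hX _ _ _ EX.
have [il Eil] : exists il, [seq (x'.1)`_i | i <- il] = t.
  apply: seq_preimage => v /tx/(nthP 0)[i _ <-]; by exists i.
have t0 (y : pt C k 0) : y.2 = [::] :> seq _ by case: (y) => y1 y2; rewrite /= (tuple0 y2).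
have [||x [sx hx ix]] := @indep_transfer _ _ el k psi pv' pk' x'.1 il (size_tuple _).
- by move: X'x'; rewrite EX Epv Epk /defset /= t0.
- by rewrite Epv Eil.
have FM := approx_form_space adm app.
have infM := countable_dim_infinite cdim.
have [ys hys] := exists_axes FM infM ix.
(* The bound on the number of auxiliary scalars from [axes_moves], the same for all [r]. *)
exists f, (e * (2 + size pv' + e))%N; split=> //.
(* From index [r0] on, the submodel contains the point, the parameters and the certifying axes. *)
have [r0 hr0] := approx_range app (x ++ pv' ++ ys).
exists (maxn n0 r0) => r; rewrite geq_max => /andP[le_n0 le_r0] ir.
have [us E] := hr0 r le_r0 ir.
have sus : size us = (size x + (size pv' + size ys))%N.
  by rewrite -(size_map (embV (j r))) E !size_cat.
have [ux [up [uy [Eus sux sup]]]] : exists ux up uy, [/\ us = ux ++ up ++ uy,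
    size ux = size x & size up = size pv'].
  exists (take (size x) us), (take (size pv') (drop (size x) us)),
    (drop (size pv') (drop (size x) us)); rewrite !cat_take_drop; split=> //.
    by rewrite size_takel // sus leq_addr.
  by rewrite size_takel // size_drop sus addKn leq_addr.
have {E}[Ex Ep Ey] : [/\ map (embV (j r)) ux = x, map (embV (j r)) up = pv' &
    map (embV (j r)) uy = ys].
  move/eqP: E; rewrite Eus map_cat map_cat eqseq_cat ?size_map // => /andP[/eqP-> ].
  by rewrite eqseq_cat ?size_map // => /andP[/eqP-> /eqP->].
have [/(_ r ir) mod_r rK _ _] := app.
have FN := model_form_space adm mod_r.
have [hF [bs [sbs free span_bs]] _] := mod_r.
have [ws [sws dual]] := dual_basis FN free.
have := hf r le_n0 ir; set Z := [set _ | _] => hz.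
have dZ := rk_definable hz.
have ZE (y : seq (vect (N r))) : size y = k ->
    lset Z y [::] <-> holds (map (embV (j r)) y ++ pv') pk' psi.
  move=> sy; rewrite (elP el) map_cat Epv Epk.
  have [w [w1 w2]] := pt_of_seqs (N := N r) sy (erefl (size [::])).
  have -> : lset Z y [::] <-> Z w by rewrite -(lset_pt Z w) w1 w2.
  by rewrite /Z /= EX /defset /= w1 w2.
have ax : axes_ok (is_alternating B) up [seq ux`_i | i <- il] uy.
  apply: (emb_axes (j := j r)); rewrite Ep Ey -map_comp.
  have -> // : [seq (embV (j r) \o nth 0 ux) i | i <- il] = [seq x`_i | i <- il].
  apply: eq_map => i /=; rewrite -Ex (@nth_map_default _ _ 0) //; exact: raddf0.
have [ms [Ems ok cost]] := axes_moves FN ax.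
have sil : size il = e by rewrite -(size_map (fun i => x'.1`_i)) Eil.
have sms : size ms = e by rewrite -(size_map (@md_point _)) Ems size_map.
have [|||d ed gd] := gdim_orbit FN span_bs free sws dual hF dZ (x0 := ux) (ms := ms) (P := up) (iota0 := il) _ _ ok _ Ems.
- by rewrite sux.
- by apply/ZE; rewrite ?sux // Ex.
- move=> c y v cy yP Zv; have [w [_ w1 _]] := Zv.
  have sv : size v = k by rewrite -w1 size_tuple.
  apply/ZE; rewrite ?size_map //; move/ZE: Zv => /(_ sv).
  have cy' := emb_isometric (j r) cy.
  move/(holds_transvection FM psi (_ ++ pv') _ cy').
  rewrite map_cat -!map_comp.
  have -> : [seq transvection (embK (j r) c) (embV (j r) y) i | i <- pv'] = pv'.
    rewrite -[RHS]map_id -Ep; apply/eq_in_map => _ /mapP[u uu ->].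
    by rewrite transvection_fix // embF yP // rmorph0.
  by congr holds; congr cat; apply: eq_map => u /=; rewrite emb_transvection.
have := rk_lower FN span_bs free sws dual hF dZ hz gd.
move: ed cost; rewrite sms sbs size_map sil sup => ed cost.
have : (e * r <= d + e * (2 + size pv' + e))%N by apply: leq_trans ed _; rewrite leq_add2l.
lia.
Qed.

End LowerBound.

(** * Witt's theorem and approximating sequences *)

Section Witt.
Variables (C : lstruct) (alt : bool).
Hypothesis FC : form_space C alt.
Local Notation V := (vect C).
Local Notation K := (scal C).
Local Notation tau := (@transvection C).
Local Notation eps := (form_sign K alt).
Implicit Types (U : seq V) (u v w x y z f g : V).

Definition orthogonal_to U v := forall x, x \in U -> bform v x = 0.

Lemma orthogonal_to_Lin U v u : orthogonal_to U v -> Lin U u -> bform v u = 0.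
Proof.
move=> vU hu; apply: (form_eq0C FC); apply: (form_Lin_eq0 FC) hu => x xU.
exact: (form_eq0C FC) (vU x xU).
Qed.

Lemma orthogonal_toD U v w a : orthogonal_to U v -> orthogonal_to U w ->
  orthogonal_to U (v + a *: w).
Proof. by move=> hv hw x xU; rewrite (formDl FC) (formZl FC) hv // hw // mulr0 addr0. Qed.

(** The first clause says that the Gram matrix of [U] is invertible, and includes linear
    independence; the second is the resulting splitting of the space into the span of [U] and its
    orthogonal complement. *)
Definition regular U :=
  (forall c, size c = size U -> orthogonal_to U (comb c U) -> c = nseq (size U) 0) /\
  (forall v, exists2 u, Lin U u & orthogonal_to U (v - u)).

Lemma regular_nil : regular [::].
Proof.
split=> [[]|v] //; exists 0; first exact: Lin0.
by move=> x.
Qed.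

Lemma regular_nondeg U u : regular U -> Lin U u -> orthogonal_to U u -> u = 0.
Proof.
move=> [h _] /LinP[c sc ->] /h -> //; exact: comb0.
Qed.

Lemma regular_rcons U f : regular U -> orthogonal_to U f -> bform f f != 0 ->
  regular (U ++ [:: f]).
Proof.
move=> rU fU ff; have [h pr] := rU; split=> [c|v].
  rewrite size_cat /= addn1; case/lastP: c => // c a; rewrite size_rcons => -[sc].
  rewrite -cats1 comb_cat //= addr0 => o.
  have c0 : c = nseq (size U) 0.
    apply: h => // x xU; have := o x; rewrite mem_cat xU => /(_ isT).
    by rewrite (formDl FC) (formZl FC) fU // mulr0 addr0.
  have := o f; rewrite mem_cat mem_head orbT c0 comb0 add0r (formZl FC) => /(_ isT) /eqP.
  by rewrite mulf_eq0 (negPf ff) orbF => /eqP ->; elim: (size U) => //= n ->.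
have [u uU vu] := pr v; pose a := bform (v - u) f / bform f f.
exists (u + a *: f).
  by apply/Lin_cat; exists u, (a *: f); split=> //; apply/LinZ/Lin_mem; rewrite mem_head.
move=> x; rewrite opprD addrA mem_cat inE => /orP[xU|/eqP->].
  by rewrite (formBl FC) (formZl FC) vu // fU // mulr0 subr0.
by rewrite (formBl FC) (formZl FC) /a mulfVK // subrr.
Qed.

(** Adjoining a hyperbolic plane; for alternating forms this is the smallest possible extension. *)
Lemma regular_cat2 U f g : regular U -> orthogonal_to U f -> orthogonal_to U g ->
  bform f f = 0 -> bform g g = 0 -> bform f g != 0 -> regular (U ++ [:: f; g]).
Proof.
move=> rU fU gU ff gg fg; have gf := form_neq0C FC fg; have [h pr] := rU; split=> [c|v].
  rewrite size_cat /= addn2; case/lastP: c => // c b; case/lastP: c => // c a.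
  rewrite !size_rcons => -[sc]; rewrite -!cats1 -catA comb_cat //= addr0 => o.
  have c0 : c = nseq (size U) 0.
    apply: h => // x xU; have := o x; rewrite mem_cat xU => /(_ isT).
    by rewrite !(formDl FC) !(formZl FC) fU // gU // !mulr0 !addr0.
  have := o f; rewrite mem_cat mem_head orbT c0 comb0 add0r (formDl FC) !(formZl FC) ff mulr0 add0r.
  move=> /(_ isT) /eqP; rewrite mulf_eq0 (negPf gf) orbF => /eqP b0.
  have := o g; rewrite mem_cat !inE eqxx !orbT c0 comb0 add0r (formDl FC) !(formZl FC) gg mulr0 addr0.
  move=> /(_ isT) /eqP; rewrite mulf_eq0 (negPf fg) orbF => /eqP a0.
  by rewrite a0 b0; elim: (size U) => //= n ->.
have [u uU vu] := pr v.
pose a := bform (v - u) g / bform f g; pose b := bform (v - u) f / bform g f.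
exists (u + (a *: f + b *: g)).
  apply/Lin_cat; exists u, (a *: f + b *: g); split=> //.
  by apply: LinD; apply/LinZ/Lin_mem; rewrite !inE eqxx ?orbT.
have -> : v - (u + (a *: f + b *: g)) = (v - u) - (a *: f + b *: g) by rewrite opprD addrA.
move=> x; rewrite mem_cat !inE /a /b; move: vu; generalize (v - u) => w0 vu.
case/or3P=> [xU|/eqP->|/eqP->]; rewrite (formBl FC) (formDl FC) !(formZl FC).
- by rewrite (vu x xU) (fU x xU) (gU x xU) !mulr0 addr0 subr0.
- by rewrite ff mulr0 add0r mulfVK // subrr.
- by rewrite gg mulr0 addr0 mulfVK // subrr.
Qed.

(** Unlike [form_index], this admits 0 in the alternating case, since the empty sequence is
    regular. *)
Definition even_index r := alt ==> ~~ odd r.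

Definition flag U := even_index (size U) /\
  forall r, (r <= size U)%N -> even_index r -> regular (take r U).

Lemma flag_regular U : flag U -> regular U.
Proof. by move=> [i h]; rewrite -(take_size U); exact: h. Qed.

Lemma flag_nil : flag [::].
Proof.
by split=> [|r]; [rewrite /even_index implybT|rewrite leqn0 => /eqP -> _; exact: regular_nil].
Qed.

Lemma flag_rcons U f : ~~ alt -> flag U -> orthogonal_to U f -> bform f f != 0 ->
  flag (U ++ [:: f]).
Proof.
move=> nalt flU fU ff; have [i h] := flU; split=> [|r]; first by rewrite /even_index (negPf nalt).
rewrite size_cat addn1 leq_eqVlt => /orP[/eqP-> _|le_r ir].
  rewrite take_oversize ?size_cat ?addn1 //; apply: regular_rcons => //; exact: flag_regular.
by rewrite takel_cat //; exact: h.
Qed.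

Lemma flag_cat2 U f g : alt -> flag U -> orthogonal_to U f -> orthogonal_to U g ->
  bform f g != 0 -> flag (U ++ [:: f; g]).
Proof.
move=> ha flU fU gU fg; have [i h] := flU; split=> [|r].
  by move: i; rewrite /even_index size_cat addn2 /= negbK.
rewrite size_cat addn2 leq_eqVlt => /orP[/eqP-> _|].
  rewrite take_oversize ?size_cat ?addn2 //.
  by apply: regular_cat2 => //; rewrite ?(form_alt FC) //; exact: flag_regular.
rewrite ltnS leq_eqVlt => /orP[/eqP-> ir|le_r ir]; last by rewrite takel_cat //; exact: h.
by move: i ir; rewrite /even_index ha /= => ->.
Qed.

Lemma regular_split U v : regular U -> exists u w, [/\ v = u + w, Lin U u & orthogonal_to U w].
Proof.
move=> [_ /(_ v)[u uU o]]; exists u, (v - u); split=> //.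
by rewrite addrCA subrr addr0.
Qed.

Lemma orthogonal_partner U w : regular U -> orthogonal_to U w -> w != 0 ->
  exists2 y, orthogonal_to U y & bform w y != 0.
Proof.
move=> rU wU /(form_nondeg FC)[v wv].
have [u [y [E uU yU]]] := regular_split v rU; exists y => //.
by move: wv; rewrite E (formDr FC) (orthogonal_to_Lin wU uU) add0r.
Qed.

(** Only the component [w'] orthogonal to [U] matters. An alternating form adjoins [w'] with a
    partner, a symmetric form adjoins [w'] alone if it is anisotropic. An isotropic [w'] cannot come
    first, because every initial segment must be regular in the symmetric case; it is replaced by an
    orthogonal pair of anisotropic vectors whose span contains it. *)
Lemma flag_extend U w : flag U -> exists2 s, flag (U ++ s) & Lin (U ++ s) w.
Proof.
move=> flU; have rU := flag_regular flU.
have [u [w' [E uU w'U]]] := regular_split w rU.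
suff [s fl ws] : exists2 s, flag (U ++ s) & Lin (U ++ s) w'.
  by exists s => //; rewrite E; apply: LinD => //; exact: Lin_catl.
case: (eqVneq w' 0) => [->|w0].
  by exists [::]; rewrite ?cats0 //; exact: Lin0.
have [y yU wy] := orthogonal_partner rU w'U w0.
have Lin_last s z : z \in s -> Lin (U ++ s) z by move=> zs; apply/Lin_catr/Lin_mem.
case: (boolP alt) => ha.
  by exists [:: w'; y]; [exact: flag_cat2|apply: Lin_last; rewrite mem_head].
case: (eqVneq (bform w' w') 0) => [ww|ww]; last first.
  by exists [:: w']; [exact: flag_rcons|apply: Lin_last; rewrite mem_head].
have [y' y'U [wy' y'y']] : exists2 y', orthogonal_to U y' & bform w' y' != 0 /\ bform y' y' != 0.
  case: (eqVneq (bform y y) 0) => [yy|yy]; last by exists y.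
  exists (y + 1 *: w'); first exact: orthogonal_toD.
  rewrite scale1r (formDr FC) ww addr0 (formDl FC) !(formDr FC) yy ww add0r addr0.
  rewrite (form_sym FC w' y) /form_sign (negPf ha) mul1r; split=> //.
  by rewrite -mulr2n -mulr_natl mulf_neq0 // (form_two FC).
pose a := - (bform w' y' / bform y' y'); pose w2 := w' + a *: y'.
have w2U : orthogonal_to (U ++ [:: y']) w2.
  move=> x; rewrite mem_cat inE => /orP[xU|/eqP->]; first exact: (orthogonal_toD _ w'U y'U).
  by rewrite /w2 (formDl FC) (formZl FC) /a mulNr mulfVK // subrr.
have w2w2 : bform w2 w2 != 0.
  rewrite {2}/w2 (formDr FC) (formZr FC) (w2U y') ?mem_cat ?mem_head ?orbT // mulr0 addr0.
  rewrite /w2 (formDl FC) (formZl FC) ww add0r (form_sym FC w') /form_sign (negPf ha) mul1r.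
  by rewrite mulf_neq0 // oppr_eq0 mulf_neq0 // invr_eq0.
exists [:: y'; w2].
  by rewrite -cat1s catA; apply: flag_rcons => //; exact: flag_rcons.
have -> : w' = w2 + (- a) *: y' by rewrite scaleNr addrK.
by apply: LinD; [|apply: LinZ]; apply: Lin_last; rewrite !inE eqxx ?orbT.
Qed.

Lemma flag_span (b : seq V) : exists2 U, flag U & forall x, x \in b -> Lin U x.
Proof.
elim: b => [|x b [U fl hU]]; first by exists [::]; [exact: flag_nil|].
have [s fl' xs] := flag_extend x fl; exists (U ++ s) => // y; rewrite inE => /orP[/eqP->//|/hU].
exact: Lin_catl.
Qed.

(** A flag spanning [b] is extended again and again, each time so as to span a vector not yet
    reached. The stages are nested and stage [n] has at least [n] entries, so the n-th vector may be
    read in stage [n.+1]. *)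
Lemma flag_basis (b : seq V) : (forall n, ~ has_dim V n) -> exists e : nat -> V,
  (forall r, even_index r -> regular (mkseq e r)) /\
  exists2 r0, even_index r0 & forall x, x \in b -> Lin (mkseq e r0) x.
Proof.
move=> inf; have [U0 fl0 hU0] := flag_span b.
have /choice[nx hnx] U : exists s, flag U -> flag (U ++ s) /\ s <> [::].
  case: (pselect (flag U)) => fl; last by exists [::].
  have [w hw] := notin_Lin inf U; have [s fl' ws] := flag_extend w fl.
  by exists s => _; split=> // s0; apply: hw; move: ws; rewrite s0 cats0.
pose fix U n := if n is n'.+1 then U n' ++ nx (U n') else U0.
have flU n : flag (U n) by elim: n => //= n /hnx[].
have sU n : (n <= size (U n))%N.
  elim: n => //= n IH; have [_] := hnx _ (flU n); rewrite size_cat.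
  by case: (nx _) => // x s _ /=; rewrite addnS ltnS (leq_trans IH) ?leq_addr.
have preU n m : (n <= m)%N -> take (size (U n)) (U m) = U n.
  move=> /subnKC <-; elim: (m - n)%N => [|d IH]; first by rewrite addn0 take_size.
  rewrite addnS /= takel_cat //.
  have : (size (take (size (U n)) (U (n + d))) = size (U n)) by rewrite IH.
  by rewrite size_take_min => /minn_idPl.
pose e n := (U n.+1)`_n.
have eU n m : (n < size (U m))%N -> (U m)`_n = e n.
  move=> lt_n; case: (leqP m n.+1) => h.
    by rewrite /e -(preU _ _ h) nth_take.
  by rewrite /e -[in RHS](preU n.+1 m (ltnW h)) nth_take.
have mkU r m : (r <= size (U m))%N -> mkseq e r = take r (U m).
  move=> le_r; apply: (@eq_from_nth _ 0); rewrite size_mkseq ?size_takel // => i lt_i.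
  by rewrite nth_mkseq // nth_take // eU // (leq_trans lt_i).
exists e; split=> [r ir|].
  by rewrite (mkU r r (sU r)); have [_ h] := flU r; apply: h.
exists (size U0); first by have [] := fl0.
by move=> x /hU0; rewrite (mkU _ 0%N) //= take_size.
Qed.

Lemma isometry_comp W (g h : V -> V) : isometry_fixing alt W g -> isometry_fixing alt W h ->
  isometry_fixing alt W (fun x => g (h x)).
Proof. by move=> Wg Wh; elim: Wg => {g} [//|c y g cy yW _ IH]; exact: iso_move. Qed.

(** The transvection along [y = w' - w] with factor [1 / [w, y]] takes [w] to [w']. It is isometric
    because equality of the norms gives [[y, y] = - (1 + eps) [w, y]]. *)
Lemma isometry_direct U w w' : orthogonal_to U w -> orthogonal_to U w' ->
  bform w w = bform w' w' -> bform w w' != bform w w ->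
  exists2 g : V -> V, isometry_fixing alt U g & g w = w'.
Proof.
move=> wU w'U ww ne; pose y := w' - w.
have wy : bform w y != 0 by rewrite (formBr FC) subr_eq0.
have yU x : x \in U -> bform x y = 0.
  by move=> xU; apply: (form_eq0C FC); rewrite (formBl FC) wU // w'U // subrr.
exists (fun x => tau (bform w y)^-1 y x); last first.
  by rewrite /tau /transvection mulVf // scale1r addrC subrK.
apply: iso_move (iso_id _ _) => //; rewrite /isometric.
have yy : bform y y = - (1 + eps) * bform w y.
  rewrite /y !(formBl FC) !(formBr FC) (form_sym FC w w') -ww /form_sign.
  case: (boolP alt) => ha; last by ring.
  by rewrite (form_alt FC) //; ring.
by rewrite yy; field.
Qed.

Lemma Witt_vector U w w' : regular U -> orthogonal_to U w -> orthogonal_to U w' ->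
  w != 0 -> w' != 0 -> bform w w = bform w' w' ->
  exists2 g : V -> V, isometry_fixing alt U g & g w = w'.
Proof.
move=> rU wU w'U w0 w'0 ww.
case: (eqVneq (bform w w') (bform w w)) => [ww'|]; last exact: isometry_direct.
have via z : orthogonal_to U z -> bform z z = bform w w -> bform w z != bform w w ->
    bform z w' != bform w w -> exists2 g : V -> V, isometry_fixing alt U g & g w = w'.
  move=> zU zz wz zw'; have [g1 h1 E1] := isometry_direct wU zU (esym zz) wz.
  have zw'' : bform z w' != bform z z by rewrite zz.
  have [g2 h2 E2] := isometry_direct zU w'U (etrans zz ww) zw''.
  by exists (fun x => g2 (g1 x)); [exact: isometry_comp|rewrite E1].
case: (eqVneq (bform w w) 0) => [ww0|ww0]; last first.
  have nn : - bform w w != bform w w.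
    by rewrite eq_sym -subr_eq0 opprK -mulr2n -mulr_natl mulf_neq0 ?(form_two FC).
  apply: (via (- w)); rewrite ?(formNl FC) ?(formNr FC) ?opprK ?ww' //.
  by move=> x xU; rewrite (formNl FC) wU // oppr0.
have [y1 y1U wy1] := orthogonal_partner rU wU w0.
have [y2 y2U wy2] := orthogonal_partner rU w'U w'0.
(* A vector pairing nontrivially with both: if neither partner does so, their sum does. *)
have [y yU [wy w'y]] : exists2 y, orthogonal_to U y & bform w y != 0 /\ bform w' y != 0.
  case: (eqVneq (bform w' y1) 0) => [e1|]; last by exists y1.
  case: (eqVneq (bform w y2) 0) => [e2|]; last by exists y2.
  exists (y1 + 1 *: y2); first exact: orthogonal_toD.
  by rewrite scale1r !(formDr FC) e1 e2 addr0 add0r.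
(* This multiple of [w] makes [z] isotropic and leaves the products with [w] and [w'] unchanged,
   since [[w, w] = [w, w'] = 0] here. *)
pose z := y + (- (bform y y / (2%:R * bform w y))) *: w.
have two := form_two FC.
apply: (via z); rewrite ?ww0.
- exact: orthogonal_toD.
- rewrite /z (formDl FC) !(formDr FC) !(formZl FC) !(formZr FC) ww0 (form_sym FC w y) /form_sign.
  case: (boolP alt) => ha; first by rewrite (form_alt FC) // mul0r oppr0; ring.
  by field; rewrite wy two.
- by rewrite /z (formDr FC) (formZr FC) ww0 mulr0 addr0.
- rewrite /z (formDl FC) (formZl FC) ww' ww0 mulr0 addr0.
  exact: (form_neq0C FC).
Qed.

End Witt.

(** * A countable-dimensional elementary submodel and its approximating sequence *)

Section CountableModel.
Variables (F : scal_theory) (B : form_theory) (C : lstruct).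
Hypothesis adm : admissible F.
Hypothesis modC : model F B None C.
Local Notation V := (vect C).
Local Notation K := (scal C).
Local Notation alt := (is_alternating B).
Let FC : form_space C alt := model_form_space adm modC.
Variable e : nat -> V.
Hypothesis reg : forall r, even_index alt r -> regular (mkseq e r).
Implicit Types (p q : {poly K}).

(* {poly K} serves as the K-space of countable dimension, 'X^i standing for e_i. *)
Definition embp (p : {poly K}) : V := \sum_(i < size p) p`_i *: e i.

Lemma embp_widen n p : (size p <= n)%N -> embp p = \sum_(i < n) p`_i *: e i.
Proof.
move=> le_pn; rewrite /embp (big_ord_widen _ (fun i => p`_i *: e i) le_pn) big_mkcond.
by apply: eq_bigr => i _; case: ltnP => // /leq_sizeP/(_ _ (leqnn _)) ->; rewrite scale0r.
Qed.

Lemma embp_comb n p : (size p <= n)%N -> embp p = comb p (mkseq e n).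
Proof.
move=> /embp_widen ->; rewrite combE size_mkseq.
by apply: eq_bigr => i _; rewrite nth_mkseq.
Qed.

Lemma embpD p q : embp (p + q) = embp p + embp q.
Proof.
rewrite (embp_widen (size_polyD p q)) (embp_widen (leq_maxl (size p) (size q))).
rewrite (embp_widen (leq_maxr (size p) (size q))) -big_split.
by apply: eq_bigr => i _; rewrite coefD scalerDl.
Qed.

Lemma embpZ c p : embp (c *: p) = c *: embp p.
Proof.
rewrite (embp_widen (size_scale_leq c p)) /embp scaler_sumr.
by apply: eq_bigr => i _; rewrite coefZ scalerA.
Qed.

Lemma embpXn i : embp 'X^i = e i.
Proof.
rewrite /embp size_polyXn big_ord_recr /= coefXn eqxx scale1r big1 ?add0r // => j _.
by rewrite coefXn ltn_eqF // scale0r.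
Qed.

Lemma even_index_ge n : exists2 r, (n <= r)%N & even_index alt r.
Proof. by exists n.*2; [lia|rewrite /even_index odd_double implybT]. Qed.

Lemma Lin_embp n v : Lin (mkseq e n) v <-> exists2 p : {poly K}, (size p <= n)%N & v = embp p.
Proof.
split=> [/LinP[c sc ->]|[p sp ->]]; last by rewrite (embp_comb sp); exact: Lin_comb.
rewrite size_mkseq in sc.
exists (Poly c); first by rewrite -sc size_Poly.
rewrite (@embp_widen n) ?combE ?size_mkseq; last by rewrite -sc size_Poly.
by apply: eq_bigr => i _; rewrite nth_mkseq // coef_Poly.
Qed.

Lemma embp_eq0 p : embp p = 0 -> p = 0.
Proof.
move=> p0; have [r le_r ir] := even_index_ge (size p).
have [h _] := reg ir; rewrite size_mkseq in h.
have E : mkseq (nth 0 p) r = nseq r 0.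
  apply: h; first by rewrite size_mkseq.
  have -> : comb (mkseq (nth 0 p) r) (mkseq e r) = 0.
    rewrite -p0 (embp_comb le_r) !combE size_mkseq.
    by apply: eq_bigr => i _; rewrite nth_mkseq.
  by move=> x _; rewrite (form0l FC).
apply/polyP => i; rewrite coef0; case: (ltnP i r) => lt_i.
  by have := congr1 (fun l => l`_i) E; rewrite nth_mkseq // nth_nseq lt_i.
by rewrite nth_default // (leq_trans le_r).
Qed.

Lemma embp_inj : injective embp.
Proof.
move=> p q E; apply/eqP; rewrite -subr_eq0; apply/eqP/embp_eq0.
by rewrite embpD -scaleN1r embpZ E scaleN1r subrr.
Qed.

Definition polyM : lstruct := @LStruct K {poly K} (fun p q => bform (embp p) (embp q)).

Lemma basis_notin n : ~ Lin (mkseq e n) (e n).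
Proof.
move=> /Lin_embp[p sp]; rewrite -embpXn => /embp_inj E.
by move: sp; rewrite -E size_polyXn ltnn.
Qed.

(** The component [f] of [e r] orthogonal to the first [r] vectors: were it isotropic, it would be
    orthogonal to the first [r.+1] vectors while lying in their span, against regularity. *)
Lemma anisotropic_basis r : ~~ alt -> exists f,
  [/\ Lin (mkseq e r.+1) f, orthogonal_to (mkseq e r) f & bform f f != 0].
Proof.
move=> nalt; have ix n : even_index alt n by rewrite /even_index (negPf nalt).
have [u [f [E uU fU]]] := regular_split (e r) (reg (ix r)).
have erU : Lin (mkseq e r.+1) (e r).
  by apply: Lin_mem; rewrite mkseqS mem_rcons mem_head.
have uU' : Lin (mkseq e r.+1) u.
  by apply: Lin_subset uU => x xU; rewrite mkseqS mem_rcons inE xU orbT.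
have fL : Lin (mkseq e r.+1) f.
  by have := LinB erU uU'; rewrite E addrAC subrr add0r.
exists f; split=> //; apply/eqP => ff; apply: (@basis_notin r).
suff -> : e r = u by [].
rewrite E -[RHS]addr0; congr (_ + _); apply: (regular_nondeg (reg (ix r.+1)) fL) => x.
rewrite mkseqS mem_rcons inE => /orP[/eqP->|/fU//].
by rewrite E (formDr FC) ff addr0 (orthogonal_to_Lin FC fU).
Qed.

Lemma closed_sqrt : GRing.closed_field_axiom K -> forall x : K, exists y, y ^+ 2 = x.
Proof.
move=> closed x; have [y Ey] := closed 2%N (fun i => if i == 0%N then x else 0) isT.
by exists y; rewrite Ey !big_ord_recl big_ord0 /= expr0 mulr1 mul0r !addr0.
Qed.

(** Witt's theorem moves [w] only to a vector of equal norm, so the span must contain a nonzero one.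
    For alternating forms all norms are 0. For positive-definite forms the quotient of two norms is
    a square. Over an algebraically closed field one scales an anisotropic vector, or, for norm 0,
    combines two orthogonal ones with [s^2 = - [f1, f1] / [f2, f2]]. *)
Lemma same_norm r w : even_index alt r -> w != 0 -> orthogonal_to (mkseq e r) w ->
  exists p, [/\ embp p != 0, orthogonal_to (mkseq e r) (embp p) & bform (embp p) (embp p) = bform w w].
Proof.
move=> ir w0 wU; case: (boolP alt) => ha.
  have [u [f [E uU fU]]] := regular_split (e r) (reg ir).
  have [p sp Ep] : exists2 p : {poly K}, (size p <= r.+1)%N & f = embp p.
    apply/Lin_embp; have -> : f = e r - u by rewrite E addrAC subrr add0r.
    apply: LinB; first by apply: Lin_mem; rewrite mkseqS mem_rcons mem_head.
    by apply: Lin_subset uU => x xU; rewrite mkseqS mem_rcons inE xU orbT.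
  exists p; rewrite -Ep; split=> //; last by rewrite !(form_alt FC).
  by apply/eqP => f0; apply: (@basis_notin r); rewrite E f0 addr0.
have nalt := ha.
have [f1 [f1L f1U ff1]] := anisotropic_basis r ha; have [p1 _ E1] := (Lin_embp _ _).1 f1L.
have scaled s : s ^+ 2 = bform w w / bform f1 f1 -> bform w w != 0 ->
    exists p, [/\ embp p != 0, orthogonal_to (mkseq e r) (embp p) & bform (embp p) (embp p) = bform w w].
  move=> Es ww; have En : bform (embp (s *: p1)) (embp (s *: p1)) = bform w w.
    by rewrite embpZ -E1 (formZl FC) (formZr FC) mulrA -expr2 Es mulfVK.
  exists (s *: p1); split=> //.
    by apply: contraNneq ww => h; rewrite -En h (form0l FC).
  by move=> x xU; rewrite embpZ -E1 (formZl FC) f1U // mulr0.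
have [pos|closed] : (forall u : V, u != 0 -> sq_lt 0 (bform u u)) \/ GRing.closed_field_axiom K.
  have [scalK _ [_]] := modC; move: (ha); rewrite /is_alternating; case: (B) => // _ [_].
  by case: (F) scalK => [p [closed _] _|_ pos]; [right|left].
  have [z z0] := pos w w0; have f10 : f1 != 0 by apply: contraNneq ff1 => ->; rewrite (form0l FC).
  have [z1 z10] := pos f1 f10; rewrite !subr0 => E1' Ew.
  by apply: (scaled (z / z1)); rewrite Ew ?E1' ?expf_neq0 // exprMn exprVn.
case: (eqVneq (bform w w) 0) => [ww|ww]; last first.
  by have [s Es] := closed_sqrt closed (bform w w / bform f1 f1); exact: scaled Es ww.
have [f2 [/Lin_embp[p2 _ E2] f2U ff2]] := anisotropic_basis r.+1 nalt.
have f2U' : orthogonal_to (mkseq e r) f2 by move=> x xU; apply: f2U; rewrite mkseqS mem_rcons inE xU orbT.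
have f21 : bform f2 f1 = 0 by exact: (orthogonal_to_Lin FC f2U f1L).
have f12 := form_eq0C FC f21.
have [s Es] := closed_sqrt closed (- (bform f1 f1 / bform f2 f2)).
exists (p1 + s *: p2); rewrite embpD embpZ -E1 -E2; split; last 2 first.
- exact: (orthogonal_toD FC).
- rewrite !(formDl FC) !(formZl FC) !(formDr FC) !(formZr FC) f12 f21 ww !mulr0 add0r addr0.
  by rewrite mulrA -expr2 Es mulNr mulfVK // subrr.
apply: contraNneq ff1 => h.
have : bform (f1 + s *: f2) f1 = 0 by rewrite h (form0l FC).
by rewrite (formDl FC) (formZl FC) f21 mulr0 addr0 => ->.
Qed.

End CountableModel.

Section Homogeneity.
Variables (F : scal_theory) (B : form_theory) (C : lstruct).
Hypothesis adm : admissible F.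
Hypothesis modC : model F B None C.
Local Notation V := (vect C).
Local Notation K := (scal C).
Local Notation alt := (is_alternating B).
Let FC : form_space C alt := model_form_space adm modC.
Variable e : nat -> V.
Hypothesis reg : forall r, even_index alt r -> regular (mkseq e r).
Local Notation embp := (embp e).
Local Notation polyM := (polyM e).
Implicit Types (p q : {poly K}).

Lemma isometry_fix_Lin (W : seq V) (g : V -> V) x : isometry_fixing alt W g -> Lin W x -> g x = x.
Proof.
move=> Wg /LinP[c _ ->]; have [gD gZ] := isometry_linear FC Wg.
have g0 := isometry0 FC Wg.
suff h s : {subset s <= W} -> g (comb c s) = comb c s by exact: h.
elim: s c => [|y s IH] [|a c] sub //=; rewrite gD gZ (isometry_fix Wg) ?sub ?mem_head //.
by rewrite IH // => z zs; rewrite sub // inE zs orbT.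
Qed.

Lemma embp_bound (ps : seq {poly K}) : exists2 r, even_index alt r &
  forall p, p \in ps -> (size p <= r)%N.
Proof.
have [r le_r ir] := even_index_ge B (\max_(p <- ps) size p); exists r => // p pps.
exact: leq_trans (leq_bigmax_seq _ pps isT) le_r.
Qed.

(* Witt's theorem moves v into the span of the basis by an automorphism fixing
   finitely many given vectors of that span. *)
Lemma embp_homogeneous (ps : seq {poly K}) (v : V) : exists2 g : V -> V,
  isometry_fixing alt (map embp ps) g & exists p, g v = embp p.
Proof.
have [r ir le_r] := embp_bound ps.
have [u [w [E uU wU]]] := regular_split v (reg ir).
have [pu spu Eu] := (Lin_embp _ _ _).1 uU.
case: (eqVneq w 0) => [w0|w0].
  by exists id; [exact: iso_id|exists pu; rewrite E w0 addr0].
have [p [p0 pU pp]] := same_norm adm modC reg ir w0 wU.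
have [g Wg gw] := Witt_vector FC (reg ir) wU pU w0 p0 (esym pp).
have fixg x : Lin (mkseq e r) x -> g x = x by exact: isometry_fix_Lin.
have [gD _] := isometry_linear FC Wg.
exists g; last by exists (pu + p); rewrite E gD fixg // gw embpD -Eu.
elim: Wg {gw fixg gD} => {g} [|c y g cy yU _ IH]; first exact: iso_id.
apply: iso_move => // x /mapP[q qps ->].
apply: (form_Lin_eq0 FC yU); apply/Lin_embp; exists q => //; exact: le_r.
Qed.

Lemma vkeval_embp (vs : seq (vect polyM)) (ks : seq (scal polyM)) :
  (forall t, veval (map embp vs) ks t = embp (veval vs ks t)) /\
  (forall t, @keval C (map embp vs) ks t = keval vs ks t).
Proof.
have e0 : embp 0 = 0 by rewrite -(scale0r 0) embpZ scale0r.
apply: vkterm_ind => //=; try by move=> *; congruence.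
- move=> i; case: (ltnP i (size vs)) => h; first by rewrite (nth_map 0).
  by rewrite !nth_default ?size_map.
- by move=> t1 E1 t2 E2; rewrite embpD E1 E2.
- by move=> c E1 t E2; rewrite embpZ E1 E2.
Qed.

(** The Tarski-Vaught argument: a witness for a vector quantifier is moved into the span by an
    automorphism that fixes the parameters. *)
Lemma holds_embp (vs : seq (vect polyM)) (ks : seq (scal polyM)) phi :
  holds vs ks phi <-> @holds C (map embp vs) ks phi.
Proof.
elim: phi vs ks => [t1 t2|t1 t2|phi IH|phi IH psi IH'|phi IH|phi IH] vs ks /=.
- by rewrite !(vkeval_embp vs ks).1; split=> [->|/(embp_inj adm modC reg)].
- by rewrite !(vkeval_embp vs ks).2.
- by rewrite IH.
- by rewrite IH IH'.
- split=> -[v hv]; first by exists (embp v); apply/(IH (v :: vs)).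
  have [g Wg [p gv]] := embp_homogeneous vs v.
  have gvs : map g (map embp vs) = map embp vs.
    by rewrite -[RHS]map_id; apply/eq_in_map => q qvs; rewrite (isometry_fix Wg qvs).
  exists p; apply/IH; rewrite /= -gv -gvs.
  exact: (holds_isometry FC phi (v :: map embp vs) ks Wg).2.
- by split=> -[c hc]; exists c; apply/IH.
Qed.

Definition elementary_polyM : elementary polyM C.
Proof.
by apply: (@Elementary polyM C embp id) => vs ks phi; rewrite map_id; exact: holds_embp.
Defined.

Lemma countably_infinite_dim_polyM : countably_infinite_dim (vect polyM).
Proof.
exists (fun i => 'X^i); split=> [n|p].
  rewrite lin_indep_nil indepP => c; rewrite size_mkseq => sc /Lin_nil.
  rewrite combE size_mkseq => E; apply: (@eq_from_nth _ 0); rewrite ?size_nseq // => i.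
  rewrite sc => lt_i; rewrite nth_nseq lt_i.
  have E' : \poly_(i < n) c`_i = 0 :> {poly K}.
    by rewrite poly_def -[RHS]E; apply: eq_bigr => j _; rewrite nth_mkseq.
  by have := coef_poly n (fun i => c`_i) i; rewrite E' coef0 lt_i.
exists (size p), (fun i => p`_i).
rewrite -[LHS]coefK poly_def size_mkseq; apply: eq_bigr => i _.
by rewrite nth_mkseq // size_mkseq.
Qed.

(** Rows of length [r] are the polynomials of size at most [r], so this is the span of the first [r]
    basis vectors, with the field of [C] as its scalars. *)
Definition rowN r : lstruct :=
  @LStruct K 'rV[K]_r (fun u v => bform (embp (rVpoly u)) (embp (rVpoly v))).

Definition rowN_embedding r : lembedding (rowN r) polyM :=
  @LEmbedding (rowN r) polyM (rVpoly : {additive 'rV[K]_r -> {poly K}}) idfun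
    (can_inj rVpolyK) (linearZ_LR rVpoly) (fun u v => erefl).

Lemma has_dim_row r : has_dim 'rV[K]_r r.
Proof.
pose bs : seq 'rV[K]_r := [seq delta_mx 0 i | i <- enum 'I_r].
have sbs : size bs = r by rewrite size_map size_enum_ord.
have combE' c : comb c bs = \row_i c`_i.
  rewrite combE sbs [RHS]row_sum_delta; apply: eq_bigr => i _.
  by rewrite mxE (nth_map i) ?size_enum_ord // nth_ord_enum.
exists bs; split=> // [|v].
  rewrite lin_indep_nil indepP => c; rewrite sbs => sc /Lin_nil; rewrite combE' => /rowP E.
  apply: (@eq_from_nth _ 0); rewrite ?size_nseq // => i; rewrite sc => lt_i.
  by have := E (Ordinal lt_i); rewrite !mxE nth_nseq lt_i.
apply/LinP; exists [seq v 0 i | i <- enum 'I_r]; first by rewrite !size_map.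
rewrite combE'; apply/rowP => i; rewrite mxE (nth_map i) ?size_enum_ord //.
by rewrite nth_ord_enum.
Qed.

Lemma embp_row_eq0 r (u : 'rV[K]_r) : embp (rVpoly u) = 0 -> u = 0.
Proof.
by move=> /(embp_eq0 adm modC reg) h; apply: (can_inj rVpolyK); rewrite h linear0.
Qed.

Lemma rowN_model r : form_index B r -> model F B (Some r) (rowN r).
Proof.
move=> ir; have [scalK _ [bl formC]] := modC; split=> //; first exact: has_dim_row.
split.
  by split=> w c u v; rewrite /= linearP embpD embpZ ?(formDl FC) ?(formZl FC) ?(formDr FC) ?(formZr FC).
have nd : nondegenerate_form (rowN r).
  have ir' : even_index alt r by move: ir; rewrite /even_index; case: (B) => //= /andP[].
  move=> u hu; apply: embp_row_eq0.
  apply: (regular_nondeg (reg ir')).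
    by apply/Lin_embp; exists (rVpoly u) => //; exact: size_poly.
  move=> x /(@Lin_mem _ _ _ _)/Lin_embp[p sp ->]; rewrite -(poly_rV_K sp); exact: hu.
move: formC; case: (B) => [[sym pos]|[alt0 _]]; split=> //.
- by move=> u v /=; rewrite sym.
- move: pos; case: (F) => [p|] pos; first exact: nd.
  move=> u u0; apply: pos.
  by apply: contraNneq u0 => /embp_row_eq0 ->.
- by move=> u; exact: alt0.
Qed.

Lemma rowN_approximating : approximating F B (M := polyM) rowN_embedding.
Proof.
split=> [r|r _|r s _ _ le_rs p [u _ <-]|p].
- exact: rowN_model.
- by apply/seteqP; split=> // c _; exists c.
- exists (poly_rV (rVpoly u)) => //=; apply: poly_rV_K.
  exact: leq_trans (size_poly _ _) le_rs.
have [r le_r ir] : exists2 r, (size p <= r)%N & form_index B r.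
  exists (size p).+1.*2; first by lia.
  by case: (B) => //=; rewrite odd_double.
by exists r => //; exists (poly_rV p) => //=; exact: poly_rV_K.
Qed.

End Homogeneity.

(** * Saturation of the finite-dimensional submodels *)

Section Saturation.
Variables (F : scal_theory) (B : form_theory) (C : lstruct).
Hypothesis adm : admissible F.
Hypothesis modC : model F B None C.
Local Notation V := (vect C).
Local Notation K := (scal C).
Local Notation alt := (is_alternating B).
Variable e : nat -> V.
Hypothesis reg : forall r, even_index alt r -> regular (mkseq e r).
Variable r : nat.
Local Notation N := (rowN e r).
Local Notation const := (fun (i : 'I_r) (_ : unit) => e i).
Local Notation no_const := (fun (i : 'I_0) (_ : unit) => 0 : K).
Local Notation gdef := (@gdef unit (fun=> C) 'I_r 'I_0 const no_const).
Local Notation gVs := (@gVs unit (fun=> C) 'I_r 'I_0 const no_const).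
Local Notation gKs := (@gKs unit (fun=> C) 'I_r 'I_0 const no_const).

Definition embrow (u : vect N) : V := embp e (rVpoly u).

Lemma embrow_inj : injective embrow.
Proof. by move=> u v /(embp_inj adm modC reg)/(can_inj rVpolyK). Qed.

Lemma vkeval_embrow (us : seq (vect N)) (ks : seq (scal N)) :
  (forall t, veval (map embrow us) ks t = embrow (veval us ks t)) /\
  (forall t, @keval C (map embrow us) ks t = keval us ks t).
Proof.
have := @vkeval_morphism N C embrow idfun _ _ _ us ks; rewrite map_id; apply.
- by move=> u v; rewrite /embrow linearD embpD.
- by move=> c v; rewrite /embrow linearZ embpZ.
- by [].
Qed.

Lemma Lin_embrow v : Lin (mkseq e r) v <-> exists u, v = embrow u.
Proof.
rewrite Lin_embp; split=> [[p sp ->]|[u ->]]; last by exists (rVpoly u) => //; exact: size_poly.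
by exists (poly_rV p); rewrite /embrow poly_rV_K.
Qed.

Lemma vconst_basis : vconst const (enum 'I_r) tt = mkseq e r.
Proof. by rewrite /mkseq -val_enum_ord -map_comp. Qed.

Lemma in_row (vs : seq V) : (exists us, vs = map embrow us) <->
  forall v, v \in vs -> Lin (mkseq e r) v.
Proof.
split=> [[us ->] v /mapP[u _ ->]|h]; first by apply/Lin_embrow; exists u.
have [|us <-] := @seq_preimage _ _ embrow vs; last by exists us.
by move=> v /h/Lin_embrow[u ->]; exists u.
Qed.

Lemma gdef_in_row k m : gdef k m (fun _ vs _ => exists us, vs = map embrow us).
Proof.
have hb := @gVs_const unit (fun=> C) 'I_r 'I_0 const no_const k m (enum 'I_r).
apply: gdef_ext (gdef_all_Lin (gVs_var _ _ k m) hb) _ => -[] vs ks _ _.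
by rewrite in_row vconst_basis.
Qed.

(** Vector quantifiers are relativized to the span of the first [r] basis vectors, the only
    constants used. Membership in the span is part of the predicate, so that negation is taken
    inside the span. *)
Lemma gdef_row phi k m :
  gdef k m (fun _ vs ks => exists2 us, vs = map embrow us & holds (N := N) us ks phi).
Proof.
elim: phi k m => [t1 t2|t1 t2|phi IH|phi IH psi IH'|phi IH|phi IH] k m /=.
- have H := gdef_holds (VEq t1 t2) (gVs_var const no_const k m) (gKs_var const no_const k m).
  apply: gdef_ext (gdef_and (gdef_in_row k m) H) _ => [[]] vs ks _ _ /=.
  split=> [[us -> E]|[[us ->]]]; first by split; [exists us|rewrite !(vkeval_embrow us ks).1 E].
  by rewrite !(vkeval_embrow us ks).1 => /embrow_inj; exists us.
- have H := gdef_holds (KEq t1 t2) (gVs_var const no_const k m) (gKs_var const no_const k m).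
  apply: gdef_ext (gdef_and (gdef_in_row k m) H) _ => [[]] vs ks _ _ /=.
  split=> [[us -> E]|[[us ->]]]; first by split; [exists us|rewrite !(vkeval_embrow us ks).2].
  by rewrite !(vkeval_embrow us ks).2; exists us.
- apply: gdef_ext (gdef_and (gdef_in_row k m) (gdef_not (IH k m))) _ => [[]] vs ks _ _.
  split=> [[us -> h]|[[us ->] h]]; last by exists us => // h'; apply: h; exists us.
  by split=> [|[us' /(inj_map embrow_inj) <-]//]; exists us.
- apply: gdef_ext (gdef_and (IH k m) (IH' k m)) _ => [[]] vs ks _ _.
  split=> [[us -> [h h']]|[[us -> h] [us' /(inj_map embrow_inj) <- h']]]; last by exists us.
  by split; exists us.
- apply: gdef_ext (@gdef_exV _ _ _ _ _ _ k m (fun _ v vs ks =>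
    exists2 us, v :: vs = map embrow us & holds us ks phi) _) _ => [|[] vs ks _ _].
    by apply: gdef_ext (IH k.+1 m) _ => [[]] [|v vs].
  split=> [[us -> [u h]]|[v [[|u us] //= [Ev ->] h]]]; last by exists us => //; exists u.
  by exists (embrow u), (u :: us).
- apply: gdef_ext (@gdef_exK _ _ _ _ _ _ k m (fun _ c vs ks =>
    exists2 us, vs = map embrow us & holds us (c :: ks) phi) _) _ => [|[] vs ks _ _].
    by apply: gdef_ext (IH k m.+1) _ => [[]] vs [|c ks].
  split=> [[us -> [c h]]|[c [us -> h]]]; first by exists c, us.
  by exists us => //; exists c.
Qed.

(** The submodel is definable in [C] from [r] vectors with its full structure, so a finitely
    satisfiable type over finitely many parameters translates into one of [C], and a realization
    there comes from the submodel. *)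
Lemma rowN_saturated : aleph0_saturated C -> aleph0_saturated N.
Proof.
move=> satC k m pv pk Phi fin.
have /choice[psi hpsi] phi : exists psi : formula, forall (vs : seq V) (ks : seq K),
    size vs = (k + size pv)%N -> size ks = (m + size pk)%N ->
    ((exists2 us, vs = map embrow us & holds (N := N) us ks phi) <->
     holds (vs ++ mkseq e r) ks psi).
  have [s [s' /(_ (enum 'I_r) [::])]] := gdef_row phi (k + size pv) (m + size pk).
  case=> [i _|i|psi h].
  - have : i \in enum 'I_r by rewrite mem_enum.
    elim: (enum _) => //= j l IH; rewrite inE => /orP[/eqP->|/IH]; first by left.
    by right.
  - by have := ltn_ord i.
  - by exists psi => vs ks sv sk; have := h tt vs ks sv sk; rewrite vconst_basis cats0.
have hdef phi (y : pt C k m) : defset (psi phi) (map embrow pv ++ mkseq e r) pk y <->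
    exists2 x : pt N k m, y = pt_map embrow id x & defset phi pv pk x.
  rewrite /defset /= catA -hpsi ?size_cat ?size_tuple ?size_map //; split.
    move=> [us E h].
    have E1 : map embrow (take k us) = y.1.
      by rewrite map_take -E take_size_cat ?size_tuple.
    have E2 : drop k us = pv.
      by apply: (inj_map embrow_inj); rewrite map_drop -E drop_size_cat ?size_tuple.
    have s1 : size (take k us) = k by rewrite -(size_map embrow) E1 size_tuple.
    have [x [x1 x2]] := pt_of_seqs (N := N) s1 (size_tuple y.2).
    exists x; first by apply: pt_eq; rewrite /= ?map_id ?x1 ?x2.
    by move: h; rewrite /defset /= x1 x2 -E2 cat_take_drop.
  move=> [x -> h]; exists (x.1 ++ pv); first by rewrite map_cat.
  by rewrite /= map_id.
(* Membership in the submodel is carried by each translated formula, so the empty type is treated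
   apart. *)
case: (pselect (exists phi0, Phi phi0)) => [[phi0 hphi0]|none]; last first.
  have [x _] := fin 0%N (fun=> KEq KZero KZero) (fun i => False_ind _ (notF (ltn_ord i))).
  by exists x => phi hphi; case: none; exists phi.
have [|y hy] := satC k m (map embrow pv ++ mkseq e r) pk [set psi phi | phi in Phi].
  move=> n f hf; have /choice[g hg] i : exists phi, Phi phi /\ psi phi = f i.
    by have [phi] := hf i; exists phi.
  have [x hx] := fin n g (fun i => (hg i).1).
  by exists (pt_map embrow id x) => i; rewrite -(hg i).2; apply/hdef; exists x.
have /hdef[x Ex _] : defset (psi phi0) (map embrow pv ++ mkseq e r) pk y by apply: hy; exists phi0.
exists x => phi hphi; have /hdef[x' Ex' h] : defset (psi phi) (map embrow pv ++ mkseq e r) pk y.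
  by apply: hy; exists phi.
suff -> : x = x' by [].
have E : pt_map embrow id x = pt_map embrow id x' by rewrite -Ex.
case: x x' E {Ex Ex' h} => [x1 x2] [x1' x2'] [] E1 E2.
congr pair; apply: val_inj; first exact: (inj_map embrow_inj E1).
by move: E2; rewrite /= !map_id.
Qed.

End Saturation.

(** * The upper bound *)

(** No elements are named: the resulting formula is the same for all parameters, which are passed as
    arguments. *)
Definition definable_uniformly (N : lstruct) k m (P : seq (vect N) -> seq (scal N) -> Prop) :=
  gdef (N := fun _ : unit => N) (fun v _ => of_void _ v) (fun c _ => of_void _ c) k m
    (fun _ vs ks => P vs ks).

Lemma definable_uniformlyP (N : lstruct) k m (P : seq (vect N) -> seq (scal N) -> Prop) :
  definable_uniformly k m P -> exists phi, forall vs ks, size vs = k -> size ks = m ->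
  (P vs ks <-> holds vs ks phi).
Proof.
move=> [s [s' h]]; have [[]//|[]//|phi hphi] := h [::] [::].
by exists phi => vs ks sv sk; have := hphi tt vs ks sv sk; rewrite !cats0.
Qed.

Section GeneratedSets.
Variables (N : lstruct) (k m : nat) (il : seq nat).
Local Notation V := (vect N).
Local Notation K := (scal N).
Hypothesis il_k : all (fun i => i < k)%N il.

Definition generated_set (b : seq V) : set (pt N k m) :=
  [set x : pt N k m | forall v, v \in val x.1 -> Lin ([seq x.1`_i | i <- il] ++ b) v].

(* The scalars of generated_set are coded by multiples of u. *)
Definition coded_set (b : seq V) (u : V) : set (pt N (k + m) 0) :=
  [set y : pt N (k + m) 0 | (forall v, v \in take k y.1 -> Lin ([seq y.1`_i | i <- il] ++ b) v) /\
           forall v, v \in drop k y.1 -> Lin [:: u] v].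

Lemma nth_cat_il (s t : seq V) : size s = k -> [seq (s ++ t)`_i | i <- il] = [seq s`_i | i <- il].
Proof. by move=> sk; apply/eq_in_map => i /(allP il_k) lt_i; rewrite nth_cat sk lt_i. Qed.

Lemma generated_set_def l l' : exists phi, forall (b : seq V) (c : seq K),
  size b = l -> size c = l' -> generated_set b = defset phi b c.
Proof.
have [|phi hphi] := @definable_uniformlyP N (k + l) (m + l') (fun vs ks =>
    forall v, v \in take k vs -> Lin ([seq (take k vs)`_i | i <- il] ++ drop k vs) v).
  have hv := gVs_var (N := fun _ : unit => N) (fun v _ => of_void _ v) (fun c _ => of_void _ c) (k + l) (m + l').
  apply: gdef_all_Lin (gVs_take hv) (gVs_cat _ (gVs_drop hv)).
  by apply: gVs_map => i; exact: gV_nth (gVs_take hv).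
exists phi => b c sb sc; apply/seteqP; split=> x.
  move=> h; apply/hphi; rewrite ?size_cat ?size_tuple ?sb ?sc //.
  by rewrite take_size_cat ?drop_size_cat ?size_tuple.
move=> /hphi; rewrite ?size_cat ?size_tuple ?sb ?sc => /(_ erefl erefl).
by rewrite take_size_cat ?drop_size_cat ?size_tuple.
Qed.

Lemma coded_set_def l : exists phi, forall (b : seq V) (u : V), size b = l ->
  coded_set b u = defset phi (b ++ [:: u]) [::].
Proof.
have [|phi hphi] := @definable_uniformlyP N (k + (m + (l + 1))) 0 (fun vs ks =>
    (forall v, v \in take k vs ->
       Lin ([seq vs`_i | i <- il] ++ take l (drop m (drop k vs))) v) /\
    forall v, v \in take m (drop k vs) -> Lin (drop l (drop m (drop k vs))) v).
  have hv := gVs_var (N := fun _ : unit => N) (fun v _ => of_void _ v) (fun c _ => of_void _ c) (k + (m + (l + 1))) 0.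
  have hd := gVs_drop (gVs_drop hv).
  apply: gdef_and.
    apply: gdef_all_Lin (gVs_take hv) (gVs_cat _ (gVs_take hd)).
    by apply: gVs_map => i; exact: gV_nth hv.
  exact: gdef_all_Lin (gVs_take (gVs_drop hv)) (gVs_drop hd).
exists phi => b u sb.
have E (y : pt N (k + m) 0) : let vs := y.1 ++ b ++ [:: u] in
  [/\ size vs = (k + (m + (l + 1)))%N, take k vs = take k y.1,
    take m (drop k vs) = drop k y.1, drop m (drop k vs) = b ++ [:: u] &
    [seq vs`_i | i <- il] = [seq y.1`_i | i <- il]].
  have [y1 [y2 [-> s1 s2]]] : exists y1 y2, [/\ y.1 = y1 ++ y2 :> seq V, size y1 = k & size y2 = m].
    exists (take k y.1), (drop k y.1); rewrite cat_take_drop size_drop size_takel size_tuple ?leq_addr //.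
    by rewrite addKn.
  rewrite /= -catA; split; rewrite ?take_size_cat ?drop_size_cat ?take_size_cat ?drop_size_cat //.
    by rewrite !size_cat s1 s2 sb.
  by rewrite !nth_cat_il.
have Ek (y : pt N (k + m) 0) : y.2 = [::] :> seq K by case: (y) => y1 y2; rewrite /= (tuple0 y2).
have H y : coded_set b u y <-> defset phi (b ++ [:: u]) [::] y.
  have [sv E1 E2 E3 E4] := E y.
  by rewrite /defset /= Ek /= -hphi // E1 E2 E3 E4 take_size_cat // drop_size_cat.
by apply/seteqP; split=> y /H.
Qed.

Lemma vecs1 (u : V) (c : seq K) : vecs [:: u] (size c) c = [seq a *: u | a <- c].
Proof. by elim: c => //= a c IH; rewrite take0 drop0 IH /= addr0. Qed.

Lemma coded_set_bijection (b : seq V) (u : V) : u != 0 ->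
  def_bijection (generated_set b) (coded_set b u).
Proof.
move=> u0; have code_size (x : pt N k m) : size (x.1 ++ vecs [:: u] m x.2) == (k + m)%N.
  by rewrite size_cat size_vecs size_tuple.
pose f (x : pt N k m) : pt N (k + m) 0 := (Tuple (code_size x), [tuple]).
exists f.
  split.
  - move=> x hx; rewrite /coded_set /=; rewrite take_size_cat ?drop_size_cat ?size_tuple //.
    rewrite nth_cat_il ?size_tuple //; split=> //.
    by apply: (vecs_Lin _ _).2; exists x.2; rewrite size_vecs ?size_tuple ?muln1.
  - move=> x x' _ _ [] /eqP; rewrite eqseq_cat ?size_tuple // => /andP[/eqP E1 /eqP E2].
    apply: pt_eq => //; have := vecs1 u x.2; have := vecs1 u x'.2.
    rewrite !size_tuple -E2 => -> /esym; apply: inj_map => a a' /eqP; by rewrite -subr_eq0 -scalerBl scaler_eq0 (negPf u0) orbF subr_eq0 => /eqP.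
  - move=> y [h1 h2].
    have sd : size (drop k y.1) = m by rewrite size_drop size_tuple addKn.
    have stk : size (take k y.1) = k by rewrite size_takel // size_tuple leq_addr.
    have [z sz Ez] := (vecs_Lin _ _).1 h2; rewrite sd /= muln1 in sz Ez.
    have [x [x1 x2]] := pt_of_seqs (N := N) stk sz.
    have Ey : y.1 = x.1 ++ vecs [:: u] m x.2 :> seq V by rewrite x1 x2 -Ez cat_take_drop.
    exists x; last first.
      by apply: pt_eq => //=; case: (y) => y1 y2; rewrite (tuple0 y2).
    by rewrite /generated_set /= -(nth_cat_il (drop k y.1)) ?x1 ?cat_take_drop //.
have H : @dfn N (k + (k + m)) (m + 0) (fun vs ks =>
    (forall v, v \in take k vs -> Lin ([seq (take k vs)`_i | i <- il] ++ b) v) /\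
    drop k vs = take k vs ++ vecs [:: u] m ks).
  have hv := dVs_var N (k + (k + m)) (m + 0).
  have hc (s : seq V) : @dVs N (k + (k + m)) (m + 0) (size s) (fun _ _ => s).
    by apply: gVs_ext (gVs_const _ _ _ _ s) _ => -[] vs ks _ _; rewrite /vconst map_id.
  apply: gdef_and.
    apply: gdef_all_Lin (gVs_take hv) (gVs_cat _ (hc b)).
    by apply: gVs_map => i; exact: gV_nth (gVs_take hv).
  apply: gdef_eqVs (gVs_drop hv) (gVs_cat (gVs_take hv) _).
  apply: gVs_vecs (hc [:: u]) _; rewrite muln1.
  by rewrite -[X in gKs _ _ _ _ X]addn0; exact: dKs_var.
have {H} := definable_dfn H; congr definable; apply/seteqP; split=> w /=.
  move=> [h E]; have [] := @pt_of_seqs N k m (take k w.1) w.2.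
  - by rewrite size_takel // size_tuple leq_addr.
  - by rewrite size_tuple addn0.
  move=> x [x1 x2]; exists x; first by rewrite /generated_set /= x1.
  apply: pt_eq; rewrite /= ?cats0 ?x2 // -{1}(cat_take_drop k w.1) E x1.
  by rewrite ?x2.
move=> [x hx ->] /=; rewrite cats0 take_size_cat ?drop_size_cat ?size_tuple //.
Qed.

End GeneratedSets.

Section UpperBound.
Variables (F : scal_theory) (B : form_theory).
Hypothesis adm : admissible F.

Lemma definable_coded_set (N : lstruct) k m il (b : seq (vect N)) u :
  all (fun i => i < k)%N il -> definable (coded_set (k := k) (m := m) il b u).
Proof.
move=> il_k; have [phi h] := @coded_set_def N k m il il_k (size b).
by exists phi, (b ++ [:: u]), [::]; split=> //; exact: h.
Qed.

(** A point is given by [size il * r] coordinates of the distinguished vectors, by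
    [size il + size b] coefficients for each of the [k] vectors of its first part, and by [m]
    multiples of [u]. Only the first number depends on [r]. *)
Lemma coded_set_rank (N : lstruct) k m r il (b : seq (vect N)) u :
  all (fun i => i < k)%N il -> model F B (Some r) N -> (F <> RCF -> aleph0_saturated N) ->
  exists2 z, rk F (coded_set (k := k) (m := m) il b u) z &
    z <= (size il * r + (k * (size il + size b) + m))%:Z.
Proof.
move=> il_k mod satN; have FN := model_form_space adm mod.
have [FK [bs [sbs free spanning]] _] := mod; have [ws [sws dual]] := dual_basis FN free.
apply: (rk_upper FN spanning free sws dual FK) => //; first exact: definable_coded_set.
pose Q := (size il + size b)%N.
pose S (t : seq (scal N)) := vecs bs (size il) (take (size il * r) t) ++ b.
pose P t := vecs (S t) k (take (k * Q) (drop (size il * r) t)) ++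
  vecs [:: u] m (drop (k * Q) (drop (size il * r) t)).
apply: (gdim_param FN spanning free sws dual FK (P := P)).
  have hv := dKs_var N 0 (size il * r + (k * Q + m)).
  have hc (s : seq (vect N)) : @dVs N 0 (size il * r + (k * Q + m)) (size s) (fun _ _ => s).
    by apply: gVs_ext (gVs_const _ _ _ _ s) _ => -[] vs ks _ _; rewrite /vconst map_id.
  have hS : @dVs N 0 (size il * r + (k * Q + m)) Q (fun _ ks => S ks).
    apply: gVs_cat (hc b); apply: gVs_vecs (hc bs) _; rewrite sbs; exact: gKs_take hv.
  apply: gVs_cat (gVs_vecs hS (gKs_take (gKs_drop hv))) (gVs_vecs (hc [:: u]) _).
  by rewrite muln1; exact: gKs_drop (gKs_drop hv).
move=> y [hy1 hy2].
have st : size (take k y.1) = k by rewrite size_takel // size_tuple leq_addr.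
have sd : size (drop k y.1) = m by rewrite size_drop size_tuple addKn.
have [z1 sz1 E1] := (vecs_Lin _ _).1 hy1; have [z2 sz2 E2] := (vecs_Lin _ _).1 hy2.
rewrite st size_cat size_map in sz1 E1; rewrite sd /= muln1 in sz2 E2.
pose z0 := coords ws [seq y.1`_i | i <- il].
have sz0 : size z0 = (size il * r)%N by rewrite (size_coords sws) size_map sbs.
exists (z0 ++ z1 ++ z2); first by rewrite !size_cat sz0 sz1 sz2.
rewrite /P /S !take_size_cat // !drop_size_cat // take_size_cat //.
by rewrite /z0 (coordsK spanning dual) ?size_map // -E1 -E2 cat_take_drop.
Qed.

Variable C : lstruct.
Hypothesis modC : model F B None C.
Hypothesis satC : aleph0_saturated C.
Local Notation V := (vect C).
Local Notation alt := (is_alternating B).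
Let FC : form_space C alt := model_form_space adm modC.

Lemma embrow0 (e : nat -> V) r : embrow (e := e) (r := r) 0 = 0.
Proof. by rewrite /embrow linear0 /embp size_poly0 big_ord0. Qed.

Lemma coded_set_embrow e r k m il (b : seq (vect (rowN e r))) u
    (x : pt (rowN e r) (k + m) 0) : (forall r, even_index alt r -> regular (mkseq e r)) ->
  coded_set il (map (@embrow C e r) b) (embrow u) (pt_map (@embrow C e r) id x) <->
  coded_set il b u x.
Proof.
move=> reg; have emb_inj := embrow_inj adm modC reg (r := r).
have L W v : Lin (map (@embrow C e r) W) (embrow v) <-> Lin W v.
  have D (v1 v2 : vect (rowN e r)) : embrow (v1 + v2) = embrow v1 + embrow v2 :> V by rewrite /embrow linearD embpD.
  have Z (c : scal C) (w : vect (rowN e r)) : embrow (c *: w) = idfun c *: embrow w :> V by rewrite /embrow linearZ embpZ.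
  split; last by move/(Lin_semilinear D (embrow0 e r) Z).
  by apply: (Lin_semilinear_inv D (embrow0 e r) Z) => // c; exists c.
have all_emb (l W : seq (vect (rowN e r))) :
    (forall v, v \in map (@embrow C e r) l -> Lin (map (@embrow C e r) W) v) <->
    (forall v, v \in l -> Lin W v).
  split=> h v; first by move=> vl; apply/L/h/map_f.
  by move=> /mapP[w wl ->]; apply/L/h.
have E : [seq (map (@embrow C e r) x.1)`_i | i <- il] ++ map (@embrow C e r) b =
    map (@embrow C e r) ([seq x.1`_i | i <- il] ++ b).
  rewrite map_cat -map_comp; congr cat; apply: eq_map => i /=.
  rewrite (@nth_map_default _ _ 0) //; exact: embrow0.
rewrite /coded_set /= -map_take -map_drop E.
by rewrite !all_emb (all_emb (drop k x.1) [:: u]).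
Qed.

(** The basis is built so that some initial segment spans [b] and an arbitrary nonzero [u]. From
    that index on, the trace of the coded set on a submodel is the coded set computed there, and the
    rank bound applies with a constant independent of [r]. *)
Lemma generated_set_dim k m il (b : seq V) : all (fun i => i < k)%N il ->
  exists f D, dim_set F B (generated_set (k := k) (m := m) il b) (germ B f) /\
    exists n0, forall r, (n0 <= r)%N -> form_index B r -> f r <= (size il * r)%:Z + D%:Z.
Proof.
move=> il_k; have [_ inf_dim _] := modC.
have [u hu] := notin_Lin inf_dim [::].
have u0 : u != 0 by apply/eqP => u0; apply: hu; rewrite u0; exact: Lin0.
have [e [reg [r0 ir0 hr0]]] := flag_basis FC (u :: b) inf_dim.
pose D := (k * (size il + size b) + m)%N.
pose X' := coded_set (k := k) (m := m) il b u.
pose Z r := [set x : pt (rowN e r) (k + m) 0 | X' (pt_map (@embrow C e r) id x)].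
have HZ r : (r0 <= r)%N -> form_index B r -> exists2 z, rk F (Z r) z & z <= (size il * r)%:Z + D%:Z.
  move=> le_r ir; have [us] : exists us, u :: b = map (@embrow C e r) us.
    apply/in_row => v /hr0; apply: Lin_subset => w /mapP[i]; rewrite mem_iota => /andP[_ lt_i] ->.
    by apply: map_f; rewrite mem_iota /= (leq_trans lt_i).
  case: us => // u' b' [Eu Eb].
  have -> : Z r = coded_set il b' u'.
    by apply/seteqP; split=> x; rewrite /Z /= /X' Eu Eb; move/(coded_set_embrow _ _ _ _ reg).
  have := coded_set_rank m b' u' il_k (rowN_model adm modC reg ir) (fun _ => rowN_saturated adm modC reg satC).
  by rewrite PoszD /D Eb size_map.
have /choice[f hf] r : exists z, (r0 <= r)%N -> form_index B r ->
    rk F (Z r) z /\ z <= (size il * r)%:Z + D%:Z.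
  case: (boolP ((r0 <= r)%N && form_index B r)) => [/andP[le ir]|/negP h].
    by have [z hz zD] := HZ r le ir; exists z.
  by exists 0 => le ir; case: h; rewrite le ir.
exists f, D; split; last by exists r0 => r le ir; have [] := hf r le ir.
exists (k + m)%N, X'; split; [exact: definable_coded_set|exact: coded_set_bijection|].
exists (polyM e), (elementary_polyM adm modC reg), (rowN e), (rowN_embedding e), f; split=> //.
- exact: countably_infinite_dim_polyM.
- have [phi hphi] := @coded_set_def C k m il il_k (size b).
  exists phi, (b ++ [:: u]), [::]; split=> // [v|]; last exact: hphi.
  rewrite mem_cat inE => hv; have /hr0/Lin_embp[p _ ->] : v \in u :: b.
    by rewrite inE orbC.
  by exists p.
- exact: (rowN_approximating adm modC reg).
- exists r0 => r le ir; have [h _] := hf r le ir; congr (rk F _ _): h.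
  apply/seteqP; split=> x; congr (X' _); apply: pt_eq; rewrite /= ?map_id -?map_comp //.
Qed.

End UpperBound.

(** * The dimension of a type *)

Section MaximalIndependence.
Variables (K : fieldType) (V : lmodType K).
Implicit Types (a b s t : seq V).

Lemma indep_uniq b s : lin_indep_over (Lin b) s -> uniq s.
Proof.
elim: s => //= x s IH /indep_cons[hx /IH ->]; rewrite andbT.
by apply/negP => xs; apply: hx; apply/Lin_catl/Lin_mem.
Qed.

Lemma maximal_indep_exists a b : exists s, maximal_indep a b s.
Proof.
have [s [sa indep_s span]] := maximal_indep_sublist b a; exists s; split=> // t ta indep_t st.
have le_ts : (size t <= size s)%N by apply: (Steinitz indep_t) => x /ta/span.
have [_ E] := uniq_min_size (indep_uniq indep_s) st le_ts.
by move=> x; rewrite E.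
Qed.

Lemma maximal_indep_span a b s : maximal_indep a b s -> forall x, x \in a -> Lin (s ++ b) x.
Proof.
move=> [sa indep_s max] x xa; apply: contrapT => hx; apply: (hx).
apply/Lin_catl/Lin_mem; apply: (max (x :: s)); last exact: mem_head.
- by move=> y; rewrite inE => /orP[/eqP->|/sa].
- exact/indep_cons.
- by move=> y ys; rewrite inE ys orbT.
Qed.

End MaximalIndependence.

Section Germs.
Variable B : form_theory.

Lemma germ_refl f : germ B f f.
Proof. by exists 0%N. Qed.

Lemma germ_leP f g : germ_le B (germ B f) (germ B g) <-> eventually_rel B (fun x y => x <= y) f g.
Proof.
split=> [[f' [g' [[n1 h1] [n2 h2] [n3 h3]]]]|h]; last first.
  by exists f, g; split=> //; exact: germ_refl.
exists (maxn n1 (maxn n2 n3)) => n; rewrite !geq_max => /and3P[le1 le2 le3] i_n.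
by rewrite h1 // h2 // h3.
Qed.

Lemma cut_lin_germ d0 d1 d0' d1' : cut B (lin_germ B d0 d1) (lin_germ B d0' d1') <->
  eventually_rel B (fun x y => x <= y) (fun n => d0' + d1' * n%:Z) (fun n => d0 + d1 * n%:Z).
Proof.
split=> [[_ /germ_leP //]|h]; split; last exact/germ_leP.
by exists d0', d1'.
Qed.

End Germs.

Theorem proposition5p2 (F : scal_theory) (B : form_theory) (C : lstruct)
    (k m k' m' : nat) (a : pt C k m) (b : pt C k' m') (d0 d1 : int) :
  admissible F ->
  model F B None C ->
  aleph0_saturated C ->
  dim_over F B a b = cut B (lin_germ B d0 d1) ->
  lin_dim_eq a.1 b.1 d1.
Proof.
move=> adm modC satC dim_ab; split; first exact: maximal_indep_exists.
move=> s max_s; have [sa indep_s _] := max_s; have span_a := maximal_indep_span max_s.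
have FC := model_form_space adm modC; have [_ inf_dim _] := modC.
have upper : d1 <= (size s)%:Z.
  pose il := [seq index x a.1 | x <- s].
  have Eil : [seq a.1`_i | i <- il] = s.
    rewrite -map_comp -[RHS]map_id; apply/eq_in_map => x /sa; exact: nth_index.
  have il_k : all (fun i => i < k)%N il.
    by apply/allP => _ /mapP[x /sa xa ->]; have := index_mem x a.1; rewrite size_tuple xa.
  have [f [D [dimX [n0 le_f]]]] := generated_set_dim adm modC satC m b.1 il_k.
  have [phi hphi] := @generated_set_def C k m il k' m'.
  (* The class belongs to its own cut, so it lies below the dimension of every formula implied by
     the type; the formula of the generated set is one of these, being satisfied by [a]. *)
  have /germ_leP[n1 h] : germ_le B (lin_germ B d0 d1) (germ B f).
    have : cut B (lin_germ B d0 d1) (lin_germ B d0 d1) by apply/cut_lin_germ; exists 0%N.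
    rewrite -dim_ab => -[_]; apply; exists phi; last by rewrite -(hphi b.1 b.2) ?size_tuple.
    move=> C1 e x b1 h; apply: h; rewrite /tp /= -(hphi b.1 b.2) ?size_tuple //.
    by rewrite /generated_set /= Eil.
  rewrite leNgt; apply/negP => lt_s.
  (* If [d1] exceeded [size s], the inequalities d0 + d1 n <= f n <= size s n + D would give n <= D
     - d0, which fails from D + |d0| + 1 on. *)
  have [n le_n i_n] := form_index_ge B (maxn n0 (maxn n1 (D + `|d0| + 1))).
  move: le_n; rewrite !geq_max => /and3P[le_n0 le_n1 le_n].
  have : ((size s)%:Z + 1) * n%:Z <= d1 * n%:Z by apply: ler_wpM2r => //; lia.
  have := h n le_n1 i_n; have := le_f n le_n0 i_n; rewrite size_map PoszM /=; lia.
apply/eqP; rewrite eq_le upper andbT leNgt; apply/negP => lt_d1.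
(* If [d1] is too small, even the class with constant term raised by 1 lies below all dimensions in
   the type, hence in the infimum, which is absurd. *)
have : cut B (lin_germ B d0 d1) (lin_germ B (d0 + 1) d1).
  rewrite -dim_ab; split=> [|S [phi impl_phi [k1 [X' [dX' hbij dim_X']]]]]; first by exists (d0 + 1), d1.
  (* Implication is tested in all elementary extensions, in particular in [C] itself at the point
     [a]. *)
  have a_phi : defset phi b.1 b.2 a.
    have := impl_phi C (elementary_refl C) a; rewrite /= !map_id; apply=> psi; by [].
  have low psi pv pk : X' = defset psi pv pk -> exists (x' : pt C k1 0) (t : seq (vect C)),
     [/\ X' x', {subset t <= x'.1}, size t = size s & lin_indep_over (Lin pv) t].
    move=> EX'; exact: (bijection_indep FC inf_dim erefl EX' hbij a_phi sa indep_s).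
  have [f [c [-> [n0 le_f]]]] := dim_vect_set_lower adm low dim_X'.
  (* For such n the surplus of at least n in (size s) n over d1 n absorbs both the constant term d0
     + 1 and the loss [c] of the lower bound. *)
  apply/germ_leP; exists (maxn n0 (`|d0 + 1| + c)) => n; rewrite geq_max => /andP[le_n0 le_n] i_n.
  have : (d1 + 1) * n%:Z <= (size s)%:Z * n%:Z by apply: ler_wpM2r => //; lia.
  have := le_f n le_n0 i_n; rewrite PoszM; lia.
move=> /cut_lin_germ[n0 h]; have [n le_n i_n] := form_index_ge B n0.
have := h n le_n i_n; lia.
Qed.
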